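(* The following assertions hold. (i) There exists a Riemannian metric $g_{BLS}$ on the $2$-torus $T^2$ admitting a sequence $f_{i_j}$ of Laplace eigenfunctions corresponding to eigenvalues $\lambda_{i_j}\to\infty$ as $j\to\infty$, such that $m_0(f_{i_j}-c_{i_j})=+\infty$ for some constants $c_{i_j}$, for all $j\ge1$. (ii) For $T^4=T^2\times T^2$ endowed with $g_{BLS}\oplus g_{BLS}$, the eigenfunctions $u_{i_j}=f_{i_j}\oplus(-f_{i_j})$, i.e. $u_{i_j}(x,y)=f_{i_j}(x)-f_{i_j}(y)$, satisfy $m_1(u_{i_j})=+\infty$ for all $j\ge1$. (iii) Let $g_{BLS}\oplus g_{st}$ be the Riemannian metric on $T^3=T^2\times S^1$, where $g_{st}$ is the standard metric on the unit circle. Put $f=f_{i_1}-c_{i_1}$ and $\lambda=\lambda_{i_1}$. Then the eigenfunctions $h_j(x,y)=f(x)\sin(jy)$ of the non-negative fourth order elliptic operator $$D=\Delta^2-\lambda\Delta_x+\lambda^2/4$$ on $T^3$, with eigenvalues $\lambda_j=j^4+\lambda^2/4$, satisfy $m_0(h_j)=+\infty$ for all $j\ge1$.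
   Context: For a function $f$ on a manifold $M$, $Z_f=\{f=0\}$ and $m_r(f)=\dim H_r(M\setminus Z_f)$, where $H_r$ is the $r$-th singular homology with coefficients in a field. Laplacians are non-negative: $\Delta f=-\operatorname{div}(\nabla f)$ is the Laplace-Beltrami operator of the given Riemannian metric. In (iii), points of $T^3=T^2\times S^1$ are written $(x,y)$, $\Delta$ is the Laplace-Beltrami operator of $(T^3,g_{BLS}\oplus g_{st})$, and $\Delta_x$ denotes the Laplace-Beltrami operator of $(T^2,g_{BLS})$ acting in the variable $x\in T^2$.
   Formalization: In (iii), D is taken as Δ_x²+Δ_y²−λΔ_x+λ²/4, with Δ_y the Laplacian of S¹, i.e. without the cross term 2Δ_xΔ_y of Δ²; with Δ the full Laplacian of T³, h_j would not satisfy Dh_j=(j⁴+λ²/4)h_j, since a nonzero term 2j²λ f_{i_1}(x) sin(jy) is added. *)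

(* Defs.v *)
From HB Require Import structures.
From mathcomp Require Import all_boot all_order all_algebra generic_quotient.
From mathcomp Require Import all_classical all_reals all_analysis.
From mathcomp.multinomials Require Import freeg.

Set Implicit Arguments.
Unset Strict Implicit.
Unset Printing Implicit Defensive.

Import Order.TTheory GRing.Theory Num.Theory.
Import numFieldNormedType.Exports.

Local Open Scope classical_set_scope.
Local Open Scope ring_scope.

(* The torus T^n = R^n / (2 pi Z)^n, with the quotient topology.  The circle  *)
(* T^1 carries its arc-length coordinate, so the standard metric of the unit  *)
(* circle is dy^2; T^m x T^n is T^(m + n) through row_mx.                     *)

Section Torus.
Variables (R : realType) (n : nat).

Definition period (k : 'rV[int]_n) : 'rV[R]_n :=
  (2 * pi) *: map_mx intr k.

Definition torus_rel (x y : 'rV[R]_n) : bool :=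
  `[< exists k : 'rV[int]_n, y = x + period k >].

Lemma torus_rel_refl : reflexive torus_rel.
Proof. by move=> x; apply/asboolP; exists 0; rewrite /period map_mx0 scaler0 addr0. Qed.

Lemma torus_rel_sym : symmetric torus_rel.
Proof.
suff H x y : torus_rel x y -> torus_rel y x by move=> x y; apply/idP/idP; exact: H.
move=> /asboolP[k ->]; apply/asboolP; exists (- k).
by rewrite /period map_mxN scalerN addrK.
Qed.

Lemma torus_rel_trans : transitive torus_rel.
Proof.
move=> y x z /asboolP[k ->] /asboolP[l ->]; apply/asboolP; exists (k + l).
by rewrite /period map_mxD scalerDr addrA.
Qed.

Definition torus_equiv : equiv_rel 'rV[R]_n :=
  EquivRel torus_rel torus_rel_refl torus_rel_sym torus_rel_trans.

Definition torus : topologicalType := quotient_topology {eq_quot torus_equiv}%qT.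

Definition torus_proj (x : 'rV[R]_n) : torus := (\pi_{eq_quot torus_equiv} x)%qT.

End Torus.

(* Singular homology of a topological space X over K. *)

Definition std_simplex (R : realType) (r : nat) : set 'rV[R]_r.+1 :=
  [set p | (forall i, 0 <= p 0 i) /\ \sum_i p 0 i = 1].
Arguments std_simplex : clear implicits.

Section SingularHomology.
Variables (R : realType) (K : fieldType).

(* The i-th face inserts a zero barycentric coordinate at position i. *)
Definition face_coords r (i : 'I_r.+2) (p : 'rV[R]_r.+1) : 'rV[R]_r.+2 :=
  \row_k oapp (p 0) 0 (unlift i k).

Lemma face_coordsP r (i : 'I_r.+2) (p : std_simplex R r) :
  face_coords i (set_val p) \in std_simplex R r.+1.
Proof.
have /set_mem[p0 p1] := valP p; apply/mem_set; split.
  by move=> k; rewrite mxE; case: unliftP => [j _|_] //=; exact: p0.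
rewrite (bigD1_ord i) //= mxE unlift_none /= add0r -[RHS]p1.
by apply: eq_bigr => j _; rewrite mxE liftK.
Qed.

Definition face_fun r (i : 'I_r.+2) (p : std_simplex R r) : std_simplex R r.+1 :=
  exist _ (face_coords i (set_val p)) (face_coordsP i p).

Lemma face_fun_continuous r (i : 'I_r.+2) : continuous (@face_fun r i).
Proof.
apply: continuous_comp_initial => p.
apply: (@continuous_comp _ _ _ set_val (face_coords i) p).
  exact: initial_continuous.
move=> A [P Pnbhs sPA].
suff : nbhs (set_val p) [set q | forall a k, P a k (face_coords i q a k)].
  by apply: filterS => q Pq; exact: sPA.
have fc a k : continuous (fun q : 'rV[R]_r.+1 => face_coords i q a k).
  move=> q; rewrite /face_coords; under eq_fun do rewrite mxE.
  case: unliftP => [j _|_] /=; [exact: coord_continuous|exact: cst_continuous].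
apply: (@filter_forall _ _ (fun a q => forall k, P a k (face_coords i q a k))
  (nbhs (set_val p)) _) => a.
apply: (@filter_forall _ _ (fun k q => P a k (face_coords i q a k))
  (nbhs (set_val p)) _) => k.
exact: fc (Pnbhs a k).
Qed.

HB.instance Definition _ r (i : 'I_r.+2) :=
  isContinuous.Build _ _ (@face_fun r i) (@face_fun_continuous r i).

Definition face r (i : 'I_r.+2) :
  continuousType (std_simplex R r) (std_simplex R r.+1) := @face_fun r i.

Definition singular_simplex (X : topologicalType) (r : nat) :=
  continuousType (std_simplex R r) X.

Definition chain (X : topologicalType) (r : nat) :=
  {freeg (singular_simplex X r) / K}.

Definition simplex_boundary X r (s : singular_simplex X r.+1) : chain X r :=
  \sum_(i < r.+2) (-1) ^+ i *: << (s \o face i : singular_simplex X r) >>.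

Definition boundary X r : chain X r.+1 -> chain X r :=
  fglift (@simplex_boundary X r).

Definition is_cycle X r : chain X r -> Prop :=
  if r is r'.+1 then fun z => boundary z = 0 else fun=> True.

(* There are N cycles whose classes are linearly independent in H_r(X; K). *)
Definition homology_dim_geq X r (N : nat) : Prop :=
  exists z : 'I_N -> chain X r,
    (forall i, is_cycle (z i)) /\
    forall a : 'I_N -> K,
      (exists b : chain X r.+1, \sum_i a i *: z i = boundary b) ->
      forall i, a i = 0.

Definition homology_dim X r : \bar R :=
  ereal_sup [set N%:R%:E | N in homology_dim_geq X r].

End SingularHomology.

(* Functions on T^n are identified with (2 pi Z)^n-periodic functions on R^n. *)

Section Functions.
Variables (R : realType) (n : nat).
Implicit Types (f h : 'rV[R]_n -> R) (x : 'rV[R]_n).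

Definition pderiv (i : 'I_n) f : 'rV[R]_n -> R :=
  fun x => 'D_(delta_mx 0 i) f x.

Definition iter_pderiv (s : seq 'I_n) f : 'rV[R]_n -> R := foldr pderiv f s.

Definition torus_smooth f : Prop :=
  [/\ forall k x, f (x + period R k) = f x,
      forall s, continuous (iter_pderiv s f) &
      forall s x i, derivable (iter_pderiv s f) x (delta_mx 0 i)].

(* T^n \ Z_f *)
Definition nodal_compl f : set (torus R n) :=
  ~` (torus_proj (n := n) @` [set x | f x = 0]).

Definition nodal_betti (K : fieldType) (r : nat) f : \bar R :=
  homology_dim R K (nodal_compl f) r.

(* A metric is given by its matrix in the global frame of coordinate fields. *)
Definition riemannian_metric (g : 'rV[R]_n -> 'M[R]_n) : Prop :=
  [/\ forall i j, torus_smooth (fun x => g x i j),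
      forall x, (g x)^T = g x &
      forall x (v : 'rV[R]_n), v != 0 -> 0 < (v *m g x *m v^T) 0 0].

Definition vol_density (g : 'rV[R]_n -> 'M[R]_n) x : R :=
  Num.sqrt (\det (g x)).

Definition gradient (g : 'rV[R]_n -> 'M[R]_n) f : 'rV[R]_n -> 'rV[R]_n :=
  fun x => \row_i \sum_j invmx (g x) i j * pderiv j f x.

Definition divergence (g : 'rV[R]_n -> 'M[R]_n) (V : 'rV[R]_n -> 'rV[R]_n)
    : 'rV[R]_n -> R :=
  fun x => (vol_density g x)^-1 *
    \sum_i pderiv i (fun y => vol_density g y * V y 0 i) x.

Definition laplace (g : 'rV[R]_n -> 'M[R]_n) f : 'rV[R]_n -> R :=
  fun x => - divergence g (gradient g f) x.

Definition eigenfunction (D : ('rV[R]_n -> R) -> 'rV[R]_n -> R) (lam : R) f :=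
  [/\ torus_smooth f, exists x, f x != 0 & forall x, D f x = lam * f x].

(* D = \sum_(k <= m) \sum_(s_1, ..., s_k) a_s d_(s_1) ... d_(s_k) is a linear *)
(* differential operator of order m with invertible principal symbol.         *)
Definition elliptic (m : nat) (D : ('rV[R]_n -> R) -> 'rV[R]_n -> R) : Prop :=
  exists a : seq 'I_n -> 'rV[R]_n -> R,
    [/\ forall s, torus_smooth (a s),
        forall h, torus_smooth h -> forall x,
          D h x = \sum_(k < m.+1) \sum_(s : k.-tuple 'I_n)
                    a s x * iter_pderiv s h x &
        forall x (xi : 'rV[R]_n), xi != 0 ->
          \sum_(s : m.-tuple 'I_n) a s x * \prod_(i <- s) xi 0 i != 0].

End Functions.

(* Integral over the fundamental domain [0, 2 pi]^n, as an iterated integral. *)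
Fixpoint torus_integral (R : realType) (n : nat) : ('rV[R]_n -> R) -> R :=
  match n with
  | 0%N => fun h => h 0
  | k.+1 => fun h => \int[lebesgue_measure]_(t in `[0, 2 * pi])
      torus_integral (fun x : 'rV[R]_k => h (row_mx (const_mx t : 'rV_1) x))
  end.

Definition nonnegative (R : realType) (n : nat) (g : 'rV[R]_n -> 'M[R]_n)
    (D : ('rV[R]_n -> R) -> 'rV[R]_n -> R) : Prop :=
  forall h, torus_smooth h ->
    0 <= torus_integral (fun x => h x * D h x * vol_density g x).

Section Product.
Variables (R : realType) (m n : nat).

Definition metric_sum (g1 : 'rV[R]_m -> 'M[R]_m) (g2 : 'rV[R]_n -> 'M[R]_n) :
    'rV[R]_(m + n) -> 'M[R]_(m + n) :=
  fun z => block_mx (g1 (lsubmx z)) 0 0 (g2 (rsubmx z)).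

Definition fun_sum (f1 : 'rV[R]_m -> R) (f2 : 'rV[R]_n -> R) :
    'rV[R]_(m + n) -> R :=
  fun z => f1 (lsubmx z) + f2 (rsubmx z).

(* Laplacians of the factors, acting in one variable, the other being fixed. *)
Definition laplace_fst (g1 : 'rV[R]_m -> 'M[R]_m) (h : 'rV[R]_(m + n) -> R) :
    'rV[R]_(m + n) -> R :=
  fun z => laplace g1 (fun x => h (row_mx x (rsubmx z))) (lsubmx z).

Definition laplace_snd (g2 : 'rV[R]_n -> 'M[R]_n) (h : 'rV[R]_(m + n) -> R) :
    'rV[R]_(m + n) -> R :=
  fun z => laplace g2 (fun y => h (row_mx (lsubmx z) y)) (rsubmx z).

End Product.

Definition g_st (R : realType) : 'rV[R]_1 -> 'M[R]_1 := fun=> 1%:M.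

(* Delta_x^2 + Delta_y^2 - lam Delta_x + lam^2/4 on T^2 x S^1: the square of  *)
(* Delta = Delta_x + Delta_y is taken factorwise.  With Delta_x F = lam F,    *)
(* this maps h = (F - c) sin(j y) to (j^4 + lam^2/4) h, whereas the cross     *)
(* term 2 Delta_x Delta_y would add 2 j^2 lam F sin(j y).                     *)
Definition bls_operator (R : realType) (g : 'rV[R]_2 -> 'M[R]_2) (lam : R)
    (h : 'rV[R]_(2 + 1) -> R) : 'rV[R]_(2 + 1) -> R :=
  fun z => laplace_fst g (laplace_fst g h) z
         + laplace_snd (@g_st R) (laplace_snd (@g_st R) h) z
         - lam * laplace_fst g h z + lam ^+ 2 / 4 * h z.

(* Main.v *)
Require Import Defs.
From mathcomp.multinomials Require Import freeg.
From HB Require Import structures.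
From mathcomp Require Import all_boot all_order all_algebra.
From mathcomp Require Import all_classical all_reals all_analysis.
From mathcomp Require Import ring lra zify.

Set Implicit Arguments.
Unset Strict Implicit.
Unset Printing Implicit Defensive.

Import Order.TTheory GRing.Theory Num.Theory.
Import numFieldNormedType.Exports.

Local Open Scope classical_set_scope.
Local Open Scope ring_scope.

                                                                                                        
                                                                                       
                                                                                                      
                                                                                                         
                                                                                                
                                                                                              
                                                                                                            
                                                                                                   
                                                                                                      
                                                     

                                                                                                    
                                                                                                       
                                                                                                           
                                                                                                      

                                                                                      

                                      

                                                                                             
Section Derivation.
Variables (R : realType) (V : normedModType R).
Implicit Types (f g : V -> R) (x v : V).

Lemma isd_eq f x v a b : is_derive x v f a -> a = b -> is_derive x v f b.
Proof. by move=> h <-. Qed.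

Lemma isdD f g x v a b : is_derive x v f a -> is_derive x v g b ->
  is_derive x v (fun y => f y + g y) (a + b).
Proof. by move=> hf hg; exact: is_deriveD. Qed.

Lemma isdB f g x v a b : is_derive x v f a -> is_derive x v g b ->
  is_derive x v (fun y => f y - g y) (a - b).
Proof. by move=> hf hg; exact: is_deriveB. Qed.

Lemma isdN f x v a : is_derive x v f a -> is_derive x v (fun y => - f y) (- a).
Proof. by move=> hf; exact: is_deriveN. Qed.

Lemma isdM f g x v a b : is_derive x v f a -> is_derive x v g b ->
  is_derive x v (fun y => f y * g y) (a * g x + f x * b).
Proof.
move=> hf hg; apply: isd_eq (is_deriveM hf hg) _.
by rewrite /GRing.scale /= addrC mulrC.
Qed.

Lemma isdC (k : R) x v : is_derive x v (fun=> k) 0.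
Proof. exact: is_derive_cst. Qed.

Lemma isdZ (k : R) f x v a : is_derive x v f a ->
  is_derive x v (fun y => k * f y) (k * a).
Proof. by move=> hf; apply: isd_eq (isdM (isdC k x v) hf) _; rewrite mul0r add0r. Qed.

Lemma isdV f x v a : f x != 0 -> is_derive x v f a ->
  is_derive x v (fun y => (f y)^-1) (- a / f x ^+ 2).
Proof.
move=> f0 [hf hd]; split; first exact: derivableV.
by rewrite deriveV // hd /GRing.scale /= -exprVn [LHS]mulNr mulNr mulrC.
Qed.

Lemma isdX f n x v a : is_derive x v f a ->
  is_derive x v (fun y => f y ^+ n.+1) (n.+1%:R * f x ^+ n * a).
Proof.
move=> hf; elim: n => [|n IH].
  by apply: isd_eq hf _; rewrite expr0 !mul1r.
rewrite (_ : (fun y => _) = (fun y => f y * f y ^+ n.+1)).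
  apply: isd_eq (isdM hf IH) _.
  by rewrite mulrC [n.+2%:R]mulrS [f x * _]mulrA [f x * _]mulrCA -exprS !mulrDl mul1r.
by apply/funext => y; rewrite exprS.
Qed.

Lemma isd_sum n (f : 'I_n -> V -> R) (a : 'I_n -> R) x v :
  (forall i, is_derive x v (f i) (a i)) ->
  is_derive x v (fun y => \sum_i f i y) (\sum_i a i).
Proof.
elim: n f a => [|n IH] f a h.
  rewrite big_ord0 (_ : (fun y => _) = (fun=> 0)); first exact: isdC.
  by apply/funext => y; rewrite big_ord0.
rewrite big_ord_recl (_ : (fun y => _) = (fun y => f ord0 y + \sum_(i < n) f (fintype.lift ord0 i) y)).
  by apply: isdD => //; exact: IH.
by apply/funext => y; rewrite big_ord_recl.
Qed.

Lemma isd_line f x v a : is_derive x v f a <->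
  is_derive (0 : R) 1 (fun t : R => f (t *: v + x)) a.
Proof.
have E : (fun h : R => h^-1 *: (((fun t : R => f (t *: v + x)) \o shift (0 : R)) (h *: (1 : R)) - f (0 *: v + x)))
       = (fun h => h^-1 *: ((f \o shift x) (h *: v) - f x)).
  by apply/funext => h /=; rewrite addr0 scale0r add0r [h *: 1]mulr1.
split=> -[d1 d2]; split.
- by move: d1; rewrite /derivable E.
- by rewrite -d2 /derive E.
- by move: d1; rewrite /derivable E.
- by rewrite -d2 /derive E.
Qed.

Lemma isd_comp (u : R -> R) f x v a b : is_derive (f x) 1 u a ->
  is_derive x v f b -> is_derive x v (fun y => u (f y)) (a * b).
Proof.
move=> hu /isd_line hf; apply/isd_line.
apply: (@is_derive1_comp R u (fun t : R => f (t *: v + x))) => //.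
by rewrite scale0r add0r.
Qed.

End Derivation.

Section Real.
Variable R : realType.
Implicit Types (f g F : R -> R) (x y : R).

Lemma isd_id x : is_derive x 1 (fun y : R => y) 1.
Proof. exact: is_derive_id. Qed.

Lemma isd_cont f f' : (forall x, is_derive x 1 f (f' x)) -> continuous f.
Proof.
move=> h x; apply: differentiable_continuous.
by apply/derivable1_diffP; case: (h x).
Qed.

Lemma isd_within f f' (A : set R) : (forall x, is_derive x 1 f (f' x)) ->
  {within A, continuous f}.
Proof. by move=> h; apply: continuous_subspaceT; exact: isd_cont h. Qed.

Lemma isd_MVT f f' (a b : R) : (forall x, is_derive x 1 f (f' x)) -> a < b ->
  exists2 c, a < c < b & f b - f a = f' c * (b - a).
Proof.
move=> h ab; have [c cab E] := MVT ab (fun x _ => h x) (isd_within h).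
by exists c => //; move: cab; rewrite in_itv.
Qed.

Lemma isd_ndecr f f' (a b : R) : (forall x, is_derive x 1 f (f' x)) ->
  (forall x, a < x < b -> 0 <= f' x) -> a <= b -> f a <= f b.
Proof.
move=> h h0; rewrite le_eqVlt => /predU1P[->//|ab].
have [c cab E] := isd_MVT h ab.
by rewrite -subr_ge0 E mulr_ge0 ?h0 // subr_ge0 ltW.
Qed.

Lemma isd_nincr f f' (a b : R) : (forall x, is_derive x 1 f (f' x)) ->
  (forall x, a < x < b -> f' x <= 0) -> a <= b -> f b <= f a.
Proof.
move=> h h0 ab; rewrite -lerN2.
apply: (@isd_ndecr (fun x => - f x) (fun x => - f' x)) => // x xab.
by rewrite oppr_ge0 h0.
Qed.

Lemma isd_eq_cst f : (forall x, is_derive x 1 f 0) -> forall x y, f x = f y.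
Proof. move=> h x y; exact: is_derive_0_is_cst. Qed.

Lemma isd_shift f (a x d : R) : is_derive (x + a) 1 f d ->
  is_derive x 1 (fun t => f (t + a)) d.
Proof.
move=> h; rewrite -[d]mulr1.
apply: (@isd_comp R R f (fun t => t + a)) => //.
by apply: isd_eq (isdD (isd_id x) (isdC a x 1)) _; rewrite addr0.
Qed.

Lemma gronwall (v v' : R -> R) (C B y : R) :
  (forall x, is_derive x 1 v (v' x)) -> 0 <= B -> 0 <= C -> 0 <= y ->
  (forall x, 0 < x < y -> v' x <= C * v x + B) ->
  v y <= (v 0 + B * y) * expR (C * y).
Proof.
move=> h B0 C0 y0 hv.
have de x : is_derive x 1 (fun t : R => expR (- C * t)) (- C * expR (- C * x)).
  rewrite mulrC; apply: (@isd_comp R R expR (fun t => - C * t)).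
  apply: isd_eq (isdZ (- C) (isd_id x)) _; by rewrite mulr1.
have := @isd_nincr (fun x => v x * expR (- C * x) - B * x)
  (fun x => v' x * expR (- C * x) + v x * (- C * expR (- C * x)) - B * 1) 0 y.
have -> : v 0 * expR (- C * 0) - B * 0 = v 0 by rewrite !mulr0 expR0 mulr1 subr0.
move=> /(_ _ _ y0) H.
have {H} : v y * expR (- C * y) - B * y <= v 0.
  apply: H => [x|x /andP[x0 xy]].
    exact: (isdB (isdM (h x) (de x)) (isdZ B (isd_id x))).
  rewrite mulr1 subr_le0 mulrA -mulrDl mulrN [v x * C]mulrC.
  apply: (@le_trans _ _ (B * expR (- C * x))).
    rewrite ler_wpM2r ?expR_ge0 // lerBlDl; apply: hv; exact/andP.
  rewrite -{2}[B]mulr1 ler_wpM2l // -(expR0 R) ler_expR mulNr oppr_le0.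
  by rewrite mulr_ge0 // ltW.
rewrite lerBlDr => H.
have e1 : expR (- C * y) * expR (C * y) = 1 by rewrite -expRD mulNr addNr expR0.
by rewrite -[v y]mulr1 -e1 mulrA ler_wpM2r ?expR_ge0.
Qed.

Lemma convex_min (f f' f'' : R -> R) :
  (forall x, is_derive x 1 f (f' x)) -> (forall x, is_derive x 1 f' (f'' x)) ->
  (forall x, 0 <= f'' x) -> f' 0 = 0 ->
  (forall x, 0 <= x -> 0 <= f' x) /\ (forall x, x <= 0 -> f' x <= 0) /\
  forall x, f 0 <= f x.
Proof.
move=> h1 h2 h0 f0.
have A x : 0 <= x -> 0 <= f' x.
  by move=> x0; rewrite -f0; apply: isd_ndecr h2 _ x0.
have B x : x <= 0 -> f' x <= 0.
  by move=> x0; rewrite -f0; apply: isd_ndecr h2 _ x0.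
split=> //; split=> // x; have [x0|x0] := leP 0 x.
  by apply: isd_ndecr h1 _ x0 => t /andP[t0 _]; apply: A; exact: ltW.
by apply: isd_nincr h1 _ (ltW x0) => t /andP[_ t0]; apply: B; exact: ltW.
Qed.

End Real.

Section Limits.
Variable R : realType.
Implicit Types (f g F : R -> R) (x y : R).

Lemma isd_of_sq f (x d M : R) :
  (forall h, `|h| <= 1 -> `|f (h + x) - f x - h * d| <= M * h ^+ 2) ->
  is_derive x 1 f d.
Proof.
move=> H.
have M0 : 0 <= M.
  by have := H 1; rewrite normr1 expr1n mulr1 => /(_ (lexx _)); apply: le_trans.
suff C : (fun h : R => h^-1 *: ((f \o shift x) (h *: (1 : R)) - f x)) h @[h --> 0^'] --> d.
  split; first by apply/cvg_ex; exists d; exact: C.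
  by apply: cvg_lim => //; exact: C.
apply/cvgrPdist_le => e e0; near=> h.
have h0 : h != 0 by near: h; exact: nbhs_dnbhs_neq.
have h1 : `|h| <= 1 by near: h; apply: dnbhs0_le.
have h2 : `|h| <= e / (M + 1).
  by near: h; apply: dnbhs0_le; rewrite divr_gt0 // ltr_pwDr.
rewrite /= [h *: 1]mulr1 -[_ *: _]/(_ * _).
have -> : d - h^-1 * (f (h + x) - f x) = - (h^-1 * (f (h + x) - f x - h * d)).
  by field.
rewrite normrN normrM normfV ler_pdivrMl ?normr_gt0 //.
apply: (le_trans (H h h1)); rewrite -real_normK ?num_real // expr2 mulrCA.
rewrite ler_wpM2l // (le_trans (ler_wpM2l M0 h2)) //.
by rewrite mulrA ler_pdivrMr; nra.
Unshelve. all: by end_near. Qed.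

Lemma taylor1 (F F' F'' : R -> R) (x h M : R) :
  (forall y, is_derive y 1 F (F' y)) -> (forall y, is_derive y 1 F' (F'' y)) ->
  (forall y, `|y - x| <= `|h| -> `|F'' y| <= M) ->
  `|F (h + x) - F x - h * F' x| <= M * h ^+ 2.
Proof.
move=> h1 h2 hM.
have M0 : 0 <= M by apply: le_trans (hM x _); rewrite // subrr normr0.
pose G y := F y - (y - x) * F' x.
have dG y : is_derive y 1 G (F' y - F' x).
  apply: isd_eq (isdB (h1 y) (isdM (isdB (isd_id y) (isdC x y 1)) (isdC (F' x) y 1))) _.
  by rewrite mulr0 addr0 subr0 mul1r.
have lip y : `|y - x| <= `|h| -> `|F' y - F' x| <= M * `|h|.
  move=> yx; have [xy|xy|->] := ltgtP x y; last by rewrite subrr normr0 mulr_ge0.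
    have [c /andP[c1 c2] ->] := isd_MVT h2 xy.
    rewrite normrM ler_pM // hM // (le_trans _ yx) //.
    by rewrite !gtr0_norm ?subr_gt0 // lerB // ltW.
  have [c /andP[c1 c2] E] := isd_MVT h2 xy.
  rewrite distrC E normrM ler_pM // ?hM // ?(le_trans _ yx) //; last by rewrite distrC.
  by rewrite !ltr0_norm ?subr_lt0 // lerN2 lerB // ltW.
have -> : F (h + x) - F x - h * F' x = G (h + x) - G x.
  by rewrite /G addrK subrr mul0r subr0 addrAC.
rewrite -real_normK ?num_real // expr2 mulrA.
have [h0|h0|->] := ltgtP h 0; last by rewrite add0r subrr normr0 mulr0.
  have [|c /andP[c1 c2] E] := isd_MVT dG (_ : h + x < x); first by rewrite gtrDr.
  rewrite distrC E normrM opprD addrCA subrr addr0 normrN ler_wpM2r // lip //.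
  by rewrite ltr0_norm ?subr_lt0 // ltr0_norm // lerN2 lerBrDr ltW.
have [|c /andP[c1 c2] E] := isd_MVT dG (_ : x < h + x); first by rewrite ltrDr.
rewrite E normrM addrK ler_wpM2r // lip //.
by rewrite gtr0_norm ?subr_gt0 // gtr0_norm // lerBlDr ltW.
Qed.

Lemma isd_limit (F F' F'' : nat -> R -> R) f (l x M : R) :
  (forall n y, is_derive y 1 (F n) (F' n y)) ->
  (forall n y, is_derive y 1 (F' n) (F'' n y)) ->
  (forall n y, `|y - x| <= 1 -> `|F'' n y| <= M) ->
  (forall y, F n y @[n --> \oo] --> f y) -> F' n x @[n --> \oo] --> l ->
  is_derive x 1 f l.
Proof.
move=> h1 h2 hM c1 c2; apply: (@isd_of_sq f x l M) => h hh.
have C : `|F n (h + x) - F n x - h * F' n x| @[n --> \oo] --> `|f (h + x) - f x - h * l|.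
  apply: cvg_norm; apply: cvgB; first by apply: cvgB; exact: c1.
  by apply: cvgM => //; exact: cvg_cst.
apply: (cvgr_to_le C); near=> n; apply: taylor1 (h1 n) (h2 n) _ => y yx.
by apply: hM; exact: le_trans hh.
Unshelve. all: by end_near. Qed.

Lemma eq_deriv_itv f g h (a b x y : R) :
  (forall t, a < t < b -> is_derive t 1 f (h t)) ->
  (forall t, a < t < b -> is_derive t 1 g (h t)) ->
  a < x < b -> a < y < b -> f x - g x = f y - g y.
Proof.
move=> df dg.
suff H u v : a < u < b -> a < v < b -> u < v -> f u - g u = f v - g v.
  by move=> xab yab; have [xy|xy|->//] := ltgtP x y; [|symmetry]; exact: H.
move=> /andP[au ub] /andP[av vb] uv.
have D t : u <= t <= v -> is_derive t 1 (fun s => f s - g s) (h t - h t).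
  move=> /andP[ut tv].
  have tab : a < t < b by rewrite (lt_le_trans au ut) (le_lt_trans tv vb).
  by apply: isdB; [exact: df|exact: dg].
have [||c _] := @MVT R (fun s => f s - g s) (fun t => h t - h t) u v uv.
- move=> t; rewrite in_itv => /andP[t1 t2]; apply: D; rewrite !ltW //.
- apply: derivable_within_continuous => t; rewrite in_itv => tt.
  by case: (D t tt).
by rewrite subrr mul0r => /eqP; rewrite subr_eq0 => /eqP.
Qed.

Lemma cont_integrable f (a b : R) : continuous f ->
  lebesgue_measure.-integrable `[a, b] (EFin \o f).
Proof.
move=> cf; apply: continuous_compact_integrable; first exact: segment_compact.
exact: continuous_subspaceT.
Qed.

Lemma FTC1_cont f (A x : R) : continuous f -> - A < x ->
  is_derive x 1 (fun y => \int[lebesgue_measure]_(t in `[- A, y]) f t) (f x).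
Proof.
move=> cf Ax.
have x1 : x < x + 1 by rewrite ltrDl.
have [d1 d2] := continuous_FTC1_closed x1 (@cont_integrable f (- A) (x + 1) cf) Ax (cf x).
by split; [exact: d1|rewrite -derive1E; exact: d2].
Qed.

Lemma primitive f : continuous f ->
  exists F : R -> R, F 0 = 0 /\ forall x, is_derive x 1 F (f x).
Proof.
move=> cf.
have [I dI] : exists I : R -> R -> R,
    forall A t : R, - A < t < A -> is_derive t 1 (I A) (f t).
  exists (fun A y => \int[lebesgue_measure]_(t in `[- A, y]) f t).
  by move=> A t /andP[At _]; exact: FTC1_cont.
pose F x := I (`|x| + 1) x - I (`|x| + 1) 0.
exists F; split; first by rewrite /F subrr.
move=> x; pose A : R := `|x| + 2.
have Ex (y : R) : `|y| < `|x| + 1 -> F y = I A y - I A 0.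
  move=> yx; rewrite /F; set B : R := `|y| + 1.
  have BA : B <= A by rewrite /A /B; lra.
  have yB : - B < y < B by rewrite -ltr_norml /B; lra.
  have B0 : - B < 0 < B by apply/andP; split; rewrite /B; have := normr_ge0 y; lra.
  have dB t : - B < t < B -> is_derive t 1 (I A) (f t).
    by move=> /andP[t1 t2]; apply: dI; apply/andP; split; lra.
  have E := eq_deriv_itv (dI B) dB yB B0.
  by apply/eqP; rewrite -subr_eq0; apply/eqP; move: E; lra.
have dA : is_derive x 1 (fun y => I A y - I A 0) (f x).
  apply: isd_eq (isdB (dI A x _) (isdC (I A 0) x 1)) _; last by rewrite subr0.
  by rewrite -ltr_norml /A; lra.
apply: near_eq_is_derive dA; near=> y; rewrite [RHS]Ex //.
near: y.
have : `|x| < `|x| + 1 by rewrite ltrDl.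
move=> /(cvgr_lt _ (cvg_norm (@cvg_id _ (nbhs x)))).
exact.
Unshelve. all: by end_near. Qed.
End Limits.

                                     

Lemma geo_series (R : realType) (a : nat -> R) (C : R) :
  (forall k, `|a k| <= C * (2^-1) ^+ k) ->
  (exists l : R, (\sum_(k < n) a k) @[n --> \oo] --> l) /\
  forall n, `|\sum_(k < n) a k| <= 2 * C.
Proof.
move=> h.
have C0 : 0 <= C by have := h 0%N; rewrite expr0 mulr1; exact: le_trans.
have gs n : \sum_(k < n) (C * (2^-1) ^+ k) <= 2 * C.
  rewrite -mulr_sumr mulrC ler_wpM2r //.
  suff -> : \sum_(k < n) 2^-1 ^+ k = 2 - 2 * 2^-1 ^+ n :> R.
    by rewrite gerBl mulr_ge0 // exprn_ge0 // invr_ge0.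
  elim: n => [|n IH]; first by rewrite big_ord0 expr0 mulr1 subrr.
  by rewrite big_ord_recr /= IH exprS; field.
split; last first.
  move=> n; apply: (le_trans (ler_norm_sum _ _ _)); apply: le_trans (gs n).
  by apply: ler_sum => i _; exact: h.
have : cvgn (series a).
  apply: normed_cvg; apply: (@series_le_cvg _ _ (geometric C 2^-1)).
  - by move=> n /=.
  - by move=> n /=; rewrite mulr_ge0 // exprn_ge0 // invr_ge0.
  - by move=> n; exact: h.
  - by apply: is_cvg_geometric_series; rewrite gtr0_norm ?invr_gt0 // invf_lt1 // ltr1n.
move=> /cvg_ex[l hl]; exists l.
rewrite (_ : (fun n => _) = series a) //.
by apply/funext => n; rewrite seriesEord.
Qed.

Section OdeExistence.
Variables (R : realType) (q q' : R -> R) (Q Q1 lam alpha beta : R).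
Hypothesis dq : forall x : R, is_derive x 1 q (q' x).
Hypothesis qQ : forall x : R, `|q x| <= Q.
Hypothesis qQ1 : forall x : R, `|q' x| <= Q1.

Let La : R := `|lam| * Q + 1.
Let mu : R := Num.sqrt (2 * La).
Let E (x : R) := expR (mu * x) + expR (- mu * x).
Let E' (x : R) := mu * (expR (mu * x) - expR (- mu * x)).
Let K : R := `|alpha| + `|beta| / mu.

Let Q0 : 0 <= Q. Proof. exact: le_trans (qQ 0). Qed.
Let La0 : 0 < La. Proof. by rewrite /La ltr_pwDr // mulr_ge0. Qed.
Let mu0 : 0 < mu. Proof. by rewrite /mu sqrtr_gt0 mulr_gt0. Qed.
Let mu2 : mu * mu = 2 * La.
Proof. by rewrite -expr2 sqr_sqrtr // ltW // mulr_gt0. Qed.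
Let K0 : 0 <= K. Proof. by rewrite /K addr_ge0 // divr_ge0 // ltW. Qed.
Let dexp (c x : R) : is_derive x 1 (fun t => expR (c * t)) (c * expR (c * x)).
Proof.
rewrite mulrC; apply: (@isd_comp R R expR (fun t => c * t)).
by apply: isd_eq (isdZ c (isd_id x)) _; rewrite mulr1.
Qed.
Let dE (x : R) : is_derive x 1 E (E' x).
Proof. by apply: isd_eq (isdD (dexp mu x) (dexp (- mu) x)) _; rewrite /E'; ring. Qed.
Let dE' (x : R) : is_derive x 1 E' (2 * La * E x).
Proof.
apply: isd_eq (isdZ mu (isdB (dexp mu x) (dexp (- mu) x))) _.
by rewrite -mu2 /E; ring.
Qed.
Let E_gt x : 0 < E x. Proof. by rewrite addr_gt0 // expR_gt0. Qed.
Let E_lin x : 1 + mu * `|x| <= E x.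
Proof.
have [x0|x0] := leP 0 x.
  rewrite ger0_norm // (le_trans (expR_ge1Dx _)) // lerDl expR_ge0 //.
rewrite ltr0_norm // mulrN -mulNr (le_trans (expR_ge1Dx _)) // lerDr expR_ge0 //.
Qed.
Let E'_le x : `|E' x| <= mu * E x.
Proof.
rewrite /E' normrM gtr0_norm // ler_wpM2l ?(ltW mu0) //.
by rewrite (le_trans (ler_normB _ _)) // !ger0_norm ?expR_ge0.
Qed.

Let prim : exists P : (R -> R) -> (R -> R),
  forall f : R -> R, continuous f -> P f 0 = 0 /\ forall x : R, is_derive x 1 (P f) (f x).
Proof.
suff /choice[P hP] : forall f : R -> R, exists F : R -> R,
    continuous f -> F 0 = 0 /\ forall x : R, is_derive x 1 F (f x) by exists P.
move=> f.
have [cf|ncf] := pselect (continuous f); last by exists f.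
by have [F ?] := primitive cf; exists F.
Qed.

Let iterates : exists T Z : nat -> R -> R,
  [/\ (forall k (x : R), is_derive x 1 (T k) (Z k x)),
      (forall x : R, is_derive x 1 (Z 0%N) 0),
      (forall k (x : R), is_derive x 1 (Z k.+1) (- (lam * (q x * T k x)))),
      T 0%N 0 = alpha /\ Z 0%N 0 = beta &
      (forall k, T k.+1 0 = 0 /\ Z k.+1 0 = 0) /\
      forall k x, `|T k x| <= K * (2^-1) ^+ k * E x /\ `|Z k x| <= K * (2^-1) ^+ k * (mu * E x)].
Proof.
have [P hP] := prim.
pose S f := P (fun x => - (lam * (q x * f x))).
pose T := fix T k := match k with 0%N => fun x => alpha + beta * x | k.+1 => P (S (T k)) end.
pose Z k := match k with 0%N => fun=> beta | k.+1 => S (T k) end.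
have step f : continuous f -> [/\ S f 0 = 0, P (S f) 0 = 0,
   forall x : R, is_derive x 1 (S f) (- (lam * (q x * f x))),
   forall x : R, is_derive x 1 (P (S f)) (S f x) & continuous (P (S f))].
  move=> cf; have [|S0 dS] := hP (fun x => - (lam * (q x * f x))).
    move=> x; apply: cvgN; apply: cvgM; first exact: cvg_cst.
    by apply: cvgM; [exact: (isd_cont dq)|exact: cf].
  have [P0 dP] := hP (S f) (isd_cont dS).
  by split=> //; exact: isd_cont dP.
have dT0 (x : R) : is_derive x 1 (T 0%N) beta.
  by apply: isd_eq (isdD (isdC alpha x 1) (isdZ beta (isd_id x))) _; rewrite add0r mulr1.
have cT k : continuous (T k).
  elim: k => [|k IH]; first exact: isd_cont dT0.
  by have [] := step _ IH.
exists T, Z; split.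
- by case=> [|k] x; [exact: dT0 | have [] := step _ (cT k)].
- by move=> x; exact: isdC.
- by move=> k x; have [] := step _ (cT k).
- by split=> //=; rewrite mulr0 addr0.
split; first by move=> k; have [] := step _ (cT k).
elim=> [|k IH] x.
  rewrite expr0 mulr1; split => /=; have := E_lin x; have m1 := E_gt x.
    move=> Ex; apply: (le_trans (ler_normD _ _)); rewrite normrM /K.
    rewrite [leRHS]mulrDl lerD //.
      by rewrite ler_peMr // (le_trans _ Ex) // lerDl mulr_ge0 // ltW.
    rewrite -mulrA ler_wpM2l // mulrC ler_pdivlMr // mulrC (le_trans _ Ex) //.
    by rewrite lerDr.
  move=> Ex; rewrite /K [leRHS]mulrDl -[X in _ + X]mulrA mulKf ?gt_eqF // ler_wpDl //.
    by rewrite !mulr_ge0 // ?ltW.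
  by rewrite ler_peMr // (le_trans _ Ex) // lerDl mulr_ge0 // ltW.
have [S0 P0 dS dP cP] := step _ (cT k).
set r : R := K * 2^-1 ^+ k.+1.
have r0 : 0 <= r by rewrite mulr_ge0 // exprn_ge0 // invr_ge0.
have F2 t : `|lam * (q t * T k t)| <= r * (2 * La * E t).
  have [hT _] := IH t.
  rewrite normrM normrM mulrA.
  apply: (@le_trans _ _ (La * (K * 2^-1 ^+ k * E t))).
    apply: ler_pM => //.
    by rewrite /La ler_wpDr // ler_wpM2l.
  by rewrite /r exprS le_eqVlt; apply/orP; left; apply/eqP; field.
have G s : `|s| = 1 -> (forall y, 0 <= y -> 0 <= r * E' y + s * S (T k) y) /\
   (forall y, y <= 0 -> r * E' y + s * S (T k) y <= 0) /\
   forall y, r * E 0 + s * T k.+1 0 <= r * E y + s * T k.+1 y.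
  move=> s1; apply: (@convex_min R (fun y => r * E y + s * T k.+1 y)
    (fun y => r * E' y + s * S (T k) y)
    (fun y => r * (2 * La * E y) + s * - (lam * (q y * T k y)))).
  - by move=> y; apply: isdD; apply: isdZ.
  - by move=> y; apply: isdD; apply: isdZ.
  - move=> y; rewrite -lerBlDr sub0r; apply: le_trans (F2 y).
    rewrite (le_trans (ler_norm _)) // normrN normrM s1 mul1r normrN //.
  - by rewrite S0 /E' !mulr0 subrr !mulr0 addr0.
have [A1 [B1 C1]] := G 1 (normr1 _).
have [|A2 [B2 C2]] := G (-1) _; first by rewrite normrN1.
rewrite /= P0 !mulr0 !addr0 in C1 C2.
have rE0 : 0 <= r * E 0 by rewrite mulr_ge0 // ltW.
split.
  rewrite ler_norml; apply/andP; split.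
    by have := C1 x; rewrite -[P (S (T k)) x]/(T k.+1 x); lra.
  by have := C2 x; rewrite -[P (S (T k)) x]/(T k.+1 x); lra.
apply: (@le_trans _ _ (r * `|E' x|)); last by rewrite ler_wpM2l.
rewrite -[X in X * _]ger0_norm // -normrM /=.
have [x0|x0] := leP 0 x.
  have h1 := A1 x x0; have h2 := A2 x x0.
  rewrite ler_norml; apply/andP; split; have := ler_norm (r * E' x); lra.
have h1 := B1 x (ltW x0); have h2 := B2 x (ltW x0).
rewrite ler_norml; apply/andP; split; have := ler_norm (- (r * E' x)); rewrite normrN; lra.
Qed.

Lemma ode_exists : exists u v : R -> R,
  [/\ (forall x : R, is_derive x 1 u (v x)),
      (forall x : R, is_derive x 1 v (- (lam * (q x * u x)))),
      u 0 = alpha & v 0 = beta].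
Proof.
have [T [Z [dT dZ0 dZ [T00 Z00] [TZ0 bnd]]]] := iterates.
pose S n x := \sum_(k < n) T k x.
pose W n x := \sum_(k < n) Z k x.
have bT x : (exists l : R, S n x @[n --> \oo] --> l) /\ forall n, `|S n x| <= 2 * (K * E x).
  by apply: (@geo_series R (fun k => T k x)) => k; have [h _] := bnd k x; rewrite mulrAC.
have bZ x : (exists l : R, W n x @[n --> \oo] --> l) /\ forall n, `|W n x| <= 2 * (K * (mu * E x)).
  by apply: (@geo_series R (fun k => Z k x)) => k; have [_ h] := bnd k x; rewrite mulrAC.
have [u hu] := choice (fun x => (bT x).1).
have [v hv] := choice (fun x => (bZ x).1).
have dS n (x : R) : is_derive x 1 (S n) (W n x) by apply: isd_sum => i; exact: dT.
have dW n (x : R) : is_derive x 1 (W n.+1) (- (lam * (q x * S n x))).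
  rewrite /W; have := @isd_sum R R n.+1 (fun i => Z i)
    (fun i => match (i : nat) with 0%N => 0 | k.+1 => - (lam * (q x * T k x)) end) x 1.
  move=> /(_ _)/isd_eq; apply; first by case=> -[|k] ki /=.
  rewrite big_ord_recl add0r /= /S.
  by rewrite 2!mulr_sumr -sumrN; apply: eq_bigr.
have E_loc x y : `|y - x| <= 1 -> E y <= E (x + 1) + E (x - 1).
  rewrite ler_norml => /andP[y1 y2]; rewrite /E.
  have a1 : expR (mu * y) <= expR (mu * (x + 1)) by rewrite ler_expR ler_pM2l //; lra.
  have a2 : expR (- mu * y) <= expR (- mu * (x - 1)) by rewrite ler_expR !mulNr lerN2 ler_pM2l //; lra.
  have := expR_ge0 (- mu * (x + 1)); have := expR_ge0 (mu * (x - 1)); lra.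
have shiftc (a : nat -> R) (l : R) : a n @[n --> \oo] --> l -> a n.+1 @[n --> \oo] --> l.
  by move=> h; rewrite (cvg_shiftS a).
exists u, v; split.
- move=> x; set B := E (x + 1) + E (x - 1).
  have B0 : 0 <= B by rewrite addr_ge0 // ltW.
  apply: (@isd_limit R (fun n => S n.+1) (fun n => W n.+1) (fun n y => - (lam * (q y * S n y)))
    u (v x) x (`|lam| * (Q * (2 * (K * B))))) => //.
  + move=> n y yx; rewrite normrN !normrM ler_wpM2l //.
    apply: ler_pM => //; apply: (le_trans ((bT y).2 n)).
    by rewrite ler_pM2l // ler_wpM2l //; exact: E_loc.
  + by move=> y; apply: (shiftc (fun n => S n y)).
  + by apply: (shiftc (fun n => W n x)).
- move=> x; set B := E (x + 1) + E (x - 1).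
  have B0 : 0 <= B by rewrite addr_ge0 // ltW.
  apply: (@isd_limit R (fun n => W n.+1) (fun n y => - (lam * (q y * S n y)))
    (fun n y => - (lam * (q' y * S n y + q y * W n y)))
    v _ x (`|lam| * (Q1 * (2 * (K * B)) + Q * (2 * (K * (mu * B)))))) => //.
  + by move=> n y; apply: isdN; apply: isdZ; apply: isdM.
  + move=> n y yx; rewrite normrN normrM ler_wpM2l // (le_trans (ler_normD _ _)) //.
    rewrite !normrM lerD //.
      apply: ler_pM => //; apply: (le_trans ((bT y).2 n)).
      by rewrite ler_pM2l // ler_wpM2l //; exact: E_loc.
    apply: ler_pM => //; apply: (le_trans ((bZ y).2 n)).
    by rewrite ler_pM2l // ler_wpM2l // ler_pM2l //; exact: E_loc.
  + by move=> y; apply: (shiftc (fun n => W n y)).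
  + apply: cvgN; apply: cvgM; first exact: cvg_cst.
    by apply: cvgM; [exact: cvg_cst|exact: hu].
- have H : S n 0 @[n --> \oo] --> alpha.
    apply: cvg_near_cst; exists 1%N => // -[//|n] _ /=.
    by rewrite /S big_ord_recl big1 ?addr0 // => i _; exact: (TZ0 _).1.
  exact: (cvg_unique _ (hu 0) H).
- have H : W n 0 @[n --> \oo] --> beta.
    apply: cvg_near_cst; exists 1%N => // -[//|n] _ /=.
    by rewrite /W big_ord_recl big1 ?addr0 // => i _; exact: (TZ0 _).2.
  exact: (cvg_unique _ (hv 0) H).
Qed.
End OdeExistence.

Section Csm.
Variable R : realType.
Implicit Types (u v : R -> R) (x : R).

                                                                                         
Fixpoint csm (k : nat) u : Prop :=
  if k is k'.+1 then
    exists2 u' : R -> R, (forall x, is_derive x 1 u (u' x)) & csm k' u'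
  else continuous u.

Definition smooth1 u := forall k, csm k u.

Lemma csm_cont k u : csm k u -> continuous u.
Proof. by case: k => [//|k] [u' h _]; exact: isd_cont h. Qed.

Lemma csmW k u : csm k.+1 u -> csm k u.
Proof.
elim: k u => [|k IH] u [u' h h']; first exact: isd_cont h.
by exists u' => //; exact: IH.
Qed.

Lemma csm_cst k (c : R) : csm k (fun=> c).
Proof.
elim: k c => [|k IH] c; first by move=> x; exact: cvg_cst.
by exists (fun=> 0); [move=> x; exact: isdC|exact: IH].
Qed.

Lemma csm_id k : csm k (fun x => x).
Proof.
case: k => [|k]; first by move=> x; exact: cvg_id.
by exists (fun=> 1); [move=> x; exact: isd_id|exact: csm_cst].
Qed.

Lemma csmD k u v : csm k u -> csm k v -> csm k (fun x => u x + v x).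
Proof.
elim: k u v => [|k IH] u v; first by move=> hu hv x; apply: cvgD; [exact: hu|exact: hv].
move=> [u' hu su] [v' hv sv]; exists (fun x => u' x + v' x); last exact: IH.
by move=> x; exact: isdD.
Qed.

Lemma csmM k u v : csm k u -> csm k v -> csm k (fun x => u x * v x).
Proof.
elim: k u v => [|k IH] u v; first by move=> hu hv x; apply: cvgM; [exact: hu|exact: hv].
move=> hu hv; have hu0 := csmW hu; have hv0 := csmW hv.
move: hu hv => [u' hu su] [v' hv sv]; exists (fun x => u' x * v x + u x * v' x).
  by move=> x; exact: isdM.
by apply: csmD; exact: IH.
Qed.

Lemma csmZ k (c : R) u : csm k u -> csm k (fun x => c * u x).
Proof. by move=> hu; apply: csmM => //; exact: csm_cst. Qed.

Lemma csmN k u : csm k u -> csm k (fun x => - u x).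
Proof.
move=> hu; rewrite (_ : (fun x => - u x) = (fun x => -1 * u x)); first exact: csmZ.
by apply/funext => x; rewrite mulN1r.
Qed.

Lemma csm_comp k u v : csm k u -> csm k v -> csm k (fun x => u (v x)).
Proof.
elim: k u v => [|k IH] u v.
  by move=> hu hv x; apply: (@continuous_comp _ _ _ v u); [exact: hv|exact: hu].
move=> hu hv; have hv0 := csmW hv.
move: hu hv => [u' hu su] [v' hv sv]; exists (fun x => u' (v x) * v' x).
  by move=> x; exact: isd_comp.
by apply: csmM => //; exact: IH.
Qed.

Lemma csm_sincos k : csm k (@sin R) /\ csm k (@cos R).
Proof.
elim: k => [|k [IHs IHc]].
  by split; [exact: continuous_sin|exact: continuous_cos].
split; first by exists (@cos R) => // x; exact: is_derive_sin.
exists (fun x => - sin x); last exact: csmN.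
by move=> x; exact: is_derive_cos.
Qed.

Lemma csm_ode k u v q (lam : R) : (forall x, is_derive x 1 u (v x)) ->
  (forall x, is_derive x 1 v (- (lam * (q x * u x)))) -> smooth1 q ->
  csm k u /\ csm k v.
Proof.
move=> hu hv hq; elim: k => [|k [su sv]]; first by split; [exact: isd_cont hu|exact: isd_cont hv].
split; first by exists v.
by exists (fun x => - (lam * (q x * u x))) => //; apply: csmN; apply: csmZ; apply: csmM.
Qed.

End Csm.

                                    

Section Flat.
Variable R : realType.
Implicit Types (s t x : R).

                                                                   
Definition flat (w : R -> R) (k : nat) (s : R) : R :=
  if 0 < s then expR (- (2 / s)) * (s^-1) ^+ k * w (s^-1) else 0.

Lemma pow_le_exp (t : R) (k : nat) : 0 <= t -> t ^+ k <= k`!%:R * expR t.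
Proof.
move=> t0; case: k => [|k].
  by rewrite expr0 fact0 mul1r -(expR0 R) ler_expR.
have := expR_ge1Dxn k t0; rewrite -ler_pdivrMl ?ltr0n ?fact_gt0 // mulrC => h.
by apply: le_trans h; rewrite lerDr.
Qed.

Lemma flat_le (w : R -> R) k s : (forall t, `|w t| <= 1) -> 0 < s ->
  `|flat w k s| <= k`!%:R * 2 ^+ k * expR (- (3 / (2 * s))).
Proof.
move=> w1 s0; rewrite /flat s0 !normrM ger0_norm ?expR_ge0 //.
rewrite (ger0_norm (exprn_ge0 _ _)) ?invr_ge0 ?(ltW s0) //.
apply: (@le_trans _ _ (expR (- (2 / s)) * s^-1 ^+ k)).
  by rewrite ler_piMr // mulr_ge0 ?expR_ge0 // exprn_ge0 // invr_ge0 ltW.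
have h : s^-1 ^+ k <= k`!%:R * 2 ^+ k * expR (1 / (2 * s)).
  have -> : s^-1 = 2 * (1 / (2 * s)) by field; rewrite gt_eqF.
  rewrite exprMn mulrAC [X in _ <= X]mulrC ler_pM2l ?exprn_gt0 //.
  by apply: pow_le_exp; rewrite divr_ge0 // mulr_ge0 // ltW.
have -> : - (3 / (2 * s)) = - (2 / s) + 1 / (2 * s) by field; rewrite gt_eqF.
rewrite expRD mulrCA ler_pM2l ?expR_gt0 //.
Qed.

Lemma flat_bound (w : R -> R) k s : (forall t, `|w t| <= 1) ->
  `|flat w k s| <= k`!%:R * 2 ^+ k.
Proof.
move=> w1; have [s0|s0] := ltP 0 s; last by rewrite /flat ltNge s0 normr0 mulr_ge0 ?exprn_ge0 ?ler0n.
apply: (le_trans (flat_le k w1 s0)); rewrite ler_piMr ?mulr_ge0 ?exprn_ge0 ?ler0n //.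
by rewrite -(expR0 R) ler_expR oppr_le0 divr_ge0 // mulr_ge0 // ltW.
Qed.

Lemma isd_flat (w w' : R -> R) k s : (forall t, `|w t| <= 1) ->
  (forall t, is_derive t 1 w (w' t)) ->
  is_derive s 1 (flat w k) (2 * flat w k.+2 s - k%:R * flat w k.+1 s - flat w' k.+2 s).
Proof.
move=> w1 dw; have [s0|s0|s0] := ltgtP 0 s; last rewrite -{s}s0.
- have sn0 : s != 0 by rewrite gt_eqF.
  have E : \near s, expR (- (2 / s)) * (s^-1) ^+ k * w (s^-1) = flat w k s.
    near=> t; rewrite /flat ifT //; near: t; exact: lt_nbhsr.
  apply: (near_eq_is_derive E).
  have di : is_derive s 1 (fun t : R => t^-1) (- (s^-1) ^+ 2).
    by apply: isd_eq (isdV sn0 (isd_id s)) _; rewrite exprVn mulN1r.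
  have de : is_derive s 1 (fun t : R => expR (- (2 / t))) (expR (- (2 / s)) * (2 * s^-1 ^+ 2)).
    apply: (@isd_comp R R expR (fun t => - (2 / t))).
    by apply: isd_eq (isdN (isdZ 2 di)) _; ring.
  have dk : is_derive s 1 (fun t : R => (t^-1) ^+ k) (- (k%:R * (s^-1) ^+ k.+1)).
    case: k {E} => [|k].
      by rewrite mul0r oppr0; under eq_fun do rewrite expr0; exact: isdC.
    by apply: isd_eq (isdX k di) _; rewrite !exprS; ring.
  apply: isd_eq (isdM (isdM de dk) (isd_comp (dw _) di)) _.
  by rewrite /flat s0 !exprS; ring.
- have E : \near s, (fun=> 0) s = flat w k s.
    near=> t; rewrite /flat ifF //; apply/negbTE; rewrite -leNgt ltW //.
    by near: t; exact: lt_nbhsl.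
  apply: (near_eq_is_derive E).
  by apply: isd_eq (isdC 0 s 1) _; rewrite /flat ltNge (ltW s0) /= !mulr0 !subr0.
- have f0 w0 j : flat w0 j 0 = 0 by rewrite /flat ltxx.
  rewrite !f0 !mulr0 !subr0.
  apply: (@isd_of_sq R _ _ _ (k.+2`!%:R * 2 ^+ k.+2)) => h h1.
  rewrite f0 mulr0 !subr0 addr0.
  have [h0|h0] := ltP 0 h; last first.
    by rewrite /flat ltNge h0 normr0 mulr_ge0 ?sqr_ge0 // mulr_ge0 ?exprn_ge0 ?ler0n.
  have -> : flat w k h = flat w k.+2 h * h ^+ 2.
    by rewrite /flat h0 !exprS; field; rewrite gt_eqF.
  by rewrite normrM (ger0_norm (sqr_ge0 _)) ler_wpM2r ?sqr_ge0 //; exact: flat_bound.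
Unshelve. all: by end_near. Qed.

Lemma flatN (w : R -> R) k s : flat (fun t => - w t) k s = - flat w k s.
Proof. by rewrite /flat; case: ifP; rewrite ?oppr0 // mulrN. Qed.

Lemma abs_cos (t : R) : `|cos t| <= 1.
Proof. by rewrite ler_norml cos_geN1 cos_le1. Qed.
Lemma abs_sin (t : R) : `|sin t| <= 1.
Proof. by rewrite ler_norml sin_geN1 sin_le1. Qed.

Definition fc := flat (@cos R).
Definition fs := flat (@sin R).

Lemma isd_fc k s : is_derive s 1 (fc k) (2 * fc k.+2 s - k%:R * fc k.+1 s + fs k.+2 s).
Proof.
apply: isd_eq (isd_flat k s abs_cos (fun t => is_derive_cos t)) _.
by rewrite flatN opprK.
Qed.

Lemma isd_fs k s : is_derive s 1 (fs k) (2 * fs k.+2 s - k%:R * fs k.+1 s - fc k.+2 s).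
Proof. exact: (isd_flat k s abs_sin (fun t => is_derive_sin t)). Qed.

Lemma csm_flat j k : csm j (fc k) /\ csm j (fs k).
Proof.
elim: j k => [|j IH] k.
  by split; [exact: isd_cont (isd_fc k)|exact: isd_cont (isd_fs k)].
split.
  exists (fun s => 2 * fc k.+2 s - k%:R * fc k.+1 s + fs k.+2 s); first exact: isd_fc.
  apply: csmD; last exact: (IH _).2.
  apply: csmD; last apply: csmN; apply: csmZ; exact: (IH _).1.
exists (fun s => 2 * fs k.+2 s - k%:R * fs k.+1 s - fc k.+2 s); first exact: isd_fs.
apply: csmD; last by apply: csmN; exact: (IH _).1.
apply: csmD; last apply: csmN; apply: csmZ; exact: (IH _).2.
Qed.

End Flat.

Section Profile.
Variable R : realType.
Implicit Types (s t x : R).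
Local Notation fc := (@fc R).
Local Notation fs := (@fs R).

Definition sig (x : R) : R := 1 - cos (3 * x).

Let s3 (x : R) : is_derive x 1 (fun t : R => sin (3 * t)) (3 * cos (3 * x)).
Proof.
rewrite mulrC; apply: (@isd_comp R R (@sin R) (fun t => 3 * t)).
by apply: isd_eq (isdZ 3 (isd_id x)) _; rewrite mulr1.
Qed.
Let c3 (x : R) : is_derive x 1 (fun t : R => cos (3 * t)) (3 * - sin (3 * x)).
Proof.
rewrite mulrC; apply: (@isd_comp R R (@cos R) (fun t => 3 * t)).
by apply: isd_eq (isdZ 3 (isd_id x)) _; rewrite mulr1.
Qed.

Lemma isd_sig (x : R) : is_derive x 1 sig (3 * sin (3 * x)).
Proof. by apply: isd_eq (isdB (isdC 1 x 1) (c3 x)) _; ring. Qed.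

Lemma sig_incr x y : 0 <= x -> x < y -> y <= 1/2 -> sig x < sig y.
Proof.
move=> x0 xy y1; have [c /andP[xc cy] E] := isd_MVT isd_sig xy.
rewrite -subr_gt0 E mulr_gt0 ?subr_gt0 // mulr_gt0 // sin_gt0_pi //.
by have := pi_ge2 R => ?; apply/andP; split; lra.
Qed.

Lemma sig0 : sig 0 = 0. Proof. by rewrite /sig mulr0 cos0 subrr. Qed.

Let F1 s := 2 * fc 2 s + fs 2 s.
Let F2 s := 2 * (2 * fc 4 s - 2 * fc 3 s + fs 4 s) + (2 * fs 4 s - 2 * fs 3 s - fc 4 s).
Let F3 s := 2 * (2 * (2 * fc 6 s - 4 * fc 5 s + fs 6 s) - 2 * (2 * fc 5 s - 3 * fc 4 s + fs 5 s)
    + (2 * fs 6 s - 4 * fs 5 s - fc 6 s)) +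
  (2 * (2 * fs 6 s - 4 * fs 5 s - fc 6 s) - 2 * (2 * fs 5 s - 3 * fs 4 s - fc 5 s)
    - (2 * fc 6 s - 4 * fc 5 s + fs 6 s)).

Let dF0 s : is_derive s 1 (fc 0) (F1 s).
Proof. by apply: isd_eq (isd_fc 0 s) _; rewrite mul0r subr0. Qed.
Let dF1 s : is_derive s 1 F1 (F2 s).
Proof. exact: (isdD (isdZ 2 (isd_fc 2 s)) (isd_fs 2 s)). Qed.
Let dF2 s : is_derive s 1 F2 (F3 s).
Proof.
apply: isdD.
  apply: isdZ; apply: isdD; last exact: isd_fs.
  by apply: isdB; apply: isdZ; exact: isd_fc.
apply: isdB; last exact: isd_fc.
by apply: isdB; apply: isdZ; exact: isd_fs.
Qed.

Let small (F : R -> R) := exists2 C : R, 0 <= C &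
  forall s, (0 < s -> `|F s| <= C * expR (- (3 / (2 * s)))) /\ `|F s| <= C.
Let small_flat (w : R -> R) k : (forall t, `|w t| <= 1) -> small (flat w k).
Proof.
move=> w1; exists (k`!%:R * 2 ^+ k); first by rewrite mulr_ge0 ?exprn_ge0 ?ler0n.
by move=> s; split=> [s0|]; [exact: flat_le|exact: flat_bound].
Qed.
Let smallc k : small (fc k). Proof. exact/small_flat/abs_cos. Qed.
Let smalls k : small (fs k). Proof. exact/small_flat/abs_sin. Qed.
Let smallD F G : small F -> small G -> small (fun s => F s + G s).
Proof.
move=> [C C0 hC] [D D0 hD]; exists (C + D); first exact: addr_ge0.
move=> s; have [c1 c2] := hC s; have [d1 d2] := hD s; split=> [s0|].
  by rewrite mulrDl (le_trans (ler_normD _ _)) // lerD ?c1 ?d1.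
by rewrite (le_trans (ler_normD _ _)) // lerD.
Qed.
Let smallZ c F : small F -> small (fun s => c * F s).
Proof.
move=> [C C0 hC]; exists (`|c| * C); first exact: mulr_ge0.
move=> s; have [c1 c2] := hC s; split=> [s0|]; rewrite normrM -?mulrA ler_wpM2l // c1 //.
Qed.
Let smallN F : small F -> small (fun s => - F s).
Proof. by move=> [C C0 hC]; exists C => // s; rewrite normrN. Qed.
Let smallB F G : small F -> small G -> small (fun s => F s - G s).
Proof. by move=> hF hG; apply: smallD => //; exact: smallN. Qed.
Let small1 : small F1.
Proof. by apply: smallD => //; exact: smallZ. Qed.
Let small2 : small F2.
Proof.
apply: smallD; first by apply: smallZ; apply: smallD => //; apply: smallB; exact: smallZ.
by apply: smallB => //; apply: smallB; exact: smallZ.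
Qed.
Let small3 : small F3.
Proof.
have A k : small (fun s => fc k s) by exact: smallc.
have B k : small (fun s => fs k s) by exact: smalls.
by rewrite /F3; do !(first [exact: A|exact: B|apply: smallB|apply: smallD|apply: smallZ]).
Qed.

Lemma profile_exists : exists (P P1 P2 P3 : R -> R) (C : R),
 [/\ [/\ forall x : R, is_derive x 1 P (P1 x), forall x : R, is_derive x 1 P1 (P2 x)
       & forall x : R, is_derive x 1 P2 (P3 x)],
     smooth1 P2,
     [/\ forall x, P2 (x + 2 * pi / 3) = P2 x, forall x, P2 (- x) = P2 x,
         P1 0 = 0, P1 (2 * pi / 3) = 0 & P 0 = 0],
     0 <= C /\ forall x, `|P2 x| <= C /\ `|P3 x| <= C &
     forall x, 0 < x <= 1/2 ->
       [/\ P x = expR (- (2 / sig x)) * cos ((sig x)^-1),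
        `|P1 x| <= C * expR (- (3 / (2 * sig x)))
        & `|P2 x| <= C * expR (- (3 / (2 * sig x)))]].
Proof.
have [C1 C10 h1] := small1; have [C2 C20 h2] := small2; have [C3 C30 h3] := small3.
pose P x := fc 0 (sig x).
pose P1 x := F1 (sig x) * (3 * sin (3 * x)).
pose P2 x := F2 (sig x) * (3 * sin (3 * x)) ^+ 2 + F1 (sig x) * (9 * cos (3 * x)).
pose P3 x := F3 (sig x) * (3 * sin (3 * x)) ^+ 3
  + F2 (sig x) * (3 * (3 * sin (3 * x)) * (9 * cos (3 * x)))
  - F1 (sig x) * (27 * sin (3 * x)).
pose C := 27 * (C1 + C2 * 3 + C3).
have b3 t : `|3 * sin t| <= 3 :> R.
  by rewrite normrM ger0_norm // ler_piMr // abs_sin.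
have b9 t : `|9 * cos t| <= 9 :> R.
  by rewrite normrM ger0_norm // ler_piMr // abs_cos.
have sig_per x : sig (x + 2 * pi / 3) = sig x.
  rewrite /sig (_ : 3 * _ = 3 * x + pi *+ 2); first by rewrite cosD2pi.
  by rewrite mulr2n; field.
have s_per x : sin (3 * (x + 2 * pi / 3)) = sin (3 * x).
  rewrite (_ : 3 * _ = 3 * x + pi *+ 2); first by rewrite sinD2pi.
  by rewrite mulr2n; field.
have c_per x : cos (3 * (x + 2 * pi / 3)) = cos (3 * x).
  by apply: (@addIr _ (-1)); rewrite -[LHS]opprB -[RHS]opprB -!/(sig _) sig_per.
have sigN x : sig (- x) = sig x by rewrite /sig mulrN cosN.
have P2b x e : `|F1 (sig x)| <= C1 * e -> `|F2 (sig x)| <= C2 * e -> 0 <= e -> `|P2 x| <= C * e.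
  move=> f1 f2 e0; rewrite /P2; apply: (le_trans (ler_normD _ _)).
  have a1 : `|F2 (sig x) * (3 * sin (3 * x)) ^+ 2| <= C2 * e * 9.
    rewrite normrM ler_pM // normrX (_ : 9 = 3 ^+ 2); last by ring.
    by rewrite lerXn2r // nnegrE.
  have a2 : `|F1 (sig x) * (9 * cos (3 * x))| <= C1 * e * 9 by rewrite normrM ler_pM.
  have b1 : 0 <= C1 * e by rewrite mulr_ge0.
  have b2 : 0 <= C2 * e by rewrite mulr_ge0.
  have b4 : 0 <= C3 * e by rewrite mulr_ge0.
  by rewrite /C; lra.
exists P, P1, P2, P3, C; split.
- split=> x.
  + by apply: (@isd_comp R R (fc 0) sig); [exact: dF0|exact: isd_sig].
  + apply: isd_eq (isdM (@isd_comp R R F1 sig x 1 _ _ (dF1 _) (isd_sig x)) (isdZ 3 (s3 x))) _.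
    by rewrite /P2; ring.
  + have dsq : is_derive x 1 (fun y : R => (3 * sin (3 * y)) ^+ 2) _ := isdX 1 (isdZ 3 (s3 x)).
    apply: isd_eq (isdD (isdM (@isd_comp R R F2 sig x 1 _ _ (dF2 _) (isd_sig x)) dsq)
      (isdM (@isd_comp R R F1 sig x 1 _ _ (dF1 _) (isd_sig x)) (isdZ 9 (c3 x)))) _.
    by rewrite /P3; ring.
- move=> k.
  have cf j i : csm j (fun s => fc i s) by exact: (csm_flat _ j i).1.
  have cs j i : csm j (fun s => fs i s) by exact: (csm_flat _ j i).2.
  have c3x : csm k (fun x : R => 3 * x) by apply: csmZ; exact: csm_id.
  have ssin : csm k (fun x : R => sin (3 * x)) by apply: csm_comp => //; exact: (csm_sincos R k).1.
  have scos : csm k (fun x : R => cos (3 * x)) by apply: csm_comp => //; exact: (csm_sincos R k).2.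
  have ssig : csm k sig by apply: csmD; [exact: csm_cst|exact: csmN].
  rewrite /P2; under eq_fun do rewrite expr2.
  apply: csmD; apply: csmM.
  + apply: (@csm_comp R k F2 sig) => //.
    by apply: csmD; do !(first [exact: cf|exact: cs|apply: csmD|apply: csmN|apply: csmZ]).
  + by apply: csmM; exact: csmZ.
  + apply: (@csm_comp R k F1 sig) => //.
    by apply: csmD => //; exact: csmZ.
  + exact: csmZ.
- split.
  + by move=> x; rewrite /P2 sig_per s_per c_per.
  + by move=> x; rewrite /P2 sigN mulrN sinN cosN mulrN sqrrN.
  + by rewrite /P1 mulr0 sin0 !mulr0.
  + by rewrite /P1 -[2 * pi / 3]add0r s_per mulr0 sin0 !mulr0.
  + by rewrite /P sig0 /fc /flat ltxx.
- split; first by rewrite /C; lra.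
  move=> x; have [_ f1] := h1 (sig x); have [_ f2] := h2 (sig x); have [_ f3] := h3 (sig x).
  split; first by rewrite -[C]mulr1; apply: P2b; rewrite ?mulr1.
  rewrite /P3; apply: (le_trans (ler_normB _ _)).
  have a0 := ler_normD (F3 (sig x) * (3 * sin (3 * x)) ^+ 3) (F2 (sig x) * (3 * (3 * sin (3 * x)) * (9 * cos (3 * x)))).
  have a1 : `|F3 (sig x) * (3 * sin (3 * x)) ^+ 3| <= C3 * 27.
    rewrite normrM ler_pM // normrX (_ : 27 = 3 ^+ 3); last by ring.
    by rewrite lerXn2r // nnegrE.
  have a2 : `|F2 (sig x) * (3 * (3 * sin (3 * x)) * (9 * cos (3 * x)))| <= C2 * 81.
    rewrite normrM ler_pM // normrM (_ : 81 = 9 * 9); last by ring.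
    by rewrite ler_pM // normrM ger0_norm // (_ : 9 = 3 * 3) ?ler_pM2l //; ring.
  have a3 : `|F1 (sig x) * (27 * sin (3 * x))| <= C1 * 27.
    rewrite normrM ler_pM // normrM ger0_norm // ler_piMr // abs_sin //.
  by rewrite /C; lra.
- move=> x /andP[x0 x1].
  have s0 : 0 < sig x by rewrite -sig0; apply: sig_incr.
  have [/(_ s0) f1 _] := h1 (sig x); have [/(_ s0) f2 _] := h2 (sig x).
  split.
  + by rewrite /P /fc /flat s0 expr0 mulr1.
  + rewrite /P1 normrM; set e := expR _ in f1 *.
    have e0 : 0 <= e by exact: expR_ge0.
    have a1 : `|F1 (sig x)| * `|3 * sin (3 * x)| <= (C1 * e) * 3 by rewrite ler_pM.
    have b1 : 0 <= C1 * e by rewrite mulr_ge0.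
    have b2 : 0 <= C2 * e by rewrite mulr_ge0.
    have b4 : 0 <= C3 * e by rewrite mulr_ge0.
    by rewrite /C; lra.
  + by apply: P2b => //; exact: expR_ge0.
Qed.

End Profile.

                           

Section Floquet.
Variables (R : realType) (q : R -> R) (lam : R) (c c1 s s1 : R -> R).
Hypothesis dc : forall x : R, is_derive x 1 c (c1 x).
Hypothesis dc1 : forall x : R, is_derive x 1 c1 (- (lam * (q x * c x))).
Hypothesis ds : forall x : R, is_derive x 1 s (s1 x).
Hypothesis ds1 : forall x : R, is_derive x 1 s1 (- (lam * (q x * s x))).
Hypothesis c0 : c 0 = 1.
Hypothesis c10 : c1 0 = 0.
Hypothesis s0 : s 0 = 0.
Hypothesis s10 : s1 0 = 1.

Lemma wronskian_cst (u u1 v v1 : R -> R) :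
  (forall x : R, is_derive x 1 u (u1 x)) ->
  (forall x : R, is_derive x 1 u1 (- (lam * (q x * u x)))) ->
  (forall x : R, is_derive x 1 v (v1 x)) ->
  (forall x : R, is_derive x 1 v1 (- (lam * (q x * v x)))) ->
  forall x, u x * v1 x - u1 x * v x = u 0 * v1 0 - u1 0 * v 0.
Proof.
move=> du du1 dv dv1 x.
apply: (@isd_eq_cst R (fun x => u x * v1 x - u1 x * v x)) => y.
by apply: isd_eq (isdB (isdM (du y) (dv1 y)) (isdM (du1 y) (dv y))) _; ring.
Qed.

Lemma wronskian x : c x * s1 x - c1 x * s x = 1.
Proof. by rewrite (wronskian_cst dc dc1 ds ds1) c0 c10 s10 mul0r mulr1 subr0. Qed.

Lemma solution_rep (u u1 : R -> R) :
  (forall x : R, is_derive x 1 u (u1 x)) ->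
  (forall x : R, is_derive x 1 u1 (- (lam * (q x * u x)))) ->
  forall x, u x = u 0 * c x + u1 0 * s x /\ u1 x = u 0 * c1 x + u1 0 * s1 x.
Proof.
move=> du du1 x.
have A := wronskian_cst du du1 ds ds1 x.
have B := wronskian_cst dc dc1 du du1 x.
rewrite s0 s10 mulr1 mulr0 subr0 in A; rewrite c0 c10 mul1r mul0r subr0 in B.
have W := wronskian x.
split.
  rewrite -A -B -{1}[u x]mulr1 -W; ring.
by rewrite -A -B -{1}[u1 x]mulr1 -W; ring.
Qed.

Lemma isd_opp (f f' : R -> R) (x : R) : (forall x : R, is_derive x 1 f (f' x)) ->
  is_derive x 1 (fun t => f (- t)) (- f' (- x)).
Proof.
by move=> h; rewrite -mulrN1; apply: (@isd_comp R R f (fun t => - t)).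
Qed.

Lemma c_even : (forall x, q (- x) = q x) -> forall x, c (- x) = c x.
Proof.
move=> qe x.
have [||-> _] := @solution_rep (fun t => c (- t)) (fun t => - c1 (- t)) _ _ x.
- by move=> t; exact: isd_opp.
- by move=> t; apply: isd_eq (isdN (isd_opp t dc1)) _; rewrite opprK qe.
by rewrite oppr0 c0 c10 oppr0 mul0r mul1r addr0.
Qed.

Lemma s_odd : (forall x, q (- x) = q x) -> forall x, s (- x) = - s x.
Proof.
move=> qe x.
have [||-> _] := @solution_rep (fun t => s (- t)) (fun t => - s1 (- t)) _ _ x.
- by move=> t; exact: isd_opp.
- by move=> t; apply: isd_eq (isdN (isd_opp t ds1)) _; rewrite opprK qe.
by rewrite oppr0 s0 s10 mul0r add0r mulN1r.
Qed.

                                                                                                 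
                                
Lemma floquet3 (L : R) : (forall x, q (- x) = q x) -> (forall x, q (x + L) = q x) ->
  c L = - 1 / 2 ->
  forall x, c (x + 3 * L) = c x /\ s (x + 3 * L) = s x.
Proof.
move=> qe qp cL.
have C x : c (x + L) = c L * c x + c1 L * s x /\ c1 (x + L) = c L * c1 x + c1 L * s1 x.
  have := @solution_rep (fun t => c (t + L)) (fun t => c1 (t + L)) _ _ x.
  rewrite add0r; apply => t; first exact: isd_shift.
  by apply: isd_eq (isd_shift (dc1 (t + L))) _; rewrite qp.
have S x : s (x + L) = s L * c x + s1 L * s x /\ s1 (x + L) = s L * c1 x + s1 L * s1 x.
  have := @solution_rep (fun t => s (t + L)) (fun t => s1 (t + L)) _ _ x.
  rewrite add0r; apply => t; first exact: isd_shift.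
  by apply: isd_eq (isd_shift (ds1 (t + L))) _; rewrite qp.
have W := wronskian L.
have E := (C (- L)).1; rewrite addNr c0 c_even // s_odd // in E.
have cs : s1 L = c L.
  have : c L * (c L - s1 L) = 0 by move: W E; lra.
  by move/eqP; rewrite cL mulf_eq0 => /orP[/eqP|/eqP]; lra.
have K : c1 L * s L = - 3 / 4 by move: W; rewrite cs cL; lra.
move=> x.
have -> : x + 3 * L = x + L + L + L by ring.
rewrite (C (x + L + L)).1 (C (x + L)).1 (S (x + L)).1 (C x).1 (S x).1.
rewrite (S (x + L + L)).1 (C (x + L)).1 (S (x + L)).1 (C x).1 (S x).1 cs cL.
have K1 : c1 L * s L * c x = - 3 / 4 * c x by rewrite K.
have K2 : c1 L * s L * s x = - 3 / 4 * s x by rewrite K.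
have K3 : c1 L * s L * (c1 L * s x) = - 3 / 4 * (c1 L * s x) by rewrite K.
have K4 : c1 L * s L * (s L * c x) = - 3 / 4 * (s L * c x) by rewrite K.
by split; lra.
Qed.

End Floquet.

Lemma cont_bound (R : realType) (f : R -> R) (a b : R) : continuous f -> a <= b ->
  exists2 M : R, 0 <= M & forall x, a <= x <= b -> `|f x| <= M.
Proof.
move=> cf ab.
have [|x _ hx] := @EVT_max R (fun x => `|f x|) a b ab.
  apply: continuous_subspaceT => x; apply: (@continuous_comp _ _ _ f Num.norm); first exact: cf.
  exact: norm_continuous.
by exists `|f x| => // y yab; apply: hx; rewrite in_itv.
Qed.

Section Spectrum.
Variables (R : realType) (q : R -> R) (Q : R).
Hypothesis qQ : forall x : R, `|q x| <= Q.
Variables c c1 : R -> R -> R.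
Hypothesis dc : forall lam (x : R), is_derive x 1 (c lam) (c1 lam x).
Hypothesis dc1 : forall lam (x : R), is_derive x 1 (c1 lam) (- (lam * (q x * c lam x))).
Hypothesis c0 : forall lam, c lam 0 = 1.
Hypothesis c10 : forall lam, c1 lam 0 = 0.

Lemma cos_solution_lip (mu L : R) : 0 <= L -> exists2 K : R, 0 <= K &
  forall lam, `|lam - mu| <= 1 -> `|c lam L - c mu L| <= K * `|lam - mu|.
Proof.
move=> L0.
have [M M0 hM] := @cont_bound R (c mu) 0 L (isd_cont (dc mu)) L0.
have Q0 : 0 <= Q by exact: le_trans (qQ 0).
pose G : R := 2 + (`|mu| + 1) * Q.
have G0 : 0 <= G by rewrite /G addr_ge0 // mulr_ge0 // addr_ge0.
pose H : R := (Q * M) ^+ 2 * L * expR (G * L).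
have H0 : 0 <= H by rewrite /H !mulr_ge0 ?sqr_ge0 ?expR_ge0.
exists (Num.sqrt H) => // lam ll.
set d := lam - mu in ll *.
have lamQ : `|lam| <= `|mu| + 1.
  by rewrite -[lam](subrK mu) -/d addrC (le_trans (ler_normD _ _)) // lerD2l.
pose w x := c lam x - c mu x; pose w1 x := c1 lam x - c1 mu x.
have dw (x : R) : is_derive x 1 w (w1 x) by exact: isdB.
have dw1 (x : R) : is_derive x 1 w1 (- (lam * (q x * w x)) - d * (q x * c mu x)).
  by apply: isd_eq (isdB (dc1 lam x) (dc1 mu x)) _; rewrite /w /d; ring.
have := @gronwall R (fun x => w x * w x + w1 x * w1 x)
  (fun x => (w1 x * w x + w x * w1 x) +
    ((- (lam * (q x * w x)) - d * (q x * c mu x)) * w1 x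
     + w1 x * (- (lam * (q x * w x)) - d * (q x * c mu x))))
   G (d ^+ 2 * (Q * M) ^+ 2) L.
have w0 : w 0 = 0 by rewrite /w !c0 subrr.
have w10 : w1 0 = 0 by rewrite /w1 !c10 subrr.
rewrite w0 w10 !mulr0 !add0r.
move=> /(_ _ _ G0 L0 _) h.
have {h} : w L * w L + w1 L * w1 L <= H * `|d| ^+ 2.
  rewrite (le_trans (h _ _ _)) //.
  - by move=> x; apply: isdD; apply: isdM.
  - by rewrite mulr_ge0 ?sqr_ge0.
  - move=> x /andP[x0 xL].
    have qx := qQ x; have cx : `|c mu x| <= M by apply: hM; rewrite !ltW.
    have e1 : `|lam * q x| <= (`|mu| + 1) * Q by rewrite normrM ler_pM.
    have e2 : `|d * (q x * c mu x)| <= `|d| * (Q * M).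
      by rewrite normrM ler_wpM2l // normrM ler_pM.
    have e3 : (d * (q x * c mu x)) ^+ 2 <= d ^+ 2 * (Q * M) ^+ 2.
      rewrite -real_normK ?num_real // -[d ^+ 2]real_normK ?num_real // -exprMn.
      by rewrite lerXn2r // nnegrE // mulr_ge0 // mulr_ge0.
    move: e1 e3; rewrite ler_norml => /andP[e1 e1']; set g := d * _ => e3.
    have f1 : 0 <= (w x - w1 x) ^+ 2 by exact: sqr_ge0.
    have f2 : 0 <= (w x + w1 x) ^+ 2 by exact: sqr_ge0.
    have f3 : 0 <= (w1 x + g) ^+ 2 by exact: sqr_ge0.
    set K := (`|mu| + 1) * Q in e1 e1' *.
    have f4 : 0 <= (K + lam * q x) * (w x + w1 x) ^+ 2.
      by apply: mulr_ge0 => //; lra.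
    have f5 : 0 <= (K - lam * q x) * (w x - w1 x) ^+ 2.
      by apply: mulr_ge0 => //; lra.
    have f6 : 0 <= w x ^+ 2 by exact: sqr_ge0.
    rewrite /G -/K; move: (w x) (w1 x) f1 f2 f3 f4 f5 f6 => W W1; nra.
  - by rewrite real_normK ?num_real // /H le_eqVlt; apply/orP; left; apply/eqP; ring.
move=> h.
have h2 : w L ^+ 2 <= H * `|d| ^+ 2.
  by apply: le_trans h; rewrite expr2 lerDl -expr2 sqr_ge0.
rewrite -[c lam L - c mu L]/(w L) -(ger0_norm (_ : 0 <= Num.sqrt H * `|d|)); last first.
  by rewrite mulr_ge0 ?sqrtr_ge0.
by rewrite -ler_sqr ?nnegrE // !real_normK ?num_real // exprMn sqr_sqrtr.
Qed.

Lemma cos_solution_cont (L : R) : 0 <= L -> continuous (fun nu : R => c (nu ^+ 2) L).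
Proof.
move=> L0.
have A : continuous (fun lam : R => c lam L).
  move=> mu; have [K K0 hK] := cos_solution_lip mu L0.
  apply/cvgrPdist_le => e e0; near=> lam.
  have l1 : `|lam - mu| <= 1.
    by rewrite distrC; near: lam; apply: cvgr_dist_le (@cvg_id _ _) _ _; exact: ltr01.
  have l2 : `|lam - mu| <= e / (K + 1).
    rewrite distrC; near: lam; apply: cvgr_dist_le (@cvg_id _ _) _ _.
    by rewrite divr_gt0 // ltr_pwDr.
  rewrite distrC (le_trans (hK _ l1)) // (le_trans (ler_wpM2l K0 l2)) //.
  by rewrite mulrA ler_pdivrMr; nra.
move=> nu; apply: (@continuous_comp _ _ _ (fun x : R => x ^+ 2) (fun lam => c lam L)).
  exact: exprn_continuous.
exact: A.
Unshelve. all: by end_near. Qed.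

Variables (a a' T : R -> R) (beta : R).
Hypothesis qa : forall x, q x = a x ^+ 2.
Hypothesis a0 : forall x, 0 < a x.
Hypothesis da : forall x : R, is_derive x 1 a (a' x).
Hypothesis dT : forall x : R, is_derive x 1 T (a x).
Hypothesis T0 : T 0 = 0.
Hypothesis ba : forall x, `|a' x| <= beta * a x.

                                                                                        
                                                                     
Lemma cos_solution_phase (nu L : R) : 0 < nu -> 0 <= L -> beta * L <= 1 / 8 ->
  sin (nu * T L) = 0 -> `|c (nu ^+ 2) L * cos (nu * T L) - 1| <= 1 / 4.
Proof.
move=> nu0 L0 bL sL.
have beta0 : 0 <= beta.
  by have := le_trans (normr_ge0 _) (ba 0); rewrite pmulr_lge0.
pose u := c (nu ^+ 2); pose u1 := c1 (nu ^+ 2).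
have du (x : R) : is_derive x 1 u (u1 x) by exact: dc.
have du1 (x : R) : is_derive x 1 u1 (- (nu ^+ 2 * (q x * u x))) by exact: dc1.
pose w x := u1 x / (nu * a x).
pose g x := a' x / a x.
have na x : nu * a x != 0 by rewrite gt_eqF // mulr_gt0.
have an x : a x != 0 by rewrite gt_eqF.
have nun : nu != 0 by rewrite gt_eqF.
have gb x : `|g x| <= beta by rewrite normrM normfV (gtr0_norm (a0 x)) ler_pdivrMr.
have dw (x : R) : is_derive x 1 w (- (nu * a x * u x) - g x * w x).
  apply: isd_eq (isdM (du1 x) (@isdV R R (fun t => nu * a t) x 1 _ (na x) (isdZ nu (da x)))) _.
  by rewrite /w /g qa; field; rewrite an nun.
have u1E x : u1 x = nu * a x * w x by rewrite /w mulrC divfK.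
have N x : 0 <= x <= L -> u x * u x + w x * w x <= 2.
  move=> /andP[x0 xL].
  have := @gronwall R (fun x => u x * u x + w x * w x)
    (fun x => (u1 x * u x + u x * u1 x) + ((- (nu * a x * u x) - g x * w x) * w x
       + w x * (- (nu * a x * u x) - g x * w x))) (2 * beta) 0 x.
  have -> : u 0 * u 0 + w 0 * w 0 = 1.
    by rewrite /w /u /u1 c0 c10 mul0r !mulr0 mulr1 addr0.
  rewrite mul0r addr0 mul1r => h.
  apply: (le_trans (h _ _ _ _ _)) => //.
  - by move=> y; apply: isdD; apply: isdM.
  - by rewrite mulr_ge0.
  - move=> y _; rewrite addr0 u1E.
    have := gb y; rewrite ler_norml => /andP[g1 g2].
    have f1 : 0 <= (beta + g y) * (w y) ^+ 2 by rewrite mulr_ge0 ?sqr_ge0 //; lra.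
    have f2 : 0 <= beta * (u y) ^+ 2 by rewrite mulr_ge0 ?sqr_ge0 //.
    by nra.
  - have y1 : 2 * beta * x <= 1 / 4.
      by have := ler_wpM2l beta0 xL; move: bL; lra.
    have := expR_ge1Dx (- (2 * beta * x)).
    have ep := expR_gt0 (2 * beta * x).
    rewrite expRN => h3.
    have h4 : 1 / 2 <= (expR (2 * beta * x))^-1 by apply: le_trans h3; lra.
    by have := ler_wpM2l (ltW ep) h4; rewrite divff ?gt_eqF //; lra.
pose X x := u x * cos (nu * T x) - w x * sin (nu * T x).
have dth (x : R) : is_derive x 1 (fun t => nu * T t) (nu * a x) by exact: isdZ.
have dX (x : R) : is_derive x 1 X (g x * w x * sin (nu * T x)).
  have dcos := @isd_comp R R (@cos R) (fun t => nu * T t) x 1 _ _ (is_derive_cos _) (dth x).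
  have dsin := @isd_comp R R (@sin R) (fun t => nu * T t) x 1 _ _ (is_derive_sin _) (dth x).
  apply: isd_eq (isdB (isdM (du x) dcos) (isdM (dw x) dsin)) _.
  by rewrite u1E; ring.
have X0 : X 0 = 1.
  by rewrite /X T0 mulr0 cos0 sin0 /u c0 mulr0 subr0 mulr1.
have XL : X L = u L * cos (nu * T L) by rewrite /X sL mulr0 subr0.
rewrite -/u -XL -{1}X0; move: L0; rewrite le_eqVlt => /predU1P[<-|L0].
  by rewrite subrr normr0; lra.
have [x /andP[x0 xL] ->] := isd_MVT dX L0.
rewrite subr0 normrM (gtr0_norm L0).
have wx : `|w x| <= 2.
  have h : u x * u x + w x * w x <= 2 by apply: N; rewrite !ltW.
  have : w x ^+ 2 <= 2 ^+ 2 by have := sqr_ge0 (u x); move: h; rewrite !expr2; lra.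
  by rewrite -[w x ^+ 2]real_normK ?num_real // ler_sqr // nnegrE.
have : `|g x * w x * sin (nu * T x)| <= beta * 2 * 1.
  by rewrite normrM ler_pM // ?abs_sin // normrM ler_pM.
move=> h; have := ler_wpM2r (ltW L0) h; move: bL; lra.
Qed.

Lemma spectrum_exists (j : nat) (L : R) : L = 2 * pi / 3 -> T L = L -> beta * L <= 1 / 8 -> (0 < j)%N ->
  exists2 nu : R, 3 * j%:R <= nu & c (nu ^+ 2) L = - 1 / 2.
Proof.
move=> LE TL bL j0.
have L0 : 0 <= L by rewrite LE divr_ge0 // mulr_ge0 // pi_ge0.
have jr : 0 < j%:R :> R by rewrite ltr0n.
have e1 : 3 * j%:R * T L = (pi *+ 2) * j%:R by rewrite TL LE mulr2n; field.
have e2 : (3 * j%:R + 3 / 2) * T L = (pi *+ 2) * j%:R + pi by rewrite TL LE mulr2n; field.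
have cj (x : R) : cos ((pi *+ 2) * j%:R + x) = cos x /\ sin ((pi *+ 2) * j%:R + x) = sin x.
  rewrite mulr_natr addrC; elim: (j) => [|n [IH1 IH2]]; first by rewrite mulr0n addr0.
  by rewrite mulrSr addrA cosD2pi sinD2pi.
have [] := cj 0; rewrite addr0 cos0 sin0 => cj0 sj0.
have [] := cj pi; rewrite cospi sinpi => cj1 sj1.
have h1 : `|c ((3 * j%:R) ^+ 2) L * 1 - 1| <= 1 / 4.
  by have := @cos_solution_phase (3 * j%:R) L; rewrite e1 cj0; apply => //; rewrite mulr_gt0.
have h2 : `|c ((3 * j%:R + 3 / 2) ^+ 2) L * -1 - 1| <= 1 / 4.
  have := @cos_solution_phase (3 * j%:R + 3 / 2) L; rewrite e2 cj1; apply => //; lra.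
have ab : 3 * j%:R <= 3 * j%:R + 3 / 2 :> R by lra.
have [||nu] := @IVT R (fun nu : R => c (nu ^+ 2) L) _ _ (- 1 / 2) ab.
- exact: continuous_subspaceT (cos_solution_cont L0).
- move: h1 h2; rewrite !ler_norml => /andP[h1 h1'] /andP[h2 h2'].
  by apply/andP; split; [rewrite ge_min|rewrite le_max]; apply/orP; [right|left]; lra.
by rewrite in_itv => /andP[n1 n2] h; exists nu.
Qed.

End Spectrum.

                                            

Section LocalEstimate.
Variables (R : realType) (P P1 P2 : R -> R) (C kap lam : R).
Hypothesis dP : forall x : R, is_derive x 1 P (P1 x).
Hypothesis dP1 : forall x : R, is_derive x 1 P1 (P2 x).
Hypothesis P0 : P 0 = 0.
Hypothesis P10 : P1 0 = 0.
Hypothesis C0 : 0 <= C.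
Hypothesis P2C : forall x, `|P2 x| <= C.
Hypothesis Ploc : forall x : R, 0 < x <= 1/2 ->
       [/\ P x = expR (- (2 / sig x)) * cos ((sig x)^-1),
        `|P1 x| <= C * expR (- (3 / (2 * sig x)))
        & `|P2 x| <= C * expR (- (3 / (2 * sig x)))].
Hypothesis kap0 : 0 < kap.
Hypothesis lam0 : 0 < lam.
Let a (x : R) := 1 - kap * P2 x.
Let q (x : R) := a x ^+ 2.
Variables c c1 s s1 : R -> R.
Hypothesis dc : forall x : R, is_derive x 1 c (c1 x).
Hypothesis dc1 : forall x : R, is_derive x 1 c1 (- (lam * (q x * c x))).
Hypothesis ds : forall x : R, is_derive x 1 s (s1 x).
Hypothesis ds1 : forall x : R, is_derive x 1 s1 (- (lam * (q x * s x))).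
Hypothesis c0 : c 0 = 1.
Hypothesis c10 : c1 0 = 0.
Hypothesis s0 : s 0 = 0.
Hypothesis s10 : s1 0 = 1.
Let h (x : R) := c x * c x + lam * (s x * s x).
Let D (x : R) := c x * c1 x + lam * (s x * s1 x).
Let G (x : R) := c1 x * c1 x + lam * (s1 x * s1 x).

Let energy_ineq (e d g l1 l2 A1 A2 F1 F2 : R) : `|l1| <= A1 -> `|l2| <= A2 ->
  4 * e * d + 2 * d * (g + l1 * e + F1) + 2 * g * (l2 * d + F2)
  <= (5 + A1 + A2) * (e * e + d * d + g * g) + (F1 ^+ 2 + F2 ^+ 2).
Proof.
rewrite !ler_norml => /andP[a1 a2] /andP[b1 b2].
have f1 : 0 <= (A1 + l1) * (d - e) ^+ 2 by apply: mulr_ge0; [lra|exact: sqr_ge0].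
have f2 : 0 <= (A1 - l1) * (d + e) ^+ 2 by apply: mulr_ge0; [lra|exact: sqr_ge0].
have f3 : 0 <= (A2 + l2) * (d - g) ^+ 2 by apply: mulr_ge0; [lra|exact: sqr_ge0].
have f4 : 0 <= (A2 - l2) * (d + g) ^+ 2 by apply: mulr_ge0; [lra|exact: sqr_ge0].
have g1 := sqr_ge0 (d - e); have g2 := sqr_ge0 (d - g).
have g3 := sqr_ge0 (d - F1); have g4 := sqr_ge0 (g - F2).
have h1 := sqr_ge0 e; have h2 := sqr_ge0 d; have h3 := sqr_ge0 g.
have k1 : 0 <= A1 * g ^+ 2 by apply: mulr_ge0 => //; lra.
have k2 : 0 <= A2 * e ^+ 2 by apply: mulr_ge0 => //; lra.
by lra.
Qed.

Lemma local_estimate : exists2 delta : R, 0 < delta &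
  forall y, 0 < y < delta ->
   `|h y - 1 - 4 * kap * lam * (expR (- (2 / sig y)) * cos ((sig y)^-1))|
   <= 4 * kap * lam * expR (- (2 / sig y)) / 10.
Proof.
pose p x := - 2 * kap * P2 x + kap ^+ 2 * P2 x ^+ 2.
have qE x : q x = 1 + p x by rewrite /q /a /p; ring.
pose B0 := 2 * kap * C + kap ^+ 2 * C ^+ 2.
have k2E : `|- 2 * kap| = 2 * kap by rewrite normrM normrN !gtr0_norm.
have l2E : `|- 2 * lam| = 2 * lam by rewrite normrM normrN !gtr0_norm.
have pB x : `|p x| <= B0.
  rewrite /p (le_trans (ler_normD _ _)) // /B0 lerD //.
    by rewrite normrM k2E ler_wpM2l // mulr_ge0 // ltW.
  rewrite normrM (ger0_norm (sqr_ge0 kap)) normrX ler_wpM2l ?sqr_ge0 //.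
  by rewrite lerXn2r ?nnegrE.
have dh (x : R) : is_derive x 1 h (2 * D x).
  apply: isd_eq (isdD (isdM (dc x) (dc x)) (isdZ lam (isdM (ds x) (ds x)))) _.
  by rewrite /D; ring.
have dD (x : R) : is_derive x 1 D (G x - lam * q x * h x).
  apply: isd_eq (isdD (isdM (dc x) (dc1 x)) (isdZ lam (isdM (ds x) (ds1 x)))) _.
  by rewrite /G /h; ring.
have dG (x : R) : is_derive x 1 G (- 2 * lam * q x * D x).
  apply: isd_eq (isdD (isdM (dc1 x) (dc1 x)) (isdZ lam (isdM (ds1 x) (ds1 x)))) _.
  by rewrite /D; ring.
pose e x := h x - 1 - 4 * kap * lam * P x.
pose d x := D x - 2 * kap * lam * P1 x.
pose g x := G x - lam + lam * (h x - 1).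
have de (x : R) : is_derive x 1 e (2 * d x).
  apply: isd_eq (isdB (isdB (dh x) (isdC 1 x 1)) (isdZ (4 * kap * lam) (dP x))) _.
  by rewrite /d; ring.
pose F1 x := (- 2 * lam - lam * p x) * (4 * kap * lam * P x) - lam * kap ^+ 2 * P2 x ^+ 2.
pose F2 x := - 2 * lam * (p x * (2 * kap * lam * P1 x)).
have dd (x : R) : is_derive x 1 d (g x + (- 2 * lam - lam * p x) * e x + F1 x).
  apply: isd_eq (isdB (dD x) (isdZ (2 * kap * lam) (dP1 x))) _.
  by rewrite /F1 /e /g qE /p; ring.
have dg (x : R) : is_derive x 1 g ((- 2 * lam * p x) * d x + F2 x).
  apply: isd_eq (isdD (isdB (dG x) (isdC lam x 1)) (isdZ lam (isdB (dh x) (isdC 1 x 1)))) _.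
  by rewrite /F2 /d qE; ring.
pose A1 := 2 * lam + lam * B0.
pose A2 := 2 * lam * B0.
pose M1 := A1 * (4 * kap * lam) + lam * kap ^+ 2 * C ^+ 2.
pose M2 := 2 * lam * ((2 * kap + kap ^+ 2 * C) * C * (2 * kap * lam) * C).
have B00 : 0 <= B0 by apply: le_trans (pB 0).
have kl : 0 <= kap by exact: ltW.
have ll : 0 <= lam by exact: ltW.
have l1A x : `|- 2 * lam - lam * p x| <= A1.
  by rewrite (le_trans (ler_normB _ _)) // l2E lerD2l normrM (gtr0_norm lam0) ler_wpM2l.
have l2A x : `|- 2 * lam * p x| <= A2.
  by rewrite normrM l2E ler_wpM2l // mulr_ge0.
have F1b x y : 0 < x <= y -> y <= 1/2 -> `|F1 x| <= M1 * expR (- (2 / sig y)).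
  move=> /andP[x0 xy] y1.
  have x1 : 0 < x <= 1 / 2 by rewrite x0 (le_trans xy).
  have [PE P1b P2b] := Ploc x1.
  have sx : 0 < sig x by rewrite -(sig0 R); apply: sig_incr => //; exact: le_trans y1.
  have sxy : sig x <= sig y.
    by move: xy; rewrite le_eqVlt => /predU1P[->//|xy]; apply/ltW/sig_incr => //; exact: ltW.
  have W : expR (- (2 / sig x)) <= expR (- (2 / sig y)).
    by rewrite ler_expR lerN2 ler_wpM2l // lef_pV2 // posrE // (lt_le_trans sx).
  have e3 : expR (- (3 / (2 * sig x))) * expR (- (3 / (2 * sig x))) <= expR (- (2 / sig x)).
    rewrite -expRD ler_expR -opprD lerN2.
    have -> : 3 / (2 * sig x) + 3 / (2 * sig x) = 3 / sig x by field; rewrite gt_eqF.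
    by rewrite ler_wpM2r ?invr_ge0 ?(ltW sx) // ler_nat.
  rewrite /F1 (le_trans (ler_normB _ _)) // /M1 [leRHS]mulrDl lerD //.
    rewrite normrM -[leRHS]mulrA; apply: ler_pM => //.
    rewrite normrM (ger0_norm (_ : 0 <= 4 * kap * lam)) ?mulr_ge0 // ler_wpM2l ?mulr_ge0 //.
    rewrite PE normrM ger0_norm ?expR_ge0 // (le_trans _ W) // ler_piMr ?expR_ge0 //.
    exact: abs_cos.
  rewrite normrM (ger0_norm (_ : 0 <= lam * kap ^+ 2)) ?mulr_ge0 ?sqr_ge0 //.
  rewrite -[leRHS]mulrA ler_wpM2l ?mulr_ge0 ?sqr_ge0 //.
  rewrite normrX (le_trans _ (ler_wpM2l (sqr_ge0 C) (le_trans e3 W))) //.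
  rewrite -expr2 -exprMn lerXn2r // nnegrE // mulr_ge0 ?expR_ge0 //.
have F2b x y : 0 < x <= y -> y <= 1/2 -> `|F2 x| <= M2 * expR (- (2 / sig y)).
  move=> /andP[x0 xy] y1.
  have x1 : 0 < x <= 1 / 2 by rewrite x0 (le_trans xy).
  have [PE P1b P2b] := Ploc x1.
  have sx : 0 < sig x by rewrite -(sig0 R); apply: sig_incr => //; exact: le_trans y1.
  have sxy : sig x <= sig y.
    by move: xy; rewrite le_eqVlt => /predU1P[->//|xy]; apply/ltW/sig_incr => //; exact: ltW.
  have W : expR (- (2 / sig x)) <= expR (- (2 / sig y)).
    by rewrite ler_expR lerN2 ler_wpM2l // lef_pV2 // posrE // (lt_le_trans sx).
  set E := expR (- (3 / (2 * sig x))) in P1b P2b.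
  have E0 : 0 <= E by exact: expR_ge0.
  have e3 : E * E <= expR (- (2 / sig x)).
    rewrite -expRD ler_expR -opprD lerN2.
    have -> : 3 / (2 * sig x) + 3 / (2 * sig x) = 3 / sig x by field; rewrite gt_eqF.
    by rewrite ler_wpM2r ?invr_ge0 ?(ltW sx) // ler_nat.
  have pb : `|p x| <= (2 * kap + kap ^+ 2 * C) * (C * E).
    have -> : p x = (- 2 * kap + kap ^+ 2 * P2 x) * P2 x by rewrite /p; ring.
    rewrite normrM ler_pM // (le_trans (ler_normD _ _)) // k2E lerD2l normrM.
    by rewrite (ger0_norm (sqr_ge0 kap)) ler_wpM2l ?sqr_ge0.
  rewrite /F2 /M2 normrM l2E !normrM (@gtr0_norm _ 2) // (gtr0_norm lam0) (gtr0_norm kap0).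
  rewrite -!mulrA !ler_wpM2l //.
  apply: (@le_trans _ _ (((2 * kap + kap ^+ 2 * C) * (C * E)) * (2 * (kap * (lam * (C * E)))))).
    by apply: ler_pM => //; rewrite ?mulr_ge0 // !ler_wpM2l.
  have -> : ((2 * kap + kap ^+ 2 * C) * (C * E)) * (2 * (kap * (lam * (C * E)))) =
     ((2 * kap + kap ^+ 2 * C) * (C * (2 * (kap * (lam * C))))) * (E * E) by ring.
  rewrite [leRHS](_ : _ = ((2 * kap + kap ^+ 2 * C) * (C * (2 * (kap * (lam * C))))) * expR (- (2 / sig y))); last by ring.
  apply: ler_wpM2l; last exact: le_trans W.
  by rewrite !mulr_ge0 // addr_ge0 ?mulr_ge0 ?sqr_ge0.
pose K0 := 5 + A1 + A2.
have A10 : 0 <= A1 by rewrite addr_ge0 ?mulr_ge0.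
have A20 : 0 <= A2 by rewrite !mulr_ge0.
have K00 : 0 <= K0 by rewrite /K0; lra.
pose K := (M1 ^+ 2 + M2 ^+ 2) * expR K0.
have K_ge0 : 0 <= K by rewrite mulr_ge0 ?expR_ge0 // addr_ge0 ?sqr_ge0.
have main y : 0 < y <= 1/2 -> e y ^+ 2 <= K * y * (expR (- (2 / sig y))) ^+ 2.
  move=> /andP[y0 y1]; set W := expR _.
  have W0 : 0 <= W by exact: expR_ge0.
  have := @gronwall R (fun x => e x * e x + d x * d x + g x * g x)
    (fun x => (2 * d x * e x + e x * (2 * d x)) +
       ((g x + (- 2 * lam - lam * p x) * e x + F1 x) * d x +
        d x * (g x + (- 2 * lam - lam * p x) * e x + F1 x)) +
       ((- 2 * lam * p x * d x + F2 x) * g x + g x * (- 2 * lam * p x * d x + F2 x)))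
    K0 ((M1 ^+ 2 + M2 ^+ 2) * W ^+ 2) y.
  have -> : e 0 = 0 by rewrite /e /h P0 c0 s0; ring.
  have -> : d 0 = 0 by rewrite /d /D P10 c10 s0; ring.
  have -> : g 0 = 0 by rewrite /g /G /h c10 s10 s0 c0; ring.
  rewrite !mulr0 !add0r => gr.
  have {gr} : e y * e y + d y * d y + g y * g y <= (M1 ^+ 2 + M2 ^+ 2) * W ^+ 2 * y * expR (K0 * y).
    apply: gr => //.
    - by move=> x; apply: isdD; [apply: isdD|]; apply: isdM.
    - by rewrite mulr_ge0 ?sqr_ge0 // addr_ge0 ?sqr_ge0.
    - exact: ltW.
    move=> x /andP[x0 xy].
    have xy' : 0 < x <= y by rewrite x0 ltW.
    have f1 : F1 x ^+ 2 <= (M1 * W) ^+ 2.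
      by rewrite -real_normK ?num_real // lerXn2r ?nnegrE ?F1b // (le_trans _ (F1b _ _ xy' y1)).
    have f2 : F2 x ^+ 2 <= (M2 * W) ^+ 2.
      by rewrite -real_normK ?num_real // lerXn2r ?nnegrE ?F2b // (le_trans _ (F2b _ _ xy' y1)).
    have := energy_ineq (e x) (d x) (g x) (F1 x) (F2 x) (l1A x) (l2A x).
    rewrite -/K0; set V := K0 * _ => E.
    apply: (@le_trans _ _ (V + (F1 x ^+ 2 + F2 x ^+ 2))).
      by apply: le_trans E; rewrite le_eqVlt; apply/orP; left; apply/eqP; ring.
    rewrite lerD2l mulrDl -!exprMn; exact: lerD.
  move=> gr.
  apply: (@le_trans _ _ ((M1 ^+ 2 + M2 ^+ 2) * W ^+ 2 * y * expR (K0 * y))).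
    apply: le_trans gr; rewrite expr2.
    by have := sqr_ge0 (d y); have := sqr_ge0 (g y); rewrite !expr2; lra.
  have -> : K * y * W ^+ 2 = (M1 ^+ 2 + M2 ^+ 2) * W ^+ 2 * y * expR K0 by rewrite /K; ring.
  rewrite ler_wpM2l ?mulr_ge0 ?sqr_ge0 ?addr_ge0 ?sqr_ge0 ?(ltW y0) //.
  by rewrite ler_expR ler_piMr //; lra.
pose A := 4 * kap * lam.
have A0 : 0 < A by rewrite !mulr_gt0.
exists (Num.min (1/2) ((A / 10) ^+ 2 / (K + 1))).
  by rewrite lt_min divr_gt0 //= divr_gt0 ?exprn_gt0 ?divr_gt0 // ltr_pwDr.
move=> y /andP[y0]; rewrite lt_min => /andP[y1 y2].
have y12 : 0 < y <= 1/2 by rewrite y0 ltW.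
have [PE _ _] := Ploc y12.
rewrite -PE -/(e y) -/A; have := main y y12; set W := expR _ => m.
have W0 : 0 <= W by exact: expR_ge0.
have -> : A * W / 10 = A / 10 * W by ring.
rewrite -[leRHS]ger0_norm ?mulr_ge0 ?divr_ge0 ?(ltW A0) //.
rewrite -ler_sqr ?nnegrE // !real_normK ?num_real // (le_trans m) // exprMn ler_wpM2r ?sqr_ge0 //.
move: y2; rewrite ltr_pdivlMr; last by rewrite ltr_pwDr.
by move=> /ltW; apply: le_trans; rewrite mulrC ler_wpM2l ?(ltW y0) // lerDl.
Qed.
End LocalEstimate.

Section Peaks.
Variables (R : realType) (h : R -> R) (A delta : R).
Hypothesis hc : continuous h.
Hypothesis h0 : h 0 = 1.
Hypothesis heven : forall x, h (- x) = h x.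
Hypothesis A0 : 0 < A.
Hypothesis delta0 : 0 < delta.
Hypothesis hest : forall y, 0 < y < delta ->
   `|h y - 1 - A * (expR (- (2 / sig y)) * cos ((sig y)^-1))|
   <= A * expR (- (2 / sig y)) / 10.

Lemma cos_ge_half (x : R) : 0 <= x <= 1 -> 1 / 2 <= cos x.
Proof.
move=> /andP[x0 x1].
have d1 (t : R) : is_derive t 1 (fun t => cos t - 1 + t ^+ 2 / 2) (- sin t + t).
  apply: isd_eq (isdD (isdB (is_derive_cos t) (isdC 1 t 1)) (isdM (isdX 1 (isd_id t)) (isdC (2^-1) t 1))) _.
  by field.
have d2 (t : R) : is_derive t 1 (fun t => - sin t + t) (- cos t + 1).
  exact: isdD (isdN (is_derive_sin t)) (isd_id t).
have [|| _ [_ H]] := convex_min d1 d2.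
- by move=> t; have := cos_le1 t; lra.
- by rewrite sin0 oppr0 addr0.
have := H x; rewrite cos0 expr0n /= mul0r addr0 subrr => h'.
have : x ^+ 2 <= 1 by rewrite expr_le1.
lra.
Qed.

Lemma peaks (d : R) : 0 < d -> exists y yp : R,
  [/\ 0 < y < yp /\ yp < d, 1 < h y,
      forall t, `|t| <= yp -> h t <= h y,
      h y * h yp < 1 &
      forall t, `|t| <= y -> h y * h yp < h t ^+ 2].
Proof.
move=> d0.
pose m : R := Num.min (1/4) (Num.min d delta / 2).
have m0 : 0 < m by rewrite lt_min divr_gt0 //= divr_gt0 // lt_min d0.
have [m4 [md mdel]] : m <= 1/4 /\ m < d /\ m < delta.
  have [m1 m2] : m <= 1/4 /\ m <= Num.min d delta / 2 by rewrite !ge_min !lexx orbT.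
  have [m3 m5] : Num.min d delta <= d /\ Num.min d delta <= delta by rewrite !ge_min !lexx orbT.
  by split=> //; split; lra.
have sc : continuous (@sig R) by exact: isd_cont (@isd_sig R).
have spos t : 0 < t <= m -> 0 < sig t.
  by move=> /andP[t0 tm]; rewrite -(sig0 R); apply: sig_incr => //; lra.
have smono t u : 0 <= t -> t < u -> u <= m -> sig t < sig u.
  by move=> *; apply: sig_incr => //; lra.
have pi0 := pi_gt0 R.
have [k hk] : exists k : nat, (sig m)^-1 < (pi *+ 2) * k%:R + pi.
  have [k hk] : exists k : nat, (sig m)^-1 / (pi *+ 2) < k%:R.
    exists (Num.truncn ((sig m)^-1 / (pi *+ 2))).+1.
    exact: Num.Theory.truncnS_gt.
  by exists k; move: hk; rewrite ltr_pdivrMr ?mulr2n; lra.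
set th := _ + pi in hk.
have sm : 0 < sig m by apply: spos; rewrite m0 lexx.
have th0 : 0 < th by apply: lt_trans hk; rewrite invr_gt0.
have point w : th <= w -> exists2 u, 0 < u < m & (sig u)^-1 = w.
  move=> thw; have w0 : 0 < w by exact: lt_le_trans thw.
  have [||u] := @IVT R (@sig R) 0 m w^-1 (ltW m0).
  - exact: continuous_subspaceT.
  - rewrite sig0 ge_min invr_ge0 (ltW w0) /= le_max; apply/orP; right.
    rewrite -[leRHS]invrK lef_pV2 ?posrE ?invr_gt0 //.
    by rewrite (le_trans _ thw) // ltW.
  rewrite in_itv /= => /andP[u0 um] su; exists u; last by rewrite su invrK.
  apply/andP; split.
    rewrite lt_neqAle u0 andbT; apply/eqP => E; move: su; rewrite -E sig0 => /esym/eqP.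
    by rewrite invr_eq0 gt_eqF.
  rewrite lt_neqAle um andbT; apply/eqP => E; move: su; rewrite E => su.
  by move: hk thw; rewrite su invrK => ? ?; lra.
have cosE s : cos (th + s) = - cos s.
  rewrite /th -addrA [pi + s]addrC mulr_natr addrC.
  elim: (k) => [|n IH]; first by rewrite mulr0n addr0 cosDpi.
  by rewrite mulrSr addrA cosD2pi.
have [yp /andP[yp0 ypm] thyp] := point th (lexx _).
have [yk /andP[yk0 ykm] thyk] := point (th + pi) (ltac:(lra)).
pose E (t : R) := expR (- (2 / sig t)).
have Eth (t w : R) : (sig t)^-1 = w -> E t = expR (- (2 * w)) by move=> <-.
pose Ek := expR (- (2 * th)).
have Ek0 : 0 < Ek by exact: expR_gt0.
have AEk0 : 0 < A * Ek by exact: mulr_gt0.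
have est t : 0 < t <= m -> `|h t - 1 - A * (E t * cos ((sig t)^-1))| <= A * E t / 10.
  by move=> /andP[t0 tm]; apply: hest; rewrite t0 (le_lt_trans tm).
have thmono t : 0 < t <= yp -> th <= (sig t)^-1.
  move=> /andP[t0 tyk]; rewrite -thyp lef_pV2 ?posrE ?spos ?t0 ?yp0 /= ?(ltW ypm) //; last first.
    by rewrite (le_trans tyk) // ltW.
  move: tyk; rewrite le_eqVlt => /predU1P[->//|tyk]; apply/ltW/smono => //; exact: ltW.
have e2 : expR (- 2) <= 1 / 4 :> R.
  have e1 : 2 <= expR 1 :> R by have := expR_ge1Dx (1 : R); lra.
  have : 4 <= expR 2 :> R.
    have -> : 2 = 1 + 1 :> R by ring.
    by rewrite expRD; nra.
  move=> e4; rewrite expRN mul1r lef_pV2 ?posrE ?expR_gt0 //.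
have tail t : 0 < t <= yp -> th + 1 <= (sig t)^-1 -> `|h t - 1| <= 275 / 1000 * (A * Ek).
  move=> tt t1.
  have tm : 0 < t <= m by move: tt => /andP[-> tyk] /=; rewrite (le_trans tyk) // ltW.
  have Et : E t <= Ek / 4.
    apply: (@le_trans _ _ (Ek * expR (- 2))); last by rewrite ler_wpM2l ?(ltW Ek0) // -[4^-1]mul1r.
    by rewrite -expRD /E ler_expR; lra.
  have := est t tm; set X := E t * _.
  have Xb : `|X| <= E t by rewrite normrM ger0_norm ?expR_ge0 // ler_piMr ?expR_ge0 ?abs_cos.
  have AX : `|A * X| <= A * E t by rewrite normrM gtr0_norm // ler_wpM2l // ltW.
  have AE : A * E t <= A * (Ek / 4) by rewrite ler_wpM2l // ltW.
  move: AX; rewrite !ler_norml => /andP[a1 a2] /andP[b1 b2].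
  by apply/andP; split; lra.
have head t : 0 < t <= yp -> (sig t)^-1 < th + 1 -> h t < 1.
  move=> tt t1.
  have tm : 0 < t <= m by move: tt => /andP[-> tyk] /=; rewrite (le_trans tyk) // ltW.
  have t2 := thmono t tt.
  have := est t tm.
  have -> : (sig t)^-1 = th + ((sig t)^-1 - th) by ring.
  rewrite cosE.
  have : 1/2 <= cos ((sig t)^-1 - th) by apply: cos_ge_half; apply/andP; split; lra.
  set cc := cos _ => c12.
  have AE : 0 < A * E t by rewrite mulr_gt0 // expR_gt0.
  have : A * E t * (1/2) <= A * E t * cc by rewrite ler_wpM2l // ltW.
  rewrite ler_norml => h1 /andP[_ h2]; lra.
have hyp : h yp - 1 <= - (9/10) * (A * Ek).
  have := est yp; rewrite yp0 (ltW ypm) => /(_ isT).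
  have := cosE 0; rewrite addr0 cos0 thyp => ->.
  by rewrite (Eth _ _ thyp) -/Ek ler_norml => /andP[_]; lra.
have ykyp : yk < yp.
  rewrite ltNge; apply/negP; rewrite le_eqVlt => /predU1P[E1|yy].
    by move: thyk; rewrite -E1 thyp; lra.
  have := smono _ _ (ltW yp0) yy (ltW ykm).
  rewrite -ltf_pV2 ?posrE ?spos ?yp0 ?yk0 ?(ltW ypm) ?(ltW ykm) // thyk thyp; lra.
have hyk : 1 < h yk.
  have := est yk; rewrite yk0 (ltW ykm) => /(_ isT).
  rewrite thyk cosE cospi opprK.
  have AE : 0 < A * E yk by rewrite mulr_gt0 // expR_gt0.
  by rewrite ler_norml => /andP[h1 _]; lra.
have [y yI ymax] := @EVT_max R h 0 yp (ltW yp0) (continuous_subspaceT hc).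
move: yI; rewrite in_itv /= => /andP[y0 yyp].
have hy1 : 1 < h y.
  apply: (lt_le_trans hyk); apply: ymax; rewrite in_itv /= (ltW yk0) (ltW ykyp) //.
have ypos : 0 < y.
  by rewrite lt_neqAle y0 andbT; apply/eqP => E1; move: hy1; rewrite -E1 h0 ltxx.
have yltp : y < yp.
  rewrite lt_neqAle yyp andbT; apply/eqP => E1; move: hy1 hyp; rewrite E1; lra.
have yI2 : 0 < y <= yp by rewrite ypos.
have thy : th + 1 <= (sig y)^-1.
  by rewrite leNgt; apply/negP => /(head _ yI2); lra.
have hyb := tail y yI2 thy.
have prod : h y * h yp <= 1 - 625 / 1000 * (A * Ek).
  move: hyb; rewrite ler_norml => /andP[_ b2].
  have : (h y - 1) * (h yp - 1) <= 0.
    by apply: mulr_ge0_le0; lra.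
  lra.
exists y, yp; split.
- by rewrite ypos yltp; split => //; exact: lt_trans md.
- by [].
- move=> t tyk.
  have -> : h t = h `|t|.
    by have [t0|t0] := leP 0 t; [rewrite ger0_norm|rewrite ltr0_norm ?heven].
  by apply: ymax; rewrite in_itv /= normr_ge0.
- lra.
move=> t ty.
have -> : h t = h `|t|.
  by have [t0|t0] := leP 0 t; [rewrite ger0_norm|rewrite ltr0_norm ?heven].
apply: (le_lt_trans prod).
have [t0|t0] := eqVneq t 0; first by rewrite t0 normr0 h0 expr1n; lra.
have tp : 0 < `|t| by rewrite normr_gt0.
have tI : 0 < `|t| <= yp by rewrite tp (le_trans ty).
have tht : th + 1 <= (sig `|t|)^-1.
  apply: (le_trans thy); rewrite lef_pV2 ?posrE ?spos ?ypos ?tp ?(le_trans _ (ltW ypm)) //; last first.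
    by rewrite (le_trans ty).
  move: ty; rewrite le_eqVlt => /predU1P[->//|tyk]; apply/ltW/smono => //.
  by rewrite (le_trans yyp) // ltW.
have := tail _ tI tht; rewrite ler_norml => /andP[b1 b2].
have := sqr_ge0 (h `|t| - 1).
by lra.
Qed.
End Peaks.

Definition has_peaks (R : realType) (h : R -> R) : Prop :=
  forall d : R, 0 < d -> exists y yp : R,
  [/\ 0 < y < yp /\ yp < d, 1 < h y,
      forall t, `|t| <= yp -> h t <= h y,
      h y * h yp < 1 &
      forall t, `|t| <= y -> h y * h yp < h t ^+ 2].

Section Data.
Variable R : realType.

Definition ode_pair (q : R -> R) (lam : R) (u v : R -> R) : Prop :=
  (forall x : R, is_derive x 1 u (v x)) /\
  (forall x : R, is_derive x 1 v (- (lam * (q x * u x)))).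

Lemma bls_data : exists (q : R -> R) (lam : nat -> R) (c c1 s s1 : nat -> R -> R),
  [/\ smooth1 q, forall x, 0 < q x, forall x, q (x + 2 * pi) = q x &
   forall j, (1 <= j)%N ->
     [/\ 9 * j%:R ^+ 2 <= lam j,
         ode_pair q (lam j) (c j) (c1 j) /\ ode_pair q (lam j) (s j) (s1 j),
         (forall x, c j (x + 2 * pi) = c j x /\ s j (x + 2 * pi) = s j x) /\
         (forall x, c j (- x) = c j x /\ s j (- x) = - s j x),
         c j 0 = 1 /\ s j 0 = 0 &
         has_peaks (fun x => c j x * c j x + lam j * (s j x * s j x))]].
Proof.
have [P [P1 [P2 [P3 [C [[dP dP1 dP2] sP2 [P2per P2even P10 P1L P0] [C0 PC] Ploc]]]]]] := profile_exists R.
pose kap : R := (64 * (C + 1))^-1.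
have kap0 : 0 < kap by rewrite invr_gt0 mulr_gt0 // ltr_pwDr.
have kapC : kap * C <= 1 / 64.
  rewrite /kap invfM -mulrA -[1 / 64]mulrC ler_wpM2l ?invr_ge0 //.
  by rewrite mulrC ler_pdivrMr ?mul1r ?lerDl // ltr_pwDr.
pose L : R := 2 * pi / 3.
pose a x := 1 - kap * P2 x.
pose a' x := - (kap * P3 x).
pose q x := a x ^+ 2.
pose T x := x - kap * P1 x.
have kb x : `|kap * P2 x| <= 1 / 64.
  rewrite normrM gtr0_norm // (le_trans _ kapC) // ler_wpM2l ?(ltW kap0) //; exact: (PC x).1.
have a_ge x : 63 / 64 <= a x <= 65 / 64.
  by have := kb x; rewrite ler_norml /a => /andP[? ?]; apply/andP; split; lra.
have a0 x : 0 < a x by have /andP[? _] := a_ge x; lra.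
have da (x : R) : is_derive x 1 a (a' x).
  by apply: isd_eq (isdB (isdC 1 x 1) (isdZ kap (dP2 x))) _; rewrite sub0r.
have dq (x : R) : is_derive x 1 q (2 * a x * a' x).
  by apply: isd_eq (isdX 1 (da x)) _; rewrite expr1.
have a'b x : `|a' x| <= 1 / 64.
  rewrite normrN normrM gtr0_norm // (le_trans _ kapC) // ler_wpM2l ?(ltW kap0) //; exact: (PC x).2.
have qQ x : `|q x| <= 2.
  rewrite ger0_norm ?sqr_ge0 // /q expr2.
  have /andP[h1 h2] := a_ge x.
  have : a x * a x <= (65 / 64) * (65 / 64) by apply: ler_pM => //; rewrite ltW.
  lra.
have qQ1 x : `|2 * a x * a' x| <= 1.
  have /andP[h1 h2] := a_ge x.
  rewrite !normrM (gtr0_norm (a0 x)) gtr0_norm //.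
  have : 2 * a x * `|a' x| <= (2 * (65 / 64)) * (1 / 64).
    by apply: ler_pM => //; [rewrite mulr_ge0 // ltW|rewrite ler_pM2l].
  lra.
have dT (x : R) : is_derive x 1 T (a x).
  exact: isdB (isd_id x) (isdZ kap (dP1 x)).
have T0 : T 0 = 0 by rewrite /T P10 mulr0 subrr.
have TL : T L = L by rewrite /T P1L mulr0 subr0.
have ba x : `|a' x| <= 1 / 63 * a x.
  by rewrite (le_trans (a'b x)) //; have /andP[h1 h2] := a_ge x; lra.
have bL : 1 / 63 * L <= 1 / 8 by rewrite /L; have := pihalf_lt2 R; lra.
have aper x : a (x + L) = a x by rewrite /a /L P2per.
have qper x : q (x + L) = q x by rewrite /q aper.
have L3 : 3 * L = 2 * pi by rewrite /L; field.
have qper3 x : q (x + 2 * pi) = q x.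
  by rewrite -L3 (_ : x + 3 * L = x + L + L + L); [rewrite !qper|ring].
have qeven x : q (- x) = q x by rewrite /q /a P2even.
have qsm : smooth1 q.
  move=> k; rewrite /q; under eq_fun do rewrite expr2.
  have ak : csm k a by apply: csmD; [exact: csm_cst|apply: csmN; exact: csmZ].
  exact: csmM.
have fund (al be : R) : forall lam : R, exists uv : (R -> R) * (R -> R),
    [/\ ode_pair q lam uv.1 uv.2, uv.1 0 = al & uv.2 0 = be].
  move=> lam; have [u [v [h1 h2 h3 h4]]] := ode_exists lam al be dq qQ qQ1.
  by exists (u, v); split.
have [cc hc] := choice (fund 1 0).
have [ss hs] := choice (fund 0 1).
have ex j : exists nu : R, (1 <= j)%N -> 3 * j%:R <= nu /\ (cc (nu ^+ 2)).1 L = - 1 / 2.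
  have [j0|j0] := ltnP 0 j; last by exists 0.
  have [||||nu n1 n2] := @spectrum_exists R q 2 qQ
    (fun lam => (cc lam).1) (fun lam => (cc lam).2) _ _ _ _ a a' T (1 / 63)
    (fun x => erefl) a0 da dT T0 ba j L erefl TL bL j0.
  - by move=> lam; have [[]] := hc lam.
  - by move=> lam; have [[]] := hc lam.
  - by move=> lam; have [] := hc lam.
  - by move=> lam; have [] := hc lam.
  by exists nu.
have [nu hnu] := choice ex.
exists q, (fun j => nu j ^+ 2), (fun j => (cc (nu j ^+ 2)).1), (fun j => (cc (nu j ^+ 2)).2),
  (fun j => (ss (nu j ^+ 2)).1), (fun j => (ss (nu j ^+ 2)).2).
split=> //; first by move=> x; rewrite exprn_gt0.
move=> j j1; have [n1 n2] := hnu j j1.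
set lam := nu j ^+ 2.
have [[dc dc1] c0 c10] := hc lam; have [[ds ds1] s0 s10] := hs lam.
have jr : 0 < j%:R :> R by rewrite ltr0n.
have lam0 : 0 < lam by rewrite exprn_gt0 // (lt_le_trans _ n1) // mulr_gt0.
have per x := @floquet3 R q lam _ _ _ _ dc dc1 ds ds1 c0 c10 s0 s10 L qeven qper n2 x.
split=> //.
- rewrite (_ : 9 * _ = (3 * j%:R) ^+ 2); last by ring.
  by rewrite lerXn2r // nnegrE ?mulr_ge0 ?ler0n // (le_trans _ n1) // mulr_ge0 // ler0n.
- split=> x; first by rewrite -L3; exact: per.
  by split; [exact: c_even dc dc1 ds ds1 c0 c10 s0 s10 qeven x|exact: s_odd dc dc1 ds ds1 c0 c10 s0 s10 qeven x].
have [delta d0 est] := @local_estimate R P P1 P2 C kap lam dP dP1 P0 P10 C0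
  (fun x => (PC x).1) Ploc kap0 lam0 _ _ _ _ dc dc1 ds ds1 c0 c10 s0 s10.
have ce x := c_even dc dc1 ds ds1 c0 c10 s0 s10 qeven x.
have so x := s_odd dc dc1 ds ds1 c0 c10 s0 s10 qeven x.
apply: (@peaks R _ (4 * kap * lam) delta) => //.
- apply: (@isd_cont R _ (fun x => (((cc lam).2 x * (cc lam).1 x + (cc lam).1 x * (cc lam).2 x)
    + lam * ((ss lam).2 x * (ss lam).1 x + (ss lam).1 x * (ss lam).2 x)))) => x.
  by apply: isdD; [apply: isdM|apply: isdZ; apply: isdM].
- by rewrite c0 s0 !mulr0 mulr1 addr0.
- by move=> x; rewrite ce so mulrNN.
- by rewrite mulr_gt0 // mulr_gt0.
Qed.
End Data.

                                                    

Section Smn.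
Variables (R : realType).

Fixpoint smn n (k : nat) (f : 'rV[R]_n -> R) : Prop :=
  if k is k'.+1 then continuous f /\ forall i : 'I_n, exists2 f' : 'rV[R]_n -> R,
      (forall x, is_derive x (delta_mx 0 i) f (f' x)) & smn k' f'
  else continuous f.

Definition smooth n (f : 'rV[R]_n -> R) := forall k, smn k f.

Lemma smn_cont n k (f : 'rV[R]_n -> R) : smn k f -> continuous f.
Proof. by case: k => [//|k] []. Qed.

Lemma smnW n k (f : 'rV[R]_n -> R) : smn k.+1 f -> smn k f.
Proof.
elim: k f => [|k IH] f [cf h]; first exact: cf.
by split=> // i; have [f' d sf'] := h i; exists f' => //; exact: IH.
Qed.

Lemma smn_cst n k (c : R) : smn k (fun _ : 'rV[R]_n => c).
Proof.
elim: k c => [|k IH] c /=; first exact: cst_continuous.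
split; first exact: cst_continuous.
by move=> i; exists (fun=> 0) => // x; exact: isdC.
Qed.

Lemma smnD n k (f g : 'rV[R]_n -> R) : smn k f -> smn k g -> smn k (fun x => f x + g x).
Proof.
elim: k f g => [|k IH] f g; first by move=> /= hu hv x; exact: continuousD (hu x) (hv x).
move=> [cf hf] [cg hg]; split; first by move=> x; exact: continuousD (cf x) (cg x).
move=> i; have [f' df sf] := hf i; have [g' dg sg] := hg i.
by exists (fun x => f' x + g' x); [move=> x; exact: isdD|exact: IH].
Qed.

Lemma smnM n k (f g : 'rV[R]_n -> R) : smn k f -> smn k g -> smn k (fun x => f x * g x).
Proof.
elim: k f g => [|k IH] f g; first by move=> /= hu hv x; exact: continuousM (hu x) (hv x).
move=> hf0 hg0; have hf1 := smnW hf0; have hg1 := smnW hg0.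
move: hf0 hg0 => [cf hf] [cg hg]; split; first by move=> x; exact: continuousM (cf x) (cg x).
move=> i; have [f' df sf] := hf i; have [g' dg sg] := hg i.
exists (fun x => f' x * g x + f x * g' x); first by move=> x; exact: isdM.
by apply: smnD; exact: IH.
Qed.

Lemma smnZ n k c (f : 'rV[R]_n -> R) : smn k f -> smn k (fun x => c * f x).
Proof. by move=> hf; apply: smnM => //; exact: smn_cst. Qed.

Lemma smnN n k (f : 'rV[R]_n -> R) : smn k f -> smn k (fun x => - f x).
Proof.
move=> hu; rewrite (_ : (fun x => - f x) = (fun x => -1 * f x)); first exact: smnZ.
by apply/funext => x; rewrite mulN1r.
Qed.

Lemma smnB n k (f g : 'rV[R]_n -> R) : smn k f -> smn k g -> smn k (fun x => f x - g x).
Proof. by move=> hf hg; apply: smnD => //; exact: smnN. Qed.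

Lemma smn_sum n k m (f : 'I_m -> 'rV[R]_n -> R) : (forall i, smn k (f i)) ->
  smn k (fun x => \sum_i f i x).
Proof.
elim: m f => [|m IH] f h.
  by under eq_fun do rewrite big_ord0; exact: smn_cst.
under eq_fun do rewrite big_ord_recl; apply: smnD => //; exact: IH.
Qed.

Lemma smn_comp n k (u : R -> R) (f : 'rV[R]_n -> R) : csm k u -> smn k f ->
  smn k (fun x => u (f x)).
Proof.
elim: k u f => [|k IH] u f.
  by move=> hu hv x; apply: (@continuous_comp _ _ _ f u); [exact: hv|exact: hu].
move=> hu hf; have hf0 := smnW hf; have cu := csm_cont hu.
move: hu hf => [u' du su] [cf hf]; split.
  by move=> x; apply: (@continuous_comp _ _ _ f u); [exact: cf|exact: cu].
move=> i; have [f' df sf] := hf i; exists (fun x => u' (f x) * f' x).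
  by move=> x; exact: isd_comp.
by apply: smnM => //; exact: IH.
Qed.

Lemma smnV n k (f : 'rV[R]_n -> R) : (forall x, f x != 0) -> smn k f ->
  smn k (fun x => (f x)^-1).
Proof.
move=> f0; elim: k => [|k IH]; first by move=> /= hf x; exact: continuousV (f0 x) (hf x).
move=> hf; have hf0 := smnW hf; move: hf => [cf hf]; split.
  by move=> x; exact: continuousV (f0 x) (cf x).
move=> i; have [f' df sf] := hf i; exists (fun x => - f' x / f x ^+ 2).
  by move=> x; exact: isdV.
under eq_fun do rewrite expr2 invfM.
have sfi := IH hf0.
by apply: smnM; [exact: smnN|exact: smnM].
Qed.

Lemma isd_coord n (i j : 'I_n) (x : 'rV[R]_n) :
  is_derive x (delta_mx 0 i) (fun y => y 0 j) (i == j)%:R.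
Proof.
apply/isd_line; have E : (fun t : R => (t *: delta_mx 0 i + x) 0 j) = (fun t : R => (i == j)%:R * t + x 0 j).
  by apply/funext => t; rewrite !mxE eqxx /= mulrC eq_sym.
rewrite E; move: (i == j) => b.
have := isdD (isdZ b%:R (isd_id (0 : R))) (isdC (x 0 j) (0 : R) 1).
by rewrite mulr1 addr0.
Qed.

Lemma smn_coord n k (j : 'I_n) : smn k (fun x : 'rV[R]_n => x 0 j).
Proof.
case: k => [|k]; first exact: coord_continuous.
split; first exact: coord_continuous.
move=> i; exists (fun=> (i == j)%:R); last exact: smn_cst.
by move=> x; exact: isd_coord.
Qed.

Lemma pderiv_is n (i : 'I_n) (f f' : 'rV[R]_n -> R) :
  (forall x, is_derive x (delta_mx 0 i) f (f' x)) -> pderiv i f = f'.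
Proof. by move=> h; apply/funext => x; rewrite /pderiv; case: (h x). Qed.

Lemma smn_pderiv n k (f : 'rV[R]_n -> R) i : smn k.+1 f -> smn k (pderiv i f).
Proof. by move=> [_ /(_ i)[f' df sf']]; rewrite (pderiv_is df). Qed.

Lemma smn_is_derive n k (f : 'rV[R]_n -> R) i x : smn k.+1 f ->
  is_derive x (delta_mx 0 i) f (pderiv i f x).
Proof. by move=> [_ /(_ i)[f' df sf']]; rewrite (pderiv_is df). Qed.

Lemma smooth_pderiv n (f : 'rV[R]_n -> R) i : smooth f -> smooth (pderiv i f).
Proof. by move=> h k; exact: smn_pderiv. Qed.

Lemma smooth_is_derive n (f : 'rV[R]_n -> R) i x : smooth f ->
  is_derive x (delta_mx 0 i) f (pderiv i f x).
Proof. by move=> h; exact: (smn_is_derive _ _ (h 1%N)). Qed.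

Lemma smooth_iter n (f : 'rV[R]_n -> R) s : smooth f -> smooth (iter_pderiv s f).
Proof. by move=> sf; elim: s => [//|i s IH] /=; exact: smooth_pderiv. Qed.

Lemma torus_smoothP n (f : 'rV[R]_n -> R) :
  torus_smooth f <-> (forall k x, f (x + period R k) = f x) /\ smooth f.
Proof.
split=> [[h1 h2 h3]|[h1 sf]].
  split=> // k.
  suff : forall s, smn k (iter_pderiv s f) by move=> /(_ [::]).
  elim: k => [|k IH] s; first exact: h2.
  split; first exact: h2.
  by move=> i; exists (iter_pderiv (i :: s) f) => // x; exact: derivableP.
split=> //.
  by move=> s; exact: (smooth_iter s sf) 0%N.
by move=> s x i; case: (smooth_is_derive i x (smooth_iter s sf)).
Qed.

Lemma pderivD n i (f g : 'rV[R]_n -> R) : smooth f -> smooth g ->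
  pderiv i (fun x => f x + g x) = fun x => pderiv i f x + pderiv i g x.
Proof.
by move=> sf sg; apply: pderiv_is => x; apply: isdD; exact: smooth_is_derive.
Qed.

Lemma pderivB n i (f g : 'rV[R]_n -> R) : smooth f -> smooth g ->
  pderiv i (fun x => f x - g x) = fun x => pderiv i f x - pderiv i g x.
Proof.
by move=> sf sg; apply: pderiv_is => x; apply: isdB; exact: smooth_is_derive.
Qed.

Lemma pderivZ n i c (f : 'rV[R]_n -> R) : smooth f ->
  pderiv i (fun x => c * f x) = fun x => c * pderiv i f x.
Proof. by move=> sf; apply: pderiv_is => x; apply: isdZ; exact: smooth_is_derive. Qed.

Lemma pderivM n i (f g : 'rV[R]_n -> R) : smooth f -> smooth g ->
  pderiv i (fun x => f x * g x) = fun x => pderiv i f x * g x + f x * pderiv i g x.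
Proof.
by move=> sf sg; apply: pderiv_is => x; apply: isdM; exact: smooth_is_derive.
Qed.

Lemma pderiv_cst n i (c : R) : pderiv i (fun _ : 'rV[R]_n => c) = fun=> 0.
Proof. by apply: pderiv_is => x; exact: isdC. Qed.

Section Product.
Variables m n : nat.
Implicit Types (f : 'rV[R]_m -> R) (g : 'rV[R]_n -> R) (z : 'rV[R]_(m + n)).

Lemma lsubmx_line (t : R) (i : 'I_m) z :
  lsubmx (t *: delta_mx 0 (lshift n i) + z) = t *: delta_mx 0 i + lsubmx z.
Proof. by apply/rowP => j; rewrite !mxE !eqxx eq_lshift. Qed.
Lemma lsubmx_line0 (t : R) (i : 'I_n) z :
  lsubmx (t *: delta_mx 0 (rshift m i) + z) = lsubmx z.
Proof. by apply/rowP => j; rewrite !mxE !eqxx eq_lrshift mulr0 add0r. Qed.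
Lemma rsubmx_line (t : R) (i : 'I_n) z :
  rsubmx (t *: delta_mx 0 (rshift m i) + z) = t *: delta_mx 0 i + rsubmx z.
Proof. by apply/rowP => j; rewrite !mxE !eqxx eq_rshift. Qed.
Lemma rsubmx_line0 (t : R) (i : 'I_m) z :
  rsubmx (t *: delta_mx 0 (lshift n i) + z) = rsubmx z.
Proof. by apply/rowP => j; rewrite !mxE !eqxx eq_rlshift mulr0 add0r. Qed.

Lemma isd_lsubmx f (i : 'I_m) z a : is_derive (lsubmx z) (delta_mx 0 i) f a ->
  is_derive z (delta_mx 0 (lshift n i)) (fun z => f (lsubmx z)) a.
Proof.
by move=> /isd_line h; apply/isd_line; under eq_fun do rewrite lsubmx_line.
Qed.
Lemma isd_lsubmx0 f (i : 'I_n) z :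
  is_derive z (delta_mx 0 (rshift m i)) (fun z => f (lsubmx z)) 0.
Proof. by apply/isd_line; under eq_fun do rewrite lsubmx_line0; exact: isdC. Qed.
Lemma isd_rsubmx g (i : 'I_n) z a : is_derive (rsubmx z) (delta_mx 0 i) g a ->
  is_derive z (delta_mx 0 (rshift m i)) (fun z => g (rsubmx z)) a.
Proof.
by move=> /isd_line h; apply/isd_line; under eq_fun do rewrite rsubmx_line.
Qed.
Lemma isd_rsubmx0 g (i : 'I_m) z :
  is_derive z (delta_mx 0 (lshift n i)) (fun z => g (rsubmx z)) 0.
Proof. by apply/isd_line; under eq_fun do rewrite rsubmx_line0; exact: isdC. Qed.

Lemma lsubmx_cont : continuous (fun z : 'rV[R]_(m + n) => lsubmx z).
Proof. by move=> z; apply: differentiable_continuous; exact: differentiable_lsubmx. Qed.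
Lemma rsubmx_cont : continuous (fun z : 'rV[R]_(m + n) => rsubmx z).
Proof. by move=> z; apply: differentiable_continuous; exact: differentiable_rsubmx. Qed.

Lemma smn_lsubmx k f : smn k f -> smn k (fun z => f (lsubmx z)).
Proof.
elim: k f => [|k IH] f.
  by move=> cf z; apply: (@continuous_comp _ _ _ (fun z => lsubmx z) f); [exact: lsubmx_cont|exact: cf].
move=> [cf h]; split.
  by move=> z; apply: (@continuous_comp _ _ _ (fun z => lsubmx z) f); [exact: lsubmx_cont|exact: cf].
move=> i; rewrite -(splitK i); case: (fintype.split i) => j /=.
  have [f' df sf] := h j; exists (fun z => f' (lsubmx z)); last exact: IH.
  by move=> z; apply: isd_lsubmx.
exists (fun=> 0); last exact: smn_cst.
by move=> z; exact: isd_lsubmx0.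
Qed.

Lemma smn_rsubmx k g : smn k g -> smn k (fun z => g (rsubmx z)).
Proof.
elim: k g => [|k IH] f.
  by move=> cf z; apply: (@continuous_comp _ _ _ (fun z => rsubmx z) f); [exact: rsubmx_cont|exact: cf].
move=> [cf h]; split.
  by move=> z; apply: (@continuous_comp _ _ _ (fun z => rsubmx z) f); [exact: rsubmx_cont|exact: cf].
move=> i; rewrite -(splitK i); case: (fintype.split i) => j /=.
  exists (fun=> 0); last exact: smn_cst.
  by move=> z; exact: isd_rsubmx0.
have [f' df sf] := h j; exists (fun z => f' (rsubmx z)); last exact: IH.
by move=> z; apply: isd_rsubmx.
Qed.

Lemma pderiv_lsubmx f (i : 'I_m) : smooth f ->
  pderiv (lshift n i) (fun z => f (lsubmx z)) = fun z => pderiv i f (lsubmx z).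
Proof. by move=> sf; apply: pderiv_is => z; apply: isd_lsubmx; exact: smooth_is_derive. Qed.
Lemma pderiv_lsubmx0 f (i : 'I_n) :
  pderiv (rshift m i) (fun z => f (lsubmx z)) = fun=> 0.
Proof. by apply: pderiv_is => z; exact: isd_lsubmx0. Qed.
Lemma pderiv_rsubmx g (i : 'I_n) : smooth g ->
  pderiv (rshift m i) (fun z => g (rsubmx z)) = fun z => pderiv i g (rsubmx z).
Proof. by move=> sf; apply: pderiv_is => z; apply: isd_rsubmx; exact: smooth_is_derive. Qed.
Lemma pderiv_rsubmx0 g (i : 'I_m) :
  pderiv (lshift n i) (fun z => g (rsubmx z)) = fun=> 0.
Proof. by apply: pderiv_is => z; exact: isd_rsubmx0. Qed.

Lemma pderiv_fst (h : 'rV[R]_(m + n) -> R) (i : 'I_m) (y : 'rV[R]_n) :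
  pderiv i (fun x => h (row_mx x y)) = fun x => pderiv (lshift n i) h (row_mx x y).
Proof.
apply/funext => x; rewrite /pderiv /derive.
set v := delta_mx _ _; set w := delta_mx _ _.
have E t : row_mx (t *: v + x) y = t *: w + row_mx x y.
  by rewrite /w delta_mx_lshift scale_row_mx add_row_mx scaler0 add0r.
suff -> : (fun t : R => t^-1 *: (((fun x0 => h (row_mx x0 y)) \o shift x) (t *: v) - h (row_mx x y)))
  = (fun t => t^-1 *: ((h \o shift (row_mx x y)) (t *: w) - h (row_mx x y))) by [].
by apply/funext => t /=; rewrite E.
Qed.
Lemma pderiv_snd (h : 'rV[R]_(m + n) -> R) (i : 'I_n) (x : 'rV[R]_m) :
  pderiv i (fun y => h (row_mx x y)) = fun y => pderiv (rshift m i) h (row_mx x y).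
Proof.
apply/funext => y; rewrite /pderiv /derive.
set v := delta_mx _ _; set w := delta_mx _ _.
have E t : row_mx x (t *: v + y) = t *: w + row_mx x y.
  by rewrite /w delta_mx_rshift scale_row_mx add_row_mx scaler0 add0r.
suff -> : (fun t : R => t^-1 *: (((fun y0 => h (row_mx x y0)) \o shift y) (t *: v) - h (row_mx x y)))
  = (fun t => t^-1 *: ((h \o shift (row_mx x y)) (t *: w) - h (row_mx x y))) by [].
by apply/funext => t /=; rewrite E.
Qed.
End Product.

Lemma int_periodic (T : Type) (u : R -> T) : (forall x, u (x + 2 * pi) = u x) ->
  forall (z : int) x, u (x + 2 * pi * z%:~R) = u x.
Proof.
move=> h; suff H (n : nat) x : u (x + 2 * pi * n%:R) = u x.
  case=> n x; first exact: H.
  rewrite NegzE mulrNz mulrN -[in RHS](subrK (2 * pi * n.+1%:R) x) H //.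
elim: n x => [|n IH] x; first by rewrite mulr0 addr0.
by rewrite -[n.+1%:R]natr1 mulrDr mulr1 addrA h IH.
Qed.

Lemma period_coord n (k : 'rV[int]_n) i : period R k 0 i = 2 * pi * (k 0 i)%:~R.
Proof. by rewrite /period !mxE. Qed.

Lemma period_lsubmx m n (k : 'rV[int]_(m + n)) : lsubmx (period R k) = period R (lsubmx k).
Proof. by apply/rowP => i; rewrite mxE !period_coord mxE. Qed.
Lemma period_rsubmx m n (k : 'rV[int]_(m + n)) : rsubmx (period R k) = period R (rsubmx k).
Proof. by apply/rowP => i; rewrite mxE !period_coord mxE. Qed.
End Smn.

Lemma add_period (R : realType) n (x : 'rV[R]_n) (k : 'rV[int]_n) i :
  (x + period R k) 0 i = x 0 i + 2 * pi * (k 0 i)%:~R.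
Proof. by rewrite mxE period_coord. Qed.

Section Metric.
Variables (R : realType) (q : R -> R).
Hypothesis qs : smooth1 q.
Hypothesis q0 : forall x, 0 < q x.
Hypothesis qper : forall x, q (x + 2 * pi) = q x.

Definition cfac (x : 'rV[R]_2) : R := q (x 0 0) + q (x 0 1).
Definition gconf (x : 'rV[R]_2) : 'M[R]_2 := (cfac x)%:M.

Lemma cfac_gt0 x : 0 < cfac x. Proof. by rewrite addr_gt0. Qed.
Lemma cfac_neq0 x : cfac x != 0. Proof. by rewrite gt_eqF // cfac_gt0. Qed.
Lemma smooth_cfac : smooth cfac.
Proof. by move=> k; apply: smnD; apply: (@smn_comp R 2 k q) => //; exact: smn_coord. Qed.

Lemma cfac_periodic k x : cfac (x + period R k) = cfac x.
Proof. by rewrite /cfac !add_period !(int_periodic qper). Qed.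

Lemma gconf_metric : riemannian_metric gconf.
Proof.
split=> [i j|x|x v v0].
- apply/torus_smoothP; split=> k.
    by move=> x; rewrite /gconf cfac_periodic.
  have -> : (fun x => gconf x i j) = (fun x => (i == j)%:R * cfac x).
    by apply/funext => x; rewrite !mxE mulr_natl.
  by apply: smnZ; exact: smooth_cfac.
- by rewrite tr_scalar_mx.
rewrite mul_mx_scalar -scalemxAl mxE mulr_gt0 ?cfac_gt0 // mxE.
under eq_bigr do rewrite mxE -expr2.
have [i vi] : exists i, v 0 i != 0.
  by apply/existsP; apply: contraNT v0; rewrite negb_exists => /forallP h;
    apply/eqP/rowP => i; rewrite mxE; apply/eqP; rewrite -[_ == _]negbK; exact: h.
rewrite (bigD1 i) //= ltr_pwDl ?exprn_even_gt0 // sumr_ge0 // => j _; exact: sqr_ge0.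
Qed.

Lemma vol_gconf x : vol_density gconf x = cfac x.
Proof. by rewrite /vol_density det_scalar sqrtr_sqr gtr0_norm // cfac_gt0. Qed.

Lemma laplace_gconf f x : laplace gconf f x =
  - ((cfac x)^-1 * (pderiv 0 (pderiv 0 f) x + pderiv 1 (pderiv 1 f) x)).
Proof.
rewrite /laplace /divergence vol_gconf; congr (- (_ * _)).
have E i : (fun y => vol_density gconf y * gradient gconf f y 0 i) = pderiv i f.
  apply/funext => y; rewrite vol_gconf mxE /gconf invmx_scalar (bigD1 i) //= big1 ?addr0.
    by rewrite mxE eqxx mulrA mulfV ?cfac_neq0 // mul1r.
  by move=> j ji; rewrite mxE eq_sym (negbTE ji) mul0r.
by rewrite big_ord_recl big_ord1 !E; congr (_ + pderiv _ (pderiv _ _) _); apply/val_inj.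
Qed.

Lemma laplace_sum f1 f2 z : smooth f1 -> smooth f2 ->
  laplace (metric_sum gconf gconf) (fun_sum f1 f2) z =
  laplace gconf f1 (lsubmx z) + laplace gconf f2 (rsubmx z).
Proof.
move=> sf1 sf2; rewrite !laplace_gconf.
have vE y : vol_density (metric_sum gconf gconf) y = cfac (lsubmx y) * cfac (rsubmx y).
  rewrite /vol_density /metric_sum det_ublock !det_scalar -exprMn sqrtr_sqr gtr0_norm //.
  by rewrite mulr_gt0 // cfac_gt0.
have gl y (i : 'I_2) : gradient (metric_sum gconf gconf) (fun_sum f1 f2) y 0 (lshift 2 i) =
    (cfac (lsubmx y))^-1 * pderiv i f1 (lsubmx y).
  rewrite mxE /metric_sum invmx_block_diag; last first.
    by rewrite unitmxE det_ublock !det_scalar unitfE mulf_neq0 // expf_neq0 // cfac_neq0.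
  rewrite big_split_ord /= [X in _ + X]big1 ?addr0; last first.
    by move=> j _; rewrite block_mxEur mxE mul0r.
  rewrite (bigD1 i) //= big1 ?addr0; last first.
    by move=> j ji; rewrite block_mxEul invmx_scalar mxE eq_sym (negbTE ji) mul0r.
  rewrite block_mxEul invmx_scalar mxE eqxx mulr1n; congr (_ * _).
  rewrite pderivD; last 2 first.
  - by move=> k; apply: smn_lsubmx.
  - by move=> k; apply: smn_rsubmx.
  by rewrite pderiv_lsubmx // pderiv_rsubmx0 addr0.
have gr y (i : 'I_2) : gradient (metric_sum gconf gconf) (fun_sum f1 f2) y 0 (rshift 2 i) =
    (cfac (rsubmx y))^-1 * pderiv i f2 (rsubmx y).
  rewrite mxE /metric_sum invmx_block_diag; last first.
    by rewrite unitmxE det_ublock !det_scalar unitfE mulf_neq0 // expf_neq0 // cfac_neq0.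
  rewrite big_split_ord /= big1 ?add0r; last first.
    by move=> j _; rewrite block_mxEdl mxE mul0r.
  rewrite (bigD1 i) //= big1 ?addr0; last first.
    by move=> j ji; rewrite block_mxEdr invmx_scalar mxE eq_sym (negbTE ji) mul0r.
  rewrite block_mxEdr invmx_scalar mxE eqxx mulr1n; congr (_ * _).
  rewrite pderivD; last 2 first.
  - by move=> k; apply: smn_lsubmx.
  - by move=> k; apply: smn_rsubmx.
  by rewrite pderiv_rsubmx // pderiv_lsubmx0 add0r.
have El i : pderiv (lshift 2 i) (fun y => vol_density (metric_sum gconf gconf) y *
    gradient (metric_sum gconf gconf) (fun_sum f1 f2) y 0 (lshift 2 i)) =
    fun y => cfac (rsubmx y) * pderiv i (pderiv i f1) (lsubmx y).
  rewrite (_ : (fun y => vol_density _ y * _) = (fun y => cfac (rsubmx y) * pderiv i f1 (lsubmx y))).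
    apply: pderiv_is => y.
    apply: isd_eq (isdM (isd_rsubmx0 cfac i y) (isd_lsubmx (smooth_is_derive i _ (smooth_pderiv i sf1)))) _.
    by rewrite mul0r add0r.
  apply/funext => y; rewrite vE gl; have := cfac_neq0 (lsubmx y) => n0.
  by rewrite [X in X * _]mulrC -mulrA mulVKf.
have Er i : pderiv (rshift 2 i) (fun y => vol_density (metric_sum gconf gconf) y *
    gradient (metric_sum gconf gconf) (fun_sum f1 f2) y 0 (rshift 2 i)) =
    fun y => cfac (lsubmx y) * pderiv i (pderiv i f2) (rsubmx y).
  rewrite (_ : (fun y => vol_density _ y * _) = (fun y => cfac (lsubmx y) * pderiv i f2 (rsubmx y))).
    apply: pderiv_is => y.
    apply: isd_eq (isdM (isd_lsubmx0 cfac i y) (isd_rsubmx (smooth_is_derive i _ (smooth_pderiv i sf2)))) _.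
    by rewrite mul0r add0r.
  apply/funext => y; rewrite vE gr; have := cfac_neq0 (rsubmx y) => n0.
  by rewrite -mulrA mulVKf.
rewrite /laplace /divergence vE big_split_ord /=.
under eq_bigr do rewrite El; under [X in _ + X]eq_bigr do rewrite Er.
have S2 (F : 'I_2 -> R) : \sum_i F i = F 0 + F 1.
  by rewrite big_ord_recl big_ord1; congr (_ + F _); apply/val_inj.
rewrite !S2; have := cfac_neq0 (lsubmx z); have := cfac_neq0 (rsubmx z).
move: (cfac (lsubmx z)) (cfac (rsubmx z)) => x y y0 x0.
move: (pderiv 0 (pderiv 0 f1) _) (pderiv 1 (pderiv 1 f1) _)
  (pderiv 0 (pderiv 0 f2) _) (pderiv 1 (pderiv 1 f2) _) => A B C D.
by field; rewrite x0 y0.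
Qed.
End Metric.

Lemma laplace_gconfZ (R : realType) (q : R -> R) c f x : (forall x, 0 < q x) -> smooth f ->
  laplace (gconf q) (fun x => c * f x) x = c * laplace (gconf q) f x.
Proof.
move=> q0 sf; rewrite !(laplace_gconf q0) !(pderivZ _ _ sf) !pderivZ; try exact: smooth_pderiv.
by rewrite -mulrDr mulrCA mulrN.
Qed.

Lemma laplace_gconfN (R : realType) (q : R -> R) f x : (forall x, 0 < q x) -> smooth f ->
  laplace (gconf q) (fun x => - f x) x = - laplace (gconf q) f x.
Proof.
move=> q0 sf; have -> : (fun x => - f x) = (fun x => -1 * f x) by apply/funext => y; rewrite mulN1r.
by rewrite (laplace_gconfZ (-1) x q0 sf) mulN1r.
Qed.


Section Eigen.
Variables (R : realType) (q : R -> R) (lam : R) (c c1 s s1 : R -> R).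
Hypothesis qs : smooth1 q.
Hypothesis q0 : forall x, 0 < q x.
Hypothesis hc : ode_pair q lam c c1.
Hypothesis hs : ode_pair q lam s s1.
Hypothesis cper : forall x, c (x + 2 * pi) = c x.
Hypothesis sper : forall x, s (x + 2 * pi) = s x.
Hypothesis c0 : c 0 = 1.
Hypothesis s0 : s 0 = 0.

Definition bls_fun (x : 'rV[R]_2) : R :=
  c (x 0 0) * c (x 0 1) + lam * (s (x 0 0) * s (x 0 1)).

Lemma smooth_bls : smooth bls_fun.
Proof.
move=> k.
have sc := (csm_ode k hc.1 hc.2 qs).1; have ss := (csm_ode k hs.1 hs.2 qs).1.
apply: smnD; first by apply: smnM; apply: smn_comp => //; exact: smn_coord.
by apply: smnZ; apply: smnM; apply: smn_comp => //; exact: smn_coord.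
Qed.

Lemma bls_periodic k x : bls_fun (x + period R k) = bls_fun x.
Proof.
by rewrite /bls_fun !add_period !(int_periodic cper) !(int_periodic sper).
Qed.

Let d_at (u u1 : R -> R) (x : 'rV[R]_2) (i j : 'I_2) : (forall t : R, is_derive t 1 u (u1 t)) ->
  is_derive x (delta_mx 0 i) (fun y : 'rV[R]_2 => u (y 0 j)) (u1 (x 0 j) * (i == j)%:R).
Proof. by move=> h; apply: (@isd_comp R _ u (fun y : 'rV[R]_2 => y 0 j)) => //; exact: isd_coord. Qed.

Lemma bls_eigen : eigenfunction (laplace (gconf q)) lam bls_fun.
Proof.
split.
- by apply/torus_smoothP; split; [exact: bls_periodic|exact: smooth_bls].
- by exists 0; rewrite /bls_fun !mxE c0 s0 !mulr0 addr0 mulr1 oner_eq0.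
move=> x; rewrite laplace_gconf //.
have [[dc dc1] [ds ds1]] := (hc, hs).
have E0 : pderiv 0 bls_fun = fun x => c1 (x 0 0) * c (x 0 1) + lam * (s1 (x 0 0) * s (x 0 1)).
  apply: pderiv_is => y.
  apply: isd_eq (isdD (isdM (d_at y 0 0 dc) (d_at y 0 1 dc)) (isdZ lam (isdM (d_at y 0 0 ds) (d_at y 0 1 ds)))) _.
  by rewrite /= !mulr0 !mulr1 !addr0.
have E1 : pderiv 1 bls_fun = fun x => c (x 0 0) * c1 (x 0 1) + lam * (s (x 0 0) * s1 (x 0 1)).
  apply: pderiv_is => y.
  apply: isd_eq (isdD (isdM (d_at y 1 0 dc) (d_at y 1 1 dc)) (isdZ lam (isdM (d_at y 1 0 ds) (d_at y 1 1 ds)))) _.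
  by rewrite /= !mulr0 !mulr1 !mul0r !add0r.
have E00 : pderiv 0 (pderiv 0 bls_fun) x = - (lam * q (x 0 0)) * bls_fun x.
  rewrite E0 /pderiv.
  have [_ ->] := isdD (isdM (d_at x 0 0 dc1) (d_at x 0 1 dc)) (isdZ lam (isdM (d_at x 0 0 ds1) (d_at x 0 1 ds))).
  by rewrite /= /bls_fun; ring.
have E11 : pderiv 1 (pderiv 1 bls_fun) x = - (lam * q (x 0 1)) * bls_fun x.
  rewrite E1 /pderiv.
  have [_ ->] := isdD (isdM (d_at x 1 0 dc) (d_at x 1 1 dc1)) (isdZ lam (isdM (d_at x 1 0 ds) (d_at x 1 1 ds1))).
  by rewrite /= /bls_fun; ring.
rewrite E00 E11 -mulrDl -opprD -mulrDr -/(cfac q x) mulNr mulrN opprK.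
by rewrite [lam * cfac q x]mulrC -mulrA mulKf ?cfac_neq0.
Qed.

Definition bls_diag (x : R) : R := c x * c x + lam * (s x * s x).

Hypothesis lam0 : 0 < lam.

                                                            
Lemma bls_CS x : bls_fun x ^+ 2 <= bls_diag (x 0 0) * bls_diag (x 0 1).
Proof.
rewrite /bls_fun /bls_diag -subr_ge0.
set C := c _; set C' := c _; set S := s _; set S' := s _.
have -> : (C * C + lam * (S * S)) * (C' * C' + lam * (S' * S')) - (C * C' + lam * (S * S')) ^+ 2
  = lam * (C * S' - S * C') ^+ 2 by ring.
by rewrite mulr_ge0 ?sqr_ge0 // ltW.
Qed.

End Eigen.

                                            

Section Evaluation.
Variables (K : fieldType) (S : choiceType) (phi : S -> K).

Definition ev (z : {freeg S / K}) : K := fglift (fun x => phi x : K^o) z.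

Lemma evB z w : ev (z - w) = ev z - ev w.
Proof. exact: (lift_is_additive (fun x => phi x : K^o)). Qed.
Lemma ev0 : ev 0 = 0. Proof. by rewrite -(subrr (0 : {freeg S / K})) evB subrr. Qed.
Lemma evN z : ev (- z) = - ev z. Proof. by rewrite -sub0r evB ev0 sub0r. Qed.
Lemma evD z w : ev (z + w) = ev z + ev w.
Proof. by rewrite -{1}[w]opprK evB evN opprK. Qed.
Lemma ev_sum (I : Type) (r : seq I) (P : pred I) (F : I -> {freeg S / K}) :
  ev (\sum_(i <- r | P i) F i) = \sum_(i <- r | P i) ev (F i).
Proof. by apply: (big_morph ev evD ev0). Qed.
Lemma evU (k : K) x : ev << k *g x >> = k * phi x.
Proof. by rewrite /ev liftU. Qed.
Lemma evE z : ev z = \sum_(x <- dom z) coeff x z * phi x.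
Proof. by rewrite -{1}[z]freeg_sumE ev_sum; apply: eq_bigr => x _; rewrite evU. Qed.
Lemma evZ (k : K) z : ev (k *: z) = k * ev z.
Proof.
rewrite [k *: z]/(fgscale k z) /fgscale ev_sum evE mulr_sumr.
by apply: eq_bigr => x _; rewrite evU mulrA.
Qed.
End Evaluation.

Lemma ev_lift0 (K : fieldType) (S T : choiceType) (phi : T -> K) (F : S -> {freeg T / K}) b :
  (forall x, x \in dom b -> ev phi (F x) = 0) -> ev phi (fglift F b) = 0.
Proof.
move=> h; rewrite -{1}[b]freeg_sumE.
have A := lift_is_additive F.
have A0 : fglift F 0 = 0 by rewrite -(subrr (0 : {freeg S / K})) A subrr.
have AN z : fglift F (- z) = - fglift F z by rewrite -sub0r A A0 sub0r.
have AD z w : fglift F (z + w) = fglift F z + fglift F w by rewrite -{1}[w]opprK A AN opprK.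
rewrite (big_morph _ AD A0) ev_sum big_seq big1 // => x xb.
by rewrite liftU evZ h // mulr0.
Qed.

Section Simplex.
Variable R : realType.

Lemma simplex_bounded r : bounded_set (std_simplex R r).
Proof.
exists 1; split; first exact: num_real.
move=> M M1 p [p0 p1] /=; rewrite (le_trans _ (ltW M1)) //.
have h i : `|p 0 i| <= 1.
  rewrite ger0_norm // -p1 (bigD1 i) //= lerDl sumr_ge0 //.
rewrite /Num.norm /= mx_normrE; apply/bigmax_leP; split=> // -[i j] _ /=.
by rewrite [i]ord1.
Qed.

Lemma simplex_closed r : closed (std_simplex R r).
Proof.
have -> : std_simplex R r = (\bigcap_(i in [set: 'I_r.+1]) [set p | 0 <= p 0 i])
   `&` [set p | \sum_i p 0 i = 1].
  by apply/seteqP; split=> p [h1 h2]; split=> // i; [move=> _; exact: h1|exact: h1].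
apply: closedI.
  apply: closed_bigI => i _.
  apply: (@preimage_closed _ _ (fun p : 'rV[R]_r.+1 => p 0 i) [set x | 0 <= x]).
    by move=> x _; exact: coord_continuous.
  exact: closed_ge.
apply: (@preimage_closed _ _ (fun p : 'rV[R]_r.+1 => \sum_i p 0 i) [set 1]).
  move=> x _; apply: (@smn_cont R r.+1 0); apply: smn_sum => i; exact: smn_coord.
exact: closed_eq.
Qed.

Lemma simplex_compact r : compact (std_simplex R r).
Proof. by apply: bounded_closed_compact; [exact: simplex_bounded|exact: simplex_closed]. Qed.

Lemma vertex0_in r : (\row_i (i == 0)%:R : 'rV[R]_r.+1) \in std_simplex R r.
Proof.
apply/mem_set; split; first by move=> i; rewrite mxE ler0n.
rewrite (bigD1 0) //= mxE eqxx big1 ?addr0 // => i i0.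
by rewrite mxE (negbTE i0).
Qed.

Definition to_simplex r (p : 'rV[R]_r.+1) : std_simplex R r :=
  match pselect (std_simplex R r p) with
  | left h => exist _ p (mem_set h)
  | right _ => exist _ (\row_i (i == 0)%:R) (vertex0_in r)
  end.

Lemma to_simplexK r p : std_simplex R r p -> set_val (to_simplex p) = p.
Proof. by rewrite /to_simplex; case: pselect. Qed.

Lemma set_val_simplex r (p : std_simplex R r) : std_simplex R r (set_val p).
Proof. exact: set_mem (valP p). Qed.

Lemma set_val_inj r (p p' : std_simplex R r) : set_val p = set_val p' -> p = p'.
Proof. exact: val_inj. Qed.

Lemma lebesgue_simplex (X : topologicalType) r (s : singular_simplex R X r) (good : set X -> Prop) :
  (forall x : X, exists2 U : set X, nbhs x U & good U) ->
  exists N : nat, forall n, (N <= n)%N -> forall p : std_simplex R r,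
   exists2 U : set X, good U & forall p' : std_simplex R r,
     `|set_val p' - set_val p| <= 2 / n.+1%:R -> U (s p').
Proof.
move=> hg.
pose Pn (n : nat) (p : 'rV[R]_r.+1) := std_simplex R r p ->
  exists2 U : set X, good U & forall p' : std_simplex R r,
     `|set_val p' - p| <= 2 / n.+1%:R -> U (s p').
have /compact_near_coveringP/(_ nat \oo Pn _) := @simplex_compact r.
case=> [x Dx|N _ hN]; last first.
  by exists N => n Nn p; apply: (hN n Nn); exact: set_val_simplex.
pose x' := to_simplex x.
have [U Ux gU] := hg (s x').
have : nbhs x' (s @^-1` U) by exact: (@cts_fun _ _ s x' U Ux).
move=> /nbhs_ballP[e /= e0 he].
have he' (p' : std_simplex R r) : `|set_val p' - x| < e -> U (s p').
  move=> h; apply: (he p'); rewrite -initial_ballE /=.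
  by rewrite -ball_normE /= to_simplexK // distrC.
have e4 : 0 < e / 4 by rewrite divr_gt0.
have e2 : 0 < e / 2 by rewrite divr_gt0.
near=> y n => /= Dy; exists U => // p' hp'; apply: he'.
rewrite -[set_val p' - x](subrKA y) (le_lt_trans (ler_normD _ _)) //.
rewrite (splitr e) ler_ltD //.
  apply: (le_trans hp').
  have : n.+1%:R^-1 < e / 4.
    by near: n; exact: (near_infty_natSinv_lt (PosNum e4)).
  by move=> /ltW h4; rewrite mulrC -ler_pdivlMr // (le_trans h4) //; lra.
Unshelve. all: by end_near. Qed.

End Simplex.

Section HomologyLowerBound.
Variables (R : realType) (K : fieldType).

Lemma homology_dim_infty (X : topologicalType) r :
  (forall N, exists z : 'I_N -> chain R K X r, (forall i, is_cycle (z i)) /\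
    forall (b : chain R K X r.+1) (i : 'I_N), exists phi : singular_simplex R X r -> K,
      [/\ ev phi (boundary b) = 0, forall j : 'I_N, (j < i)%N -> ev phi (z j) = 0 &
        ev phi (z i) = 1]) ->
  homology_dim R K X r = +oo%E.
Proof.
move=> h; apply/eq_infty => t.
have [N tN] : exists N : nat, t <= N%:R.
  by exists (Num.truncn t).+1; apply/ltW; exact: Num.Theory.truncnS_gt.
apply: (@le_trans _ _ (N%:R%:E)); first by rewrite lee_fin.
apply: ereal_sup_ubound; exists N => //.
have [z [cz hz]] := h N; exists z; split=> // a [b ab].
suff H k : forall i : 'I_N, (N - k <= i)%N -> a i = 0.
  by move=> i; apply: (H N); rewrite subnn.
elim: k => [|k IH] i ki.
  by move: ki; rewrite subn0 leqNgt ltn_ord.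
have [lt|ge] := ltnP i (N - k)%N; last exact: IH.
have [phi [p1 p2 p3]] := hz b i.
move: p1; rewrite -ab ev_sum (bigD1 i) //= evZ p3 mulr1 big1 ?addr0 // => j ji.
rewrite evZ; have [jlt|jge|jeq] := ltngtP j i.
- by rewrite p2 // mulr0.
- by rewrite IH ?mul0r //; move: lt ki jge; lia.
- by move: ji; rewrite -val_eqE /= jeq eqxx.
Qed.

Definition pt1 (t : R) : std_simplex R 1 := to_simplex (\row_(i < 2) (if i == 0 then 1 - t else t)).
Definition pt2 (u v : R) : std_simplex R 2 :=
  to_simplex (\row_(i < 3) (if i == 0 then 1 - u - v else if i == 1 then u else v)).

Lemma pt1K t : 0 <= t <= 1 ->
  set_val (pt1 t) = \row_(i < 2) (if i == 0 then 1 - t else t).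
Proof.
move=> /andP[t0 t1]; apply: to_simplexK; split.
  by move=> i; rewrite mxE; case: ifP => _ //; rewrite subr_ge0.
by rewrite big_ord_recl big_ord1 !mxE /= subrK.
Qed.

Lemma pt2K u v : 0 <= u -> 0 <= v -> u + v <= 1 ->
  set_val (pt2 u v) = \row_(i < 3) (if i == 0 then 1 - u - v else if i == 1 then u else v).
Proof.
move=> u0 v0 uv; apply: to_simplexK; split.
  by move=> i; rewrite mxE; case: ifP => _ //; [rewrite -addrA -opprD subr_ge0|case: ifP].
by rewrite !big_ord_recl big_ord0 !mxE /= addr0; ring.
Qed.

Lemma set_val_face r (i : 'I_r.+2) (p : std_simplex R r) :
  set_val (face R i p) = face_coords i (set_val p).
Proof. by []. Qed.

Lemma face2_pt1 t : 0 <= t <= 1 -> face R (inord 2 : 'I_3) (pt1 t) = pt2 t 0.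
Proof.
move=> t01; have /andP[t0 t1] := t01; apply: set_val_inj.
rewrite set_val_face pt2K ?addr0 // /face_coords pt1K //; apply/rowP => k; rewrite !mxE.
case: unliftP => [j kj|kj] /=; last by rewrite kj -!val_eqE /= inordK.
rewrite mxE kj -!val_eqE /= /bump inordK //.
by case: j {kj} => [[|[|j]] jlt] //=; rewrite ?subr0.
Qed.

Lemma face1_pt1 t : 0 <= t <= 1 -> face R (inord 1 : 'I_3) (pt1 t) = pt2 0 t.
Proof.
move=> t01; have /andP[t0 t1] := t01; apply: set_val_inj.
rewrite set_val_face pt2K ?add0r // /face_coords pt1K //; apply/rowP => k; rewrite !mxE.
case: unliftP => [j kj|kj] /=; last by rewrite kj -!val_eqE /= inordK.
rewrite mxE kj -!val_eqE /= /bump inordK //.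
by case: j {kj} => [[|[|j]] jlt] //=; rewrite ?subr0.
Qed.

Lemma face0_pt1 t : 0 <= t <= 1 -> face R (inord 0 : 'I_3) (pt1 t) = pt2 (1 - t) t.
Proof.
move=> t01; have /andP[t0 t1] := t01; apply: set_val_inj.
rewrite set_val_face pt2K ?subr_ge0 ?subrK // /face_coords pt1K //; apply/rowP => k; rewrite !mxE.
case: unliftP => [j kj|kj] /=; last by rewrite kj -!val_eqE /= inordK //= opprB addrCA subrr addr0 subrr.
by rewrite mxE kj -!val_eqE /= /bump inordK.
Qed.

Lemma pt1_ends : (face R (inord 0 : 'I_2) (to_simplex (\row_i (i == 0)%:R)) = pt1 1) /\
  (face R (inord 1 : 'I_2) (to_simplex (\row_i (i == 0)%:R)) = pt1 0).
Proof.
have v0 : std_simplex R 0 (\row_i (i == 0)%:R) by exact: set_mem (vertex0_in R 0).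
split; apply: set_val_inj; rewrite set_val_face pt1K ?lexx ?ler01 // /face_coords to_simplexK //;
  apply/rowP => k; rewrite !mxE; case: unliftP => [j kj|kj] /=;
  rewrite kj -!val_eqE /= ?inordK ?subrr ?subr0 // ?mxE /= ?(ord1 j) //=.
Qed.

Variable X : topologicalType.
Variable tau : X -> X -> K.

Definition additive_on (U : set X) :=
  forall a b c, U a -> U b -> U c -> tau a b + tau b c = tau a c.
Definition locally_additive := forall x : X, exists2 U, nbhs x U & additive_on U.

Definition steps (n : nat) (s : singular_simplex R X 1) : K :=
  \sum_(k < n.+1) tau (s (pt1 (k%:R / n.+1%:R))) (s (pt1 (k.+1%:R / n.+1%:R))).

Hypothesis tau_add : locally_additive.

                                                                                                      
                                   
Lemma steps_coboundary (s : singular_simplex R X 2) : exists N, forall n, (N <= n)%N ->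
  ev (steps n) (simplex_boundary K s) = 0.
Proof.
have [N hN] := lebesgue_simplex s tau_add; exists N => n Nn.
pose d : R := n.+1%:R.
have d0 : 0 < d by rewrite ltr0n.
have dn : d != 0 by rewrite gt_eqF.
pose g i j := s (pt2 (i%:R / d) (j%:R / d)).
have gin i j : (i + j <= n.+1)%N -> set_val (pt2 (i%:R / d) (j%:R / d)) =
   \row_(k < 3) (if k == 0 then 1 - i%:R / d - j%:R / d else if k == 1 then i%:R / d else j%:R / d).
  move=> ij; apply: pt2K; rewrite ?divr_ge0 ?ler0n ?(ltW d0) //.
  by rewrite -mulrDl ler_pdivrMr // mul1r -natrD ler_nat.
have near_g i j i' j' : (i + j <= n.+1)%N -> (i' + j' <= n.+1)%N ->
    (i <= i' <= i.+1)%N -> (j <= j' <= j.+1)%N ->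
    `|set_val (pt2 (i'%:R / d) (j'%:R / d)) - set_val (pt2 (i%:R / d) (j%:R / d))| <= 2 / d.
  move=> ij ij' /andP[i1 i2] /andP[j1 j2].
  rewrite !gin // /Num.norm /= mx_normrE; apply/bigmax_leP; split.
    by rewrite divr_ge0 // ltW.
  move=> -[a k] _ /=; rewrite !mxE.
  have Ei : 0 <= i'%:R / d - i%:R / d <= 1 / d.
    rewrite -mulrBl -natrB // divr_ge0 ?ler0n ?(ltW d0) //= ler_pM2r ?invr_gt0 // lern1.
    by rewrite leq_subLR addn1.
  have Ej : 0 <= j'%:R / d - j%:R / d <= 1 / d.
    rewrite -mulrBl -natrB // divr_ge0 ?ler0n ?(ltW d0) //= ler_pM2r ?invr_gt0 // lern1.
    by rewrite leq_subLR addn1.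
  move: Ei Ej; set A := i'%:R / d; set A' := i%:R / d; set B := j'%:R / d; set B' := j%:R / d.
  have -> : 2 / d = 1 / d + 1 / d by field.
  set e := 1 / d => /andP[? ?] /andP[? ?].
  by case: ifP => _; [|case: ifP => _]; rewrite ler_norml; apply/andP; split; lra.
pose h i j := tau (g i j) (g i.+1 j).
pose v i j := tau (g i j) (g i j.+1).
pose r j := tau (g (n.+1 - j)%N j) (g (n - j)%N j.+1).
have square i j : (i.+1 + j.+1 <= n.+1)%N -> h i j + v i.+1 j = v i j + h i j.+1.
  move=> ij.
  have [U aU hU] := hN n Nn (pt2 (i%:R / d) (j%:R / d)).
  have Ug i' j' : (i <= i' <= i.+1)%N -> (j <= j' <= j.+1)%N -> (i' + j' <= n.+1)%N -> U (g i' j').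
    by move=> *; apply: hU; apply: near_g => //; lia.
  rewrite /h /v !aU //; apply: Ug; lia.
have triangle i j : (i + j = n)%N -> h i j + r j = v i j.
  move=> ij.
  have [U aU hU] := hN n Nn (pt2 (i%:R / d) (j%:R / d)).
  have Ug i' j' : (i <= i' <= i.+1)%N -> (j <= j' <= j.+1)%N -> (i' + j' <= n.+1)%N -> U (g i' j').
    by move=> *; apply: hU; apply: near_g => //; lia.
  rewrite /h /v /r (_ : n.+1 - j = i.+1)%N; last by lia.
  rewrite (_ : n - j = i)%N; last by lia.
  by rewrite aU //; apply: Ug; lia.
have strip j k : (k + j <= n)%N ->
    \sum_(i < k) h i j + v k j = v 0%N j + \sum_(i < k) h i j.+1.
  elim: k => [|k IH] kj; first by rewrite !big_ord0 add0r addr0.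
  rewrite !big_ord_recr /= -addrA square; last by lia.
  by rewrite addrA IH ?addrA //; lia.
pose Rj j := \sum_(i < n.+1 - j) h i j.
have row j : (j <= n)%N -> Rj j + r j = v 0%N j + Rj j.+1.
  move=> jn; rewrite /Rj (_ : n.+1 - j = (n - j).+1)%N; last by lia.
  rewrite (_ : n.+1 - j.+1 = n - j)%N; last by lia.
  rewrite big_ord_recr /= -addrA triangle; last by lia.
  by apply: strip; lia.
have total k : (k <= n.+1)%N ->
    Rj 0%N + \sum_(j < k) r j = \sum_(j < k) v 0%N j + Rj k.
  elim: k => [|k IH] kn; first by rewrite !big_ord0 addr0 add0r.
  by rewrite !big_ord_recr /= addrA IH ?(ltnW kn) // -!addrA row.
have := total n.+1 (leqnn _); rewrite [X in _ = _ + X]/Rj subnn big_ord0 addr0 => E.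
have t01 (k : nat) : (k <= n.+1)%N -> 0 <= k%:R / d <= 1.
  by move=> kn; rewrite divr_ge0 ?ler0n ?(ltW d0) //= ler_pdivrMr // mul1r ler_nat.
have S2 : steps n (s \o face R (inord 2 : 'I_3) : singular_simplex R X 1) = Rj 0%N.
  rewrite /Rj subn0; apply: eq_bigr => k _ /=.
  have k1 := ltn_ord k.
  by rewrite -/d /= !face2_pt1 ?t01 // ?(ltnW k1) // /h /g mul0r.
have S1 : steps n (s \o face R (inord 1 : 'I_3) : singular_simplex R X 1) = \sum_(j < n.+1) v 0%N j.
  apply: eq_bigr => k _ /=.
  have k1 := ltn_ord k.
  by rewrite -/d /= !face1_pt1 ?t01 // ?(ltnW k1) // /v /g mul0r.
have S0 : steps n (s \o face R (inord 0 : 'I_3) : singular_simplex R X 1) = \sum_(j < n.+1) r j.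
  apply: eq_bigr => k _ /=.
  have k1 := ltn_ord k.
  have B (m : nat) : (m <= n.+1)%N -> 1 - m%:R / d = (n.+1 - m)%:R / d.
    by move=> mn; rewrite natrB // mulrBl divff.
  by rewrite -/d /= !face0_pt1 ?t01 // ?(ltnW k1) // /r /g !B // ?(ltnW k1).
rewrite /simplex_boundary ev_sum !big_ord_recl big_ord0 addr0 !evZ !evU !mul1r.
have e0 : ord0 = inord 0 :> 'I_3 by apply/val_inj; rewrite /= inordK.
have e1 : fintype.lift ord0 ord0 = inord 1 :> 'I_3 by apply/val_inj; rewrite /= inordK.
have e2 : fintype.lift ord0 (fintype.lift ord0 ord0) = inord 2 :> 'I_3 by apply/val_inj; rewrite /= inordK.
rewrite e2 e1 e0 S0 S1 S2 !inordK //= expr1 mulN1r expr2 mulN1r opprK mul1r.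
by rewrite addrA addrAC [X in X - _]addrC E subrr.
Qed.

Lemma steps_boundary (b : chain R K X 2) : exists N, forall n, (N <= n)%N ->
  ev (steps n) (boundary b) = 0.
Proof.
have [Nf hN] := choice steps_coboundary.
exists (\max_(x <- dom b) Nf x)%N => n nN.
apply: ev_lift0 => x xb; apply: hN.
by apply: leq_trans nN; exact: leq_bigmax_seq.
Qed.

End HomologyLowerBound.

Section H0.
Variables (R : realType) (K : fieldType) (X : topologicalType) (chi : X -> K).
Hypothesis chi_loc : forall x, exists2 U : set X, nbhs x U & forall a, U a -> chi a = chi x.

Definition at_vertex (s : singular_simplex R X 0) : K := chi (s (to_simplex (\row_i (i == 0)%:R))).

Lemma at_vertex_boundary (b : chain R K X 1) : ev at_vertex (boundary b) = 0.
Proof.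
apply: ev_lift0 => s _.
have [|N hN] := @lebesgue_simplex R X 1 s (fun U => forall a b, U a -> U b -> chi a = chi b).
  by move=> x; have [U Ux h] := chi_loc x; exists U => // a c Ua Uc; rewrite !h.
pose d : R := N.+1%:R.
have d0 : 0 < d by rewrite ltr0n.
have step k : (k <= N)%N -> chi (s (pt1 (k%:R / d))) = chi (s (pt1 (k.+1%:R / d))).
  move=> kN; have [U gU hU] := hN N (leqnn _) (pt1 (k%:R / d)).
  apply: gU; apply: hU; first by rewrite subrr normr0 divr_ge0.
  have t01 (j : nat) : (j <= N.+1)%N -> 0 <= j%:R / d <= 1.
    by move=> kn; rewrite divr_ge0 ?ler0n ?(ltW d0) //= ler_pdivrMr // mul1r ler_nat.
  rewrite !pt1K ?t01 //; last by lia.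
  rewrite /Num.norm /= mx_normrE; apply/bigmax_leP; split; first by rewrite divr_ge0.
  move=> -[a i] _ /=; rewrite !mxE -/d.
  have E : k.+1%:R / d - k%:R / d = 1 / d by rewrite -mulrBl -natrB // subSnn.
  have E2 : 2 / d = 1 / d + 1 / d by rewrite -mulrDl.
  have e0 : 0 <= 1 / d by rewrite divr_ge0 // ltW.
  rewrite E2; move: E e0; set A := k.+1%:R / d; set B := k%:R / d; set e := 1 / d => E e0.
  by case: ifP => _; rewrite ler_norml; apply/andP; split; lra.
have all k : (k <= N.+1)%N -> chi (s (pt1 0)) = chi (s (pt1 (k%:R / d))).
  elim: k => [|k IH] kN; first by rewrite mul0r.
  by rewrite (IH (ltnW kN)); exact: step.
have := all N.+1 (leqnn _); rewrite divff ?gt_eqF // => E.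
have [p0 p1] := pt1_ends R.
rewrite /simplex_boundary ev_sum !big_ord_recl big_ord0 addr0 !evZ !evU !mul1r.
have e0 : ord0 = inord 0 :> 'I_2 by apply/val_inj; rewrite /= inordK.
have e1 : fintype.lift ord0 ord0 = inord 1 :> 'I_2 by apply/val_inj; rewrite /= inordK.
by rewrite e1 e0 !inordK // expr1 mulN1r /at_vertex /= p0 p1 E subrr.
Qed.
End H0.

                          

Section TorusSpace.
Variables (R : realType) (n : nat).

Definition periodic_fun (Y : Type) (F : 'rV[R]_n -> Y) := forall k x, F (x + period R k) = F x.

Variable f : 'rV[R]_n -> R.
Hypothesis fper : periodic_fun f.

Definition rep (p : nodal_compl f) : 'rV[R]_n :=
  repr (set_val p : {eq_quot torus_equiv R n}%qT).

Lemma proj_eq (x y : 'rV[R]_n) : torus_proj x = torus_proj y -> exists k, y = x + period R k.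
Proof. by move=> /eqmodP/asboolP. Qed.

Lemma proj_repr (p : torus R n) : torus_proj (repr (p : {eq_quot torus_equiv R n}%qT)) = p.
Proof. exact: reprK. Qed.

Lemma proj_nodal x : f x != 0 -> torus_proj x \in nodal_compl f.
Proof.
move=> fx; apply/mem_set => -[y /= fy /proj_eq[k E]].
by move: fx; rewrite E fper fy eqxx.
Qed.

Lemma rep_neq0 (p : nodal_compl f) : f (rep p) != 0.
Proof.
apply/eqP => h; have := set_mem (valP p); apply.
by exists (rep p) => //; exact: proj_repr.
Qed.

Lemma rep_val (Y : Type) (F : 'rV[R]_n -> Y) (p : nodal_compl f) x : periodic_fun F ->
  set_val p = torus_proj x -> F (rep p) = F x.
Proof.
move=> Fper px.
have : torus_proj (rep p) = torus_proj x by rewrite proj_repr.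
by move=> /proj_eq[k ->]; rewrite Fper.
Qed.

Lemma rep_cont (Y : topologicalType) (F : 'rV[R]_n -> Y) : continuous F -> periodic_fun F ->
  continuous (fun p : nodal_compl f => F (rep p)).
Proof.
move=> cF Fper p.
have C : continuous (F \o (repr : {eq_quot torus_equiv R n}%qT -> _)
    : quotient_topology {eq_quot torus_equiv R n}%qT -> Y).
  apply: repr_comp_continuous => // a b /eqP ab.
  have [k ->] : exists k, b = a + period R k by apply: proj_eq.
  by apply/eqP; rewrite Fper.
apply: (@continuous_comp _ _ _ (set_val : nodal_compl f -> torus R n)
  (F \o (repr : {eq_quot torus_equiv R n}%qT -> _)) p); last exact: C.
exact: initial_continuous.
Qed.

Section MkSimplex.
Variables (r : nat) (G : 'rV[R]_r.+1 -> 'rV[R]_n).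
Hypothesis cG : continuous G.
Hypothesis fG : forall p, std_simplex R r p -> f (G p) != 0.

Lemma mk_simplexP (p : std_simplex R r) : f (G (set_val p)) != 0.
Proof. exact/fG/set_val_simplex. Qed.

Definition mk_simplex_fun (p : std_simplex R r) : nodal_compl f :=
  exist _ (torus_proj (G (set_val p))) (proj_nodal (mk_simplexP p)).

Lemma mk_simplex_continuous : continuous mk_simplex_fun.
Proof.
apply: continuous_comp_initial => p.
apply: (@continuous_comp _ _ _ (fun p : std_simplex R r => G (set_val p))
  (@torus_proj R n : _ -> torus R n) p); last exact: pi_continuous.
apply: (@continuous_comp _ _ _ (set_val : std_simplex R r -> _) G p); last exact: cG.
exact: initial_continuous.
Qed.

HB.instance Definition _ := isContinuous.Build _ _ mk_simplex_fun mk_simplex_continuous.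

Definition mk_simplex : singular_simplex R (nodal_compl f) r := mk_simplex_fun.

Lemma mk_simplexE (Y : Type) (F : 'rV[R]_n -> Y) p : periodic_fun F ->
  F (rep (mk_simplex p)) = F (G (set_val p)).
Proof. by move=> Fper; exact: rep_val. Qed.
End MkSimplex.

Variable K : fieldType.

                                                                                                    
                               
Lemma betti0_infty : (forall N, exists (x : 'I_N -> 'rV[R]_n) (F : 'I_N -> 'rV[R]_n -> R),
   [/\ forall i, f (x i) != 0,
       forall i, continuous (F i) /\ periodic_fun (F i),
       forall i y, f y != 0 -> F i y != 0,
       forall i, 0 < F i (x i) &
       forall i j : 'I_N, (j < i)%N -> F i (x j) < 0]) ->
  nodal_betti K 0 f = +oo%E.
Proof.
move=> h; apply: homology_dim_infty => N.
have [x [F [fx cF Fn Fp Fm]]] := h N.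
have cst_c i : continuous (fun _ : 'rV[R]_1 => x i) by exact: cst_continuous.
exists (fun i => << mk_simplex (cst_c i) (fun _ _ => fx i) >>); split=> // b i.
pose chi (p : nodal_compl f) : K := (0 < F i (rep p))%R%:R.
have chi_loc p : exists2 U : set (nodal_compl f), nbhs p U & forall a, U a -> chi a = chi p.
  have [cFi pFi] := cF i.
  have cc := rep_cont cFi pFi.
  have := Fn i _ (rep_neq0 p); rewrite neq_lt => /orP[neg|pos].
    exists [set a | F i (rep a) < 0]; first exact: (cvgr_lt _ (cc p)).
    by move=> a /= an; rewrite /chi !ltNge (ltW an) (ltW neg).
  exists [set a | 0 < F i (rep a)]; first exact: (cvgr_gt _ (cc p)).
  by move=> a /= an; rewrite /chi an pos.
exists (at_vertex chi); split.
- exact: at_vertex_boundary.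
- move=> j ji; rewrite evU mul1r /at_vertex /chi mk_simplexE; last by case: (cF i).
  by rewrite ltNge (ltW (Fm i j ji)).
- by rewrite evU mul1r /at_vertex /chi mk_simplexE ?Fp //; case: (cF i).
Qed.

                                                                                                    
                                                        
Definition crossing (A B : 'rV[R]_n -> R) (p p' : nodal_compl f) : K :=
  if (0 < A (rep p)) && (0 < A (rep p')) then (0 < B (rep p'))%R%:R - (0 < B (rep p))%R%:R else 0.

Lemma crossing_additive A B : continuous A -> periodic_fun A -> continuous B -> periodic_fun B ->
  (forall y, f y != 0 -> A y = 0 -> B y != 0) -> locally_additive (crossing A B).
Proof.
move=> cA pA cB pB AB p.
have ccA := rep_cont cA pA; have ccB := rep_cont cB pB.
have [neg|pos|zero] := ltgtP (A (rep p)) 0.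
- exists [set a | A (rep a) < 0]; first exact: (cvgr_lt _ (ccA p)).
  by move=> a b c /= a0 b0 c0; rewrite /crossing (lt_gtF a0) (lt_gtF b0) /= addr0.
- exists [set a | 0 < A (rep a)]; first exact: (cvgr_gt _ (ccA p)).
  by move=> a b c /= a0 b0 c0; rewrite /crossing a0 b0 c0 /= addrC subrKA.
have := AB _ (rep_neq0 p) zero; rewrite neq_lt => /orP[neg|pos].
  exists [set a | B (rep a) < 0]; first exact: (cvgr_lt _ (ccB p)).
  move=> a b c /= a0 b0 c0; rewrite /crossing.
  rewrite (lt_gtF a0) (lt_gtF b0) (lt_gtF c0) subrr.
  by case: ifP => _; case: ifP => _; case: ifP => _; rewrite addr0.
exists [set a | 0 < B (rep a)]; first exact: (cvgr_gt _ (ccB p)).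
move=> a b c /= a0 b0 c0; rewrite /crossing a0 b0 c0 subrr.
by case: ifP => _; case: ifP => _; case: ifP => _; rewrite addr0.
Qed.

End TorusSpace.

Section Trigo.
Variable R : realType.

Lemma cos_2pi (x : R) : cos (x + 2 * pi) = cos x.
Proof. by rewrite mulr_natl cosD2pi. Qed.
Lemma sin_2pi (x : R) : sin (x + 2 * pi) = sin x.
Proof. by rewrite mulr_natl sinD2pi. Qed.

Lemma cos_near (a x : R) : 0 <= a <= pi -> cos a <= cos x -> exists k : int, `|x + 2 * pi * k%:~R| <= a.
Proof.
move=> /andP[a0 api] ca.
have p0 := pi_gt0 R.
have tp : 0 < 2 * pi :> R by rewrite mulr_gt0.
pose m := Num.floor ((x + pi) / (2 * pi)).
have /andP[m1 m2] : m%:~R <= (x + pi) / (2 * pi) < (m + 1)%:~R.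
  exact: Num.Theory.floor_itv.
rewrite ler_pdivlMr // in m1; rewrite ltr_pdivrMr // intrD mulrDl mul1r in m2.
exists (- m); rewrite mulrNz.
set x' := x + _.
have xpi : `|x'| <= pi.
  by rewrite ler_norml /x'; apply/andP; split; move: m1 m2; set M := m%:~R; lra.
rewrite leNgt; apply/negP => ax.
have cx : cos `|x'| = cos x.
  by rewrite cos_norm /x' -mulrNz (int_periodic cos_2pi).
have : cos `|x'| < cos a by rewrite ltr_cos // in_itv /= ?a0 ?api ?normr_ge0.
by rewrite cx ltNge ca.
Qed.

Lemma rv_cont (X : topologicalType) n (G : X -> 'rV[R]_n) :
  (forall j, continuous (fun p => G p 0 j)) -> continuous G.
Proof.
move=> cG p A [P Pnbhs sPA].
suff : nbhs p [set q : X | forall (a : 'I_1) (k : 'I_n), P a k (G q a k)].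
  by apply: filterS => q Pq; exact: sPA.
apply: (@filter_forall _ _ (fun a q => forall k, P a k (G q a k)) (nbhs p) _) => a.
apply: (@filter_forall _ _ (fun k q => P a k (G q a k)) (nbhs p) _) => k.
have := cG k p _; rewrite -(ord1 a) => cGa; exact: cGa (Pnbhs a k).
Qed.

Lemma min_cont (X : topologicalType) (u v : X -> R) : continuous u -> continuous v ->
  continuous (fun x => Num.min (u x) (v x)).
Proof. by move=> cu cv x; apply: continuous_min; [exact: cu|exact: cv]. Qed.

Lemma sin_period n (m : nat) (x : 'rV[R]_n) k i :
  sin (m%:R * (x + period R k) 0 i) = sin (m%:R * x 0 i).
Proof.
rewrite add_period mulrDr.
have -> : m%:R * (2 * pi * (k 0 i)%:~R) = 2 * pi * (m%:Z * k 0 i)%:~R :> R by rewrite intrM mulrCA.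
exact: (int_periodic sin_2pi).
Qed.

Lemma unit_0pi (a : R) : 0 <= a <= 1 -> 0 <= a <= pi.
Proof. by move=> /andP[-> a1] /=; rewrite (le_trans a1) // (le_trans _ (pi_ge2 R)) // ler1n. Qed.

Lemma cos_lt (a b : R) : 0 <= a -> a < b -> b <= 1 -> cos b < cos a.
Proof.
by move=> a0 ab b1; rewrite ltr_cos // in_itv /= unit_0pi //; apply/andP; split=> //; lra.
Qed.

End Trigo.

Section Nodal.
Variables (R : realType) (f : 'rV[R]_2 -> R) (h : R -> R).
Hypothesis fcont : continuous f.
Hypothesis fper : periodic_fun f.
Hypothesis fd : forall x : 'rV[R]_2, x 0 0 = x 0 1 -> f x = h (x 0 0).
Hypothesis fCS : forall x : 'rV[R]_2, f x ^+ 2 <= h (x 0 0) * h (x 0 1).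
Hypothesis h_ge0 : forall t, 0 <= h t.
Hypothesis h0 : h 0 = 1.
Hypothesis hper : forall t, h (t + 2 * pi) = h t.
Hypothesis heven : forall t, h (- t) = h t.
Hypothesis hpeaks : has_peaks h.

Lemma peaks_seq : exists y yp : nat -> R,
  [/\ forall k, 0 < y k < yp k /\ yp k < 1, forall k j, (j < k)%N -> yp k < y j,
   forall k, 1 < h (y k),
   (forall k t, `|t| <= yp k -> h t <= h (y k)) /\
   (forall k, h (y k) * h (yp k) < 1) &
   forall k t, `|t| <= y k -> h (y k) * h (yp k) < h t ^+ 2].
Proof.
have ex (d : R) : exists v : R * R, 0 < d -> [/\ 0 < v.1 < v.2 /\ v.2 < d, 1 < h v.1,
      forall t, `|t| <= v.2 -> h t <= h v.1,
      h v.1 * h v.2 < 1 &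
      forall t, `|t| <= v.1 -> h v.1 * h v.2 < h t ^+ 2].
  have [d0|d0] := boolP (0 < d); last by exists (0, 0) => d1.
  by have [y [yp P]] := hpeaks d0; exists (y, yp).
have [V hV] := choice ex.
pose d := fix d k := if k is k'.+1 then (V (d k')).1 else 1.
have dpos k : 0 < d k.
  elim: k => [//|k IH] /=; by have [[/andP[? _] _]] := hV _ IH.
have dle k : d k <= 1.
  elim: k => [//|k IH] /=; have [[/andP[_ ?] ?]] := hV _ (dpos k) => _ _ _ _.
  by rewrite (le_trans _ IH) // ltW // (lt_trans _ (_ : (V (d k)).2 < d k)).
exists (fun k => (V (d k)).1), (fun k => (V (d k)).2); split.
- by move=> k; have [[? ?]] := hV _ (dpos k); split=> //; exact: lt_le_trans (dle k).
- elim=> [//|k IH] j; have [[_ yanti] _ _ _ _] := hV _ (dpos k.+1).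
  rewrite ltnS leq_eqVlt => /predU1P[->//|jk].
  apply: (lt_trans yanti); apply: (lt_trans _ (IH _ jk)).
  by have [[/andP[_ ylt] _] _ _ _ _] := hV _ (dpos k).
- by move=> k; have [] := hV _ (dpos k).
- by split=> k; have [] := hV _ (dpos k).
- by move=> k; have [] := hV _ (dpos k).
Qed.

Section OnePeak.
Variables y yp : R.
Hypothesis yy : 0 < y < yp.
Hypothesis yp1 : yp < 1.
Hypothesis hy1 : 1 < h y.
Hypothesis hmax : forall t, `|t| <= yp -> h t <= h y.
Hypothesis hdip : h y * h yp < 1.
Hypothesis hinner : forall t, `|t| <= y -> h y * h yp < h t ^+ 2.

Let y0 : 0 < y. Proof. by case/andP: yy. Qed.
Let yyp : y < yp. Proof. by case/andP: yy. Qed.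
Let yp0 : 0 < yp. Proof. exact: lt_trans yyp. Qed.
Let hper_int (k : int) t : h (t + 2 * pi * k%:~R) = h t.
Proof. exact: int_periodic. Qed.

Let h_norm t : h `|t| = h t.
Proof. by have [t0|t0] := leP 0 t; [rewrite ger0_norm|rewrite ltr0_norm ?heven]. Qed.

Lemma h_le_peak (t : R) : cos yp <= cos t -> h t <= h y.
Proof.
move=> ct; have [|k hk] := @cos_near R yp t _ ct; first by apply: unit_0pi; rewrite !ltW.
by rewrite -(hper_int k); exact: hmax.
Qed.

Lemma h_cos_eq (a t : R) : 0 <= a <= 1 -> cos t = cos a -> h t = h a.
Proof.
move=> /andP[a0 a1] ct.
have [||k hk] := @cos_near R a t; [by apply: unit_0pi; apply/andP|by rewrite ct|].
rewrite -(hper_int k) -h_norm; congr h; apply: cos_inj; rewrite ?in_itv /=.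
- by rewrite unit_0pi // normr_ge0 (le_trans hk).
- by rewrite unit_0pi // a0.
- by rewrite cos_norm (int_periodic (@cos_2pi R)).
Qed.

Lemma h_inner (t : R) : cos y <= cos t -> h y * h yp < h t ^+ 2.
Proof.
move=> ct; have [|k hk] := @cos_near R y t _ ct; first by apply: unit_0pi; rewrite !ltW // (lt_trans yyp).
by rewrite -(hper_int k t); exact: hinner.
Qed.

Lemma f_le_peak (x : 'rV[R]_2) : cos yp <= cos (x 0 0) -> cos yp <= cos (x 0 1) -> f x <= h y.
Proof.
move=> c0 c1; have H0 := h_le_peak c0; have H1 := h_le_peak c1.
rewrite leNgt; apply/negP => lt.
have := fCS x; apply/negP; rewrite -ltNge.
apply: (@le_lt_trans _ _ (h y * h y)); first by apply: ler_pM.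
by rewrite expr2; have := h_ge0 y; nra.
Qed.

Lemma f_boundary (x : 'rV[R]_2) : cos yp <= cos (x 0 0) -> cos yp <= cos (x 0 1) ->
  cos (x 0 0) = cos yp \/ cos (x 0 1) = cos yp -> f x ^+ 2 <= h y * h yp.
Proof.
move=> c0 c1; have H0 := h_le_peak c0; have H1 := h_le_peak c1.
have yp01 : 0 <= yp <= 1 by rewrite !ltW.
case=> c; apply: (le_trans (fCS x)); rewrite (h_cos_eq yp01 c).
  by rewrite mulrC ler_wpM2r.
by rewrite ler_wpM2r.
Qed.

Definition cos_box (a : R) (x : 'rV[R]_2) : R := Num.min (cos (x 0 0) - cos a) (cos (x 0 1) - cos a).

Lemma cos_box_cont a : continuous (cos_box a).
Proof.
have C i : continuous (fun x : 'rV[R]_2 => cos (x 0 i) - cos a).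
  apply: (@smn_cont R 2 0); apply: smnB; last exact: smn_cst.
  by apply: (@smn_comp R 2 0 (@cos R)); [exact: (csm_sincos R 0).2|exact: smn_coord].
by apply: min_cont; exact: C.
Qed.

Lemma cos_box_per a : periodic_fun (cos_box a).
Proof. by move=> k x; rewrite /cos_box !add_period !(int_periodic (@cos_2pi R)). Qed.

Definition square_fun (x : 'rV[R]_2) : R := Num.min (f x - 1) (cos_box yp x).

Lemma square_fun_cont : continuous square_fun.
Proof.
apply: min_cont; last exact: cos_box_cont.
by move=> x; apply: continuousB; [exact: fcont|exact: cst_continuous].
Qed.

Lemma square_fun_per : periodic_fun square_fun.
Proof. by move=> k x; rewrite /square_fun fper cos_box_per. Qed.

Lemma square_fun_neq0 x : f x - 1 != 0 -> square_fun x != 0.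
Proof.
move=> fx; apply/eqP => E.
have : 0 <= square_fun x by rewrite E.
rewrite /square_fun /cos_box !le_min !subr_ge0 => /and3P[f1 c0 c1].
have flt : 1 < f x by rewrite lt_neqAle f1 andbT eq_sym -subr_eq0.
have : f x ^+ 2 <= h y * h yp.
  apply: f_boundary => //; apply: contrapT => /not_orP[/eqP n0 /eqP n1].
  suff : 0 < square_fun x by rewrite E ltxx.
  rewrite /square_fun /cos_box !lt_min !subr_gt0 flt !lt_neqAle c0 c1 !andbT /=.
  by rewrite ![cos yp == _]eq_sym n0 n1.
by have := hdip; nra.
Qed.

Lemma square_fun_peak : 0 < square_fun (const_mx y).
Proof.
rewrite /square_fun /cos_box !lt_min !subr_gt0 fd !mxE // hy1 /= andbb.
by apply: cos_lt; rewrite ?ltW.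
Qed.

Lemma square_fun_outer t : yp < t -> t <= 1 -> square_fun (const_mx t) < 0.
Proof.
move=> tp t1; rewrite /square_fun /cos_box !mxE !gt_min !subr_lt0.
by rewrite (cos_lt (ltW yp0) tp t1) !orbT.
Qed.

Definition diff_fun (z : 'rV[R]_(2 + 2)) : R := f (lsubmx z) - f (rsubmx z).

Definition wall_region (z : 'rV[R]_(2 + 2)) : R :=
  Num.min (diff_fun z) (Num.min (cos_box yp (lsubmx z)) (cos_box y (rsubmx z))).

Definition wall (z : 'rV[R]_(2 + 2)) : R := sin (rsubmx z 0 0 - rsubmx z 0 1).

Lemma diff_fun_per : periodic_fun diff_fun.
Proof. by move=> k z; rewrite /diff_fun !linearD /= period_lsubmx period_rsubmx !fper. Qed.

Lemma wall_region_per : periodic_fun wall_region.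
Proof.
move=> k z; rewrite /wall_region diff_fun_per !linearD /= period_lsubmx period_rsubmx.
by rewrite !cos_box_per.
Qed.

Lemma wall_per : periodic_fun wall.
Proof.
move=> k z; rewrite /wall linearD /= period_rsubmx !add_period.
set a := (rsubmx k 0 0); set b := (rsubmx k 0 1).
have -> : rsubmx z 0 0 + 2 * pi * a%:~R - (rsubmx z 0 1 + 2 * pi * b%:~R)
   = rsubmx z 0 0 - rsubmx z 0 1 + 2 * pi * (a - b)%:~R :> R.
  by rewrite intrB; ring.
exact: (int_periodic (@sin_2pi R)).
Qed.

Lemma wall_region_cont : continuous wall_region.
Proof.
apply: min_cont.
  move=> z; apply: continuousB.
    apply: (@continuous_comp _ _ _ (fun z : 'rV[R]_(2 + 2) => lsubmx z) f); last exact: fcont.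
    exact: lsubmx_cont.
  apply: (@continuous_comp _ _ _ (fun z : 'rV[R]_(2 + 2) => rsubmx z) f); last exact: fcont.
  exact: rsubmx_cont.
apply: min_cont => z.
  apply: (@continuous_comp _ _ _ (fun z : 'rV[R]_(2 + 2) => lsubmx z) (cos_box yp)).
    exact: lsubmx_cont.
  exact: cos_box_cont.
apply: (@continuous_comp _ _ _ (fun z : 'rV[R]_(2 + 2) => rsubmx z) (cos_box y)).
  exact: rsubmx_cont.
exact: cos_box_cont.
Qed.

Lemma wall_cont : continuous wall.
Proof.
apply: (@smn_cont R (2 + 2) 0); apply: (@smn_comp R (2 + 2) 0 (@sin R)).
  exact: (csm_sincos R 0).1.
by apply: smnB; apply: (@smn_rsubmx R 2 2 0 (fun x => x 0 _)); exact: smn_coord.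
Qed.

Lemma sin_eq0_small (t : R) : `|t| < pi -> sin t = 0 -> t = 0.
Proof.
move=> tpi st; apply/eqP/negPn/negP; rewrite neq_lt => /orP[t0|t0].
  have : 0 < sin (- t) by apply: sin_gt0_pi; rewrite oppr_gt0 t0 -(ltr0_norm t0).
  by rewrite sinN st oppr0 ltxx.
have : 0 < sin t by apply: sin_gt0_pi; rewrite t0 -(gtr0_norm t0).
by rewrite st ltxx.
Qed.

Lemma wall_neq0 z : diff_fun z != 0 -> wall_region z = 0 -> wall z != 0.
Proof.
move=> uz E.
have : 0 <= wall_region z by rewrite E.
rewrite /wall_region /cos_box !le_min !subr_ge0.
set X := lsubmx z; set Y := rsubmx z => /and3P[u0 /andP[X0 X1] /andP[Y0 Y1]].
have fXY : f Y < f X.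
  by rewrite lt_neqAle u0 andbT; apply: contraNneq uz; rewrite /diff_fun -/X -/Y => ->; rewrite subrr.
apply/eqP => wz.
have yle : 0 <= y <= 1 by rewrite !ltW // (lt_trans yyp).
have [|k0 hk0] := @cos_near R y (Y 0 0) _ Y0; first exact: unit_0pi.
have [|k1 hk1] := @cos_near R y (Y 0 1) _ Y1; first exact: unit_0pi.
set a := Y 0 0 + 2 * pi * k0%:~R in hk0; set b := Y 0 1 + 2 * pi * k1%:~R in hk1.
have ab : a = b.
  apply/eqP; rewrite -subr_eq0; apply/eqP; apply: sin_eq0_small.
    apply: (le_lt_trans (ler_normB _ _)); apply: (le_lt_trans (lerD hk0 hk1)).
    apply: (@lt_le_trans _ _ 2); last exact: pi_ge2.
    by move: (lt_trans yyp yp1); lra.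
  rewrite -wz /wall -/Y.
  have -> : a - b = Y 0 0 - Y 0 1 + 2 * pi * (k0 - k1)%:~R by rewrite /a /b intrB; ring.
  exact: (int_periodic (@sin_2pi R)).
have fY : f Y = h a.
  rewrite -(fper (\row_i (if i == 0 then k0 else k1)) Y) fd add_period mxE //.
  by rewrite add_period mxE.
have ha : h a = h (Y 0 0) by rewrite /a hper_int.
have hb : h a = h (Y 0 1) by rewrite ab /b hper_int.
have hX : cos (X 0 0) = cos yp \/ cos (X 0 1) = cos yp -> False.
  move=> /(f_boundary X0 X1) fX.
  have := h_inner Y0; rewrite -ha => hi.
  have := h_ge0 a; move: fXY; rewrite fY => *; nra.
have hY : cos (Y 0 0) = cos y \/ cos (Y 0 1) = cos y -> False.
  have fX := f_le_peak X0 X1.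
  by case=> /(h_cos_eq yle) hy; move: fXY; rewrite fY; [rewrite ha|rewrite hb]; rewrite hy ltNge fX.
suff : 0 < wall_region z by rewrite E ltxx.
rewrite /wall_region /cos_box -/X -/Y !lt_min !subr_gt0 fXY !lt_neqAle X0 X1 Y0 Y1 !andbT /=.
rewrite -andbA; apply/and4P; split; apply/eqP => c.
- by apply: hX; left.
- by apply: hX; right.
- by apply: hY; left.
- by apply: hY; right.
Qed.

Definition ramp1 t : R := yp * Num.min (2 * t) 1.
Definition ramp2 t : R := yp * Num.max (2 * t - 1) 0.

                                                                                                  
Definition side_path (s : bool) (t : R) : 'rV[R]_(2 + 2) :=
  row_mx (const_mx y) (\row_(i < 2) (if (i == 0) == s then ramp1 t else ramp2 t)).

Lemma ramp_bounds t : 0 <= t <= 1 ->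
  [/\ 0 <= ramp1 t <= yp, 0 <= ramp2 t <= ramp1 t & ramp2 t = 0 \/ ramp1 t = yp].
Proof.
move=> /andP[t0 t1]; rewrite /ramp1 /ramp2.
have [t2|t2] := leP t (1 / 2).
  rewrite min_l; last by lra.
  by rewrite max_r; [split; [apply/andP; split; move: yp0; nra| |left]; rewrite ?mulr0 //=; move: yp0; nra|lra].
rewrite min_r; last by lra.
rewrite max_l; last by lra.
rewrite mulr1 lexx (ltW yp0); split=> //; last by right.
by apply/andP; split; move: yp0; nra.
Qed.

Lemma side_path_diff s t : 0 <= t <= 1 -> 0 < diff_fun (side_path s t).
Proof.
move=> t01; have [/andP[r1 r1'] /andP[r2 r2'] r12] := ramp_bounds t01.
rewrite /diff_fun /side_path row_mxKl row_mxKr subr_gt0 (fd (x := const_mx y)) ?mxE //.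
set Y := \row_i _.
have hle a : 0 <= a -> a <= yp -> h a <= h y by move=> a0 ayp; apply: hmax; rewrite ger0_norm.
have : f Y ^+ 2 < h y ^+ 2.
  have -> : h y ^+ 2 = h y * h y by rewrite expr2.
  apply: (@le_lt_trans _ _ (h (ramp1 t) * h (ramp2 t))).
    by apply: (le_trans (fCS Y)); rewrite !mxE /=; case: s {Y} => //=; rewrite mulrC.
  case: r12 => ->.
    rewrite h0 mulr1; apply: (le_lt_trans (hle _ r1 r1')); by move: hy1; nra.
  apply: (@le_lt_trans _ _ (h yp * h y)).
    by rewrite ler_wpM2l // hle // (le_trans r2').
  by rewrite mulrC; apply: (lt_trans hdip); move: hy1; nra.
by move: hy1; nra.
Qed.

Lemma side_path_wall s t : 0 <= t <= 1 ->
  wall (side_path s t) = (if s then 1 else - 1) * sin (ramp1 t - ramp2 t).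
Proof.
move=> t01; rewrite /wall /side_path row_mxKr !mxE /=.
by case: s => /=; rewrite ?mul1r // mulN1r -sinN opprB.
Qed.

Lemma side_path_wall_pos t : 0 < t < 1 -> 0 < wall (side_path true t).
Proof.
move=> /andP[t0 t1]; have t01 : 0 <= t <= 1 by rewrite !ltW.
have [/andP[r1 r1'] /andP[r2 r2'] r12] := ramp_bounds t01.
rewrite side_path_wall // mul1r; apply: sin_gt0_pi; apply/andP; split.
  rewrite subr_gt0 /ramp1 /ramp2 ltr_pM2l // lt_min !gt_max.
  by apply/andP; split; apply/andP; split; lra.
apply: (@le_lt_trans _ _ yp); first by lra.
by apply: (lt_trans yp1); apply: (@lt_le_trans _ _ 2); [lra|exact: pi_ge2].
Qed.

Lemma side_path_wall_neg t : 0 <= t <= 1 -> wall (side_path false t) <= 0.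
Proof.
move=> t01; have [/andP[r1 r1'] /andP[r2 r2'] r12] := ramp_bounds t01.
rewrite side_path_wall // mulN1r oppr_le0; apply: sin_ge0_pi; rewrite subr_ge0 r2' /=.
apply: (@le_trans _ _ yp); first by lra.
by apply: (le_trans (ltW yp1)); apply: (@le_trans _ _ 2); [lra|exact: pi_ge2].
Qed.

Lemma side_path_wall0 s : wall (side_path s 0) = 0.
Proof.
by rewrite side_path_wall ?lexx ?ler01 // /ramp1 /ramp2 min_l ?max_r ?mulr0 ?subrr ?sin0 ?mulr0 // ?sub0r //; lra.
Qed.

Lemma side_path_start s t : 0 <= t -> 2 * yp * t < y -> 0 < wall_region (side_path s t).
Proof.
move=> t0 ty.
have t2 : t < 1 / 2 by move: (yyp) (yp0); nra.
have t01 : 0 <= t <= 1 by apply/andP; split; lra.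
have [/andP[r1 r1'] /andP[r2 r2'] r12] := ramp_bounds t01.
have r1y : ramp1 t < y by rewrite /ramp1 min_l; lra.
have y1 := lt_trans yyp yp1.
rewrite /wall_region !lt_min side_path_diff // /cos_box /side_path !row_mxKl !row_mxKr !mxE !subr_gt0.
rewrite (cos_lt (ltW y0) yyp (ltW yp1)) /=.
have c1 : cos y < cos (ramp1 t) by apply: cos_lt => //; exact: ltW.
have c2 : cos y < cos (ramp2 t) by apply: cos_lt => //; [exact: le_lt_trans r1y|exact: ltW].
by case: s => /=; rewrite c1 c2.
Qed.

Lemma side_path_end s : wall_region (side_path s 1) < 0.
Proof.
have E : ramp1 1 = yp /\ ramp2 1 = yp.
  by rewrite /ramp1 /ramp2 min_r ?max_l ?mulr1; lra.
rewrite /wall_region !gt_min /cos_box /side_path !row_mxKl !row_mxKr !mxE !subr_lt0 !E.1 !E.2.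
by case: s; rewrite /= (cos_lt (ltW y0) yyp (ltW yp1)) !orbT.
Qed.

Lemma wall_region_outer t Y : yp < t -> t <= 1 -> wall_region (row_mx (const_mx t) Y) < 0.
Proof.
move=> tp t1; rewrite /wall_region !gt_min /cos_box row_mxKl !mxE !subr_lt0.
by rewrite (cos_lt (ltW yp0) tp t1) !orbT.
Qed.

Let side_map s (p : 'rV[R]_2) := side_path s (p 0 1).

Lemma side_map_cont s : continuous (side_map s).
Proof.
have c1 : continuous (fun p : 'rV[R]_2 => p 0 1) by exact: coord_continuous.
have cm (a : R) : continuous (fun p : 'rV[R]_2 => 2 * p 0 1 - a).
  by apply: (@smn_cont R 2 0); apply: smnB; [apply: smnZ; exact: smn_coord|exact: smn_cst].
have r1 : continuous (fun p : 'rV[R]_2 => ramp1 (p 0 1)).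
  rewrite /ramp1 => p; apply: (@continuousM _ _ (fun=> yp) (fun p : 'rV[R]_2 => Num.min (2 * p 0 1) 1)).
    exact: cst_continuous.
  have c0 : continuous (fun p : 'rV[R]_2 => 2 * p 0 1) by have := cm 0; under eq_fun do rewrite subr0.
  by apply: (@min_cont _ _ (fun p : 'rV[R]_2 => 2 * p 0 1) (fun=> 1)) => // q; exact: cst_continuous.
have r2 : continuous (fun p : 'rV[R]_2 => ramp2 (p 0 1)).
  rewrite /ramp2 => p; apply: (@continuousM _ _ (fun=> yp) (fun p : 'rV[R]_2 => Num.max (2 * p 0 1 - 1) 0)).
    exact: cst_continuous.
  by apply: continuous_max; [exact: cm|exact: cst_continuous].
apply: rv_cont => j; rewrite /side_map /side_path.
have [k ->|k ->] := split_ordP j.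
  by under eq_fun do rewrite row_mxEl mxE; exact: cst_continuous.
under eq_fun do rewrite row_mxEr mxE.
by case: ((k == 0) == s).
Qed.

Lemma side_map_neq0 s p : std_simplex R 1 p -> diff_fun (side_map s p) != 0.
Proof.
move=> [p0 p1]; rewrite gt_eqF // side_path_diff // p0 /= -p1 big_ord_recl big_ord1.
have -> : fintype.lift ord0 ord0 = 1 :> 'I_2 by apply/val_inj.
by rewrite lerDr.
Qed.

Variable K : fieldType.

Definition side s : singular_simplex R (nodal_compl diff_fun) 1 :=
  mk_simplex diff_fun_per (@side_map_cont s) (@side_map_neq0 s).

Definition loop_cycle : chain R K (nodal_compl diff_fun) 1 := << side true >> - << side false >>.

Lemma loop_cycle_boundary : boundary loop_cycle = 0.
Proof.
rewrite /boundary /loop_cycle (lift_is_additive (@simplex_boundary R K _ 0)) !liftU !scale1r.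
apply/eqP; rewrite subr_eq0; apply/eqP; apply: eq_bigr => i _.
congr (_ *: << _ >>); apply/continuousEP => p /=; apply: val_inj => /=; congr torus_proj.
have -> : p = to_simplex (\row_i (i == 0)%:R).
  have v0 : std_simplex R 0 (\row_i (i == 0)%:R) by exact: set_mem (vertex0_in R 0).
  apply: set_val_inj; rewrite to_simplexK //; apply/rowP => j; rewrite mxE (ord1 j) /=.
  by have [_ /=] := set_val_simplex p; rewrite big_ord1.
have [e0 e1] := pt1_ends R.
have eq_side t : 0 <= t <= 1 -> ramp1 t = ramp2 t ->
    side_map true (set_val (pt1 t)) = side_map false (set_val (pt1 t)).
  move=> t01 E; rewrite /side_map pt1K // !mxE /= /side_path; congr row_mx.
  by apply/rowP => j; rewrite !mxE E; case: ifP; case: ifP.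
have [-> | ->] : i = inord 0 \/ i = inord 1.
  by case: i => [[|[|//]]] hi; [left|right]; apply/val_inj; rewrite /= inordK.
  rewrite [X in set_val X]e0; apply: eq_side; rewrite ?lexx ?ler01 //.
  by rewrite /ramp1 /ramp2 min_r ?max_l; lra.
rewrite [X in set_val X]e1; apply: eq_side; rewrite ?lexx ?ler01 //.
by rewrite /ramp1 /ramp2 min_l ?max_r; lra.
Qed.

Lemma steps_side (A B : 'rV[R]_(2 + 2) -> R) n s : periodic_fun A -> periodic_fun B ->
  steps (crossing (f := diff_fun) K A B) n (side s) =
  \sum_(k < n.+1) let t k : R := k%:R / n.+1%:R in
    if (0 < A (side_path s (t k))) && (0 < A (side_path s (t k.+1)))
    then (0 < B (side_path s (t k.+1)))%R%:R - (0 < B (side_path s (t k)))%R%:R else 0.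
Proof.
move=> pA pB; apply: eq_bigr => k _.
have t01 (j : nat) : (j <= n.+1)%N -> 0 <= (j%:R / n.+1%:R : R) <= 1.
  by move=> jn; rewrite divr_ge0 //= ler_pdivrMr ?ltr0n // mul1r ler_nat.
have E (F : 'rV[R]_(2 + 2) -> R) (j : nat) : periodic_fun F -> (j <= n.+1)%N ->
    F (rep (side s (pt1 (j%:R / n.+1%:R)))) = F (side_path s (j%:R / n.+1%:R)).
  by move=> pF jn; rewrite mk_simplexE // /side_map pt1K ?t01 // mxE.
have k1 := ltn_ord k.
by rewrite /crossing !E // ltnW.
Qed.

Lemma steps_loop n : 2 * yp < y * n.+1%:R ->
  ev (steps (crossing (f := diff_fun) K wall_region wall) n) loop_cycle = 1.
Proof.
move=> yn; rewrite evB !evU !mul1r !steps_side; try exact: wall_region_per; try exact: wall_per.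
have n0 : 0 < n.+1%:R :> R by rewrite ltr0n.
have t01 (j : nat) : (j <= n.+1)%N -> 0 <= (j%:R / n.+1%:R : R) <= 1.
  by move=> jn; rewrite divr_ge0 //= ler_pdivrMr // mul1r ler_nat.
rewrite [X in _ - X]big1 ?subr0; last first.
  move=> k _ /=; have k1 := ltn_ord k; case: ifP => // _.
  by rewrite !ltNge !side_path_wall_neg ?t01 ?(ltnW k1) //= subrr.
have n_gt0 : (0 < n)%N.
  rewrite lt0n; apply/eqP => n00; move: yn; rewrite n00 mulr1.
  by move: (yyp) (y0) (yp0); lra.
rewrite big_ord_recl big1 => [|k _] /=.
  have S1 : 0 < wall_region (side_path true (1 / n.+1%:R)).
    by apply: side_path_start; rewrite ?divr_ge0 ?ler01 ?ltW // mulrA mulr1 ltr_pdivrMr.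
  rewrite mul0r side_path_start ?mulr0 // S1 /=.
  rewrite side_path_wall0 ltxx side_path_wall_pos ?subr0 ?addr0 //.
  by rewrite divr_gt0 ?ltr01 //= ltr_pdivrMr // mul1r ltr_nat.
have k1 := ltn_ord k; rewrite /bump /= add1n.
have [kn|kn] := leqP k.+2 n.
  case: ifP => // _.
  by rewrite !side_path_wall_pos ?subrr // divr_gt0 ?ltr0n //= ltr_pdivrMr // mul1r ltr_nat // ltnW.
have -> : k.+2 = n.+1 by apply/eqP; rewrite eqn_leq kn andbT.
by rewrite divff ?gt_eqF // [_ < wall_region (side_path true 1)]ltNge (ltW (side_path_end _)) andbF.
Qed.

Lemma steps_loop_outer (A B : 'rV[R]_(2 + 2) -> R) n : periodic_fun A -> periodic_fun B ->
  (forall Y, A (row_mx (const_mx y) Y) < 0) ->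
  ev (steps (crossing (f := diff_fun) K A B) n) loop_cycle = 0.
Proof.
move=> pA pB Aneg; rewrite evB !evU !mul1r !steps_side //.
by rewrite !big1 ?subrr // => k _ /=; rewrite !ltNge (ltW (Aneg _)).
Qed.

End OnePeak.

Variable K : fieldType.

Lemma betti0_bls : nodal_betti K 0 (fun x => f x - 1) = +oo%E.
Proof.
have [y [yp [yy anti hy [hmax hdip] hinner]]] := peaks_seq.
apply: betti0_infty => [k x|N]; first by rewrite fper.
exists (fun i => const_mx (y i)), (fun i => square_fun (yp i)); split=> /=.
- by move=> i; rewrite fd !mxE // subr_eq0 gt_eqF.
- by move=> i; split; [exact: square_fun_cont|exact: square_fun_per].
- move=> i x; have [yi yi1] := yy i.
  exact: (square_fun_neq0 yi yi1 (hmax i) (hdip i)).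
- by move=> i; have [yi yi1] := yy i; exact: (square_fun_peak yi yi1 (hy i)).
- move=> i j ji; have [yi yi1] := yy i; have [yj yj1] := yy j.
  apply: (square_fun_outer yi); first exact: anti.
  by case/andP: yj => _ ?; rewrite ltW // (lt_trans _ yj1).
Qed.

Lemma betti0_product (m : nat) : (0 < m)%N ->
  nodal_betti K 0 (fun z : 'rV[R]_(2 + 1) => (f (lsubmx z) - 1) * sin (m%:R * rsubmx z 0 0)) = +oo%E.
Proof.
move=> m0.
have mr : 0 < m%:R :> R by rewrite ltr0n.
have [y [yp [yy anti hy [hmax hdip] hinner]]] := peaks_seq.
apply: betti0_infty => [k z|N].
  by rewrite !linearD /= period_lsubmx period_rsubmx sin_period fper.
pose th : R := pi / 2 / m%:R.
have sth : sin (m%:R * th) = 1 by rewrite /th mulrC divfK ?gt_eqF // sin_pihalf.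
exists (fun i => row_mx (const_mx (y i)) (const_mx th)),
  (fun i z => Num.min (square_fun (yp i) (lsubmx z)) (sin (m%:R * rsubmx z 0 0))); split=> /=.
- move=> i; rewrite row_mxKl row_mxKr mxE sth mulr1 fd !mxE // subr_eq0 gt_eqF //.
- move=> i; split.
    apply: min_cont.
      move=> z; apply: (@continuous_comp _ _ _ (fun z : 'rV[R]_(2 + 1) => lsubmx z) (square_fun (yp i))).
        exact: lsubmx_cont.
      exact: square_fun_cont.
    apply: (@smn_cont R (2 + 1) 0); apply: (@smn_comp R (2 + 1) 0 (@sin R)).
      exact: (csm_sincos R 0).1.
    apply: smnZ; apply: (@smn_rsubmx R 2 1 0 (fun x => x 0 0)); exact: smn_coord.
  by move=> k z; rewrite !linearD /= period_lsubmx period_rsubmx sin_period square_fun_per.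
- move=> i z; rewrite mulf_eq0 negb_or => /andP[fz sz].
  have [yi yi1] := yy i.
  have F := square_fun_neq0 yi yi1 (hmax i) (hdip i) fz.
  by rewrite /Num.min; case: ifP.
- move=> i; have [yi yi1] := yy i.
  by rewrite row_mxKl row_mxKr mxE sth lt_min ltr01 andbT; exact: (square_fun_peak yi yi1 (hy i)).
- move=> i j ji; have [yi yi1] := yy i; have [yj yj1] := yy j.
  rewrite row_mxKl gt_min; apply/orP; left.
  apply: (square_fun_outer yi); first exact: anti.
  by case/andP: yj => _ ?; rewrite ltW // (lt_trans _ yj1).
Qed.

Lemma betti1_bls : nodal_betti K 1 diff_fun = +oo%E.
Proof.
have [y [yp [yy anti hy [hmax hdip] hinner]]] := peaks_seq.
apply: homology_dim_infty => N.
exists (fun i => loop_cycle (yy i).1 (hy i) (hmax i) (hdip i) K); split=> [i|b i].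
  exact: loop_cycle_boundary.
have [yi yi1] := yy i.
pose A := wall_region (y i) (yp i).
have AP : periodic_fun A by exact: wall_region_per.
have T : locally_additive (crossing (f := diff_fun) K A wall).
  apply: crossing_additive => //; [exact: wall_region_cont|exact: wall_cont|exact: wall_per|].
  move=> z uz; exact: (wall_neq0 yi yi1 (hmax i) (hinner i)).
have [M hM] := steps_boundary T b.
have [M' hM'] : exists M' : nat, 2 * yp i / y i < M'%:R.
  by exists (Num.truncn (2 * yp i / y i)).+1; exact: Num.Theory.truncnS_gt.
have yi0 : 0 < y i by case/andP: yi.
exists (steps (crossing K A wall) (maxn M M')); split.
- by apply: hM; exact: leq_maxl.
- move=> j ji; have [yj yj1] := yy j; apply: steps_loop_outer => //; first exact: wall_per.
  move=> Y; apply: wall_region_outer => //; first exact: anti.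
  by case/andP: yj => _ ?; rewrite ltW // (lt_trans _ yj1).
- have E : 2 * yp i < y i * (maxn M M').+1%:R.
    rewrite [ltRHS]mulrC -ltr_pdivrMr //; apply: (lt_le_trans hM').
    by rewrite ler_nat (leq_trans (leq_maxr M M')).
  exact: (steps_loop _ yi1 _ _ _ _ E).
Qed.
End Nodal.

                                   

Section TorusIntegral.
Variable R : realType.

Definition tsm n (f : 'rV[R]_n -> R) := periodic_fun f /\ smooth f.

Lemma tsm_cst n c : tsm (fun _ : 'rV[R]_n => c).
Proof. by split=> // k; exact: smn_cst. Qed.
Lemma tsmD n (f g : 'rV[R]_n -> R) : tsm f -> tsm g -> tsm (fun x => f x + g x).
Proof. by move=> [pf sf] [pg sg]; split=> [k x|k]; [rewrite pf pg|exact: smnD]. Qed.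
Lemma tsmB n (f g : 'rV[R]_n -> R) : tsm f -> tsm g -> tsm (fun x => f x - g x).
Proof. by move=> [pf sf] [pg sg]; split=> [k x|k]; [rewrite pf pg|exact: smnB]. Qed.
Lemma tsmM n (f g : 'rV[R]_n -> R) : tsm f -> tsm g -> tsm (fun x => f x * g x).
Proof. by move=> [pf sf] [pg sg]; split=> [k x|k]; [rewrite pf pg|exact: smnM]. Qed.
Lemma tsmZ n c (f : 'rV[R]_n -> R) : tsm f -> tsm (fun x => c * f x).
Proof. by move=> [pf sf]; split=> [k x|k]; [rewrite pf|exact: smnZ]. Qed.
Lemma tsmN n (f : 'rV[R]_n -> R) : tsm f -> tsm (fun x => - f x).
Proof. by move=> [pf sf]; split=> [k x|k]; [rewrite pf|exact: smnN]. Qed.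
Lemma tsmV n (f : 'rV[R]_n -> R) : (forall x, f x != 0) -> tsm f -> tsm (fun x => (f x)^-1).
Proof. by move=> f0 [pf sf]; split=> [k x|k]; [rewrite pf|exact: smnV]. Qed.
Lemma tsm_pderiv n i (f : 'rV[R]_n -> R) : tsm f -> tsm (pderiv i f).
Proof.
move=> [pf sf]; split; last exact: smooth_pderiv.
move=> k x; rewrite /pderiv /derive.
set F := fun t : R => _; set G := fun t : R => _.
suff -> : F = G by [].
by apply/funext => t; rewrite /F /G /= pf addrA pf.
Qed.

Lemma tsm_bounded n (f : 'rV[R]_n -> R) : tsm f -> exists2 M, 0 <= M & forall x, `|f x| <= M.
Proof.
move=> [pf sf].
pose box : set 'rV[R]_n := [set x | forall i, 0 <= x 0 i <= 2 * pi].
have tp : 0 < 2 * pi :> R by rewrite mulr_gt0 ?pi_gt0.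
have bcpt : compact box.
  apply: bounded_closed_compact.
    exists (2 * pi); split; first exact: num_real.
    move=> M M1 p hp /=; rewrite (le_trans _ (ltW M1)) //.
    rewrite /Num.norm /= mx_normrE; apply/bigmax_leP; split; first exact: ltW.
    by move=> -[i j] _ /=; rewrite [i]ord1; have /andP[h1 h2] := hp j; rewrite ger0_norm.
  have -> : box = \bigcap_(i in [set: 'I_n]) ([set p | 0 <= p 0 i] `&` [set p | p 0 i <= 2 * pi]).
    apply/seteqP; split=> p h i; first by move=> _; have /andP[] := h i.
    by have [h1 h2] := h i I; apply/andP.
  apply: closed_bigI => i _; apply: closedI.
    apply: (@preimage_closed _ _ (fun p : 'rV[R]_n => p 0 i) [set x | 0 <= x]).
      by move=> x _; exact: coord_continuous.
    exact: closed_ge.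
  apply: (@preimage_closed _ _ (fun p : 'rV[R]_n => p 0 i) [set x | x <= 2 * pi]).
    by move=> x _; exact: coord_continuous.
  exact: closed_le.
have [M [_ hM]] : bounded_set (f @` box).
  apply: compact_bounded; apply: continuous_compact => //.
  by apply: continuous_subspaceT; exact: (smn_cont (sf 0%N)).
exists (Num.max (M + 1) 0); first by rewrite le_max lexx orbT.
move=> x; pose k : 'rV[int]_n := \row_i (- Num.floor (x 0 i / (2 * pi))).
rewrite -(pf k) le_max; apply/orP; left.
apply: hM; first by rewrite ltrDl.
exists (x + period R k) => // i; rewrite add_period mxE mulrNz.
have /andP[m1 m2] : (Num.floor (x 0 i / (2 * pi)))%:~R <= x 0 i / (2 * pi) < (Num.floor (x 0 i / (2 * pi)) + 1)%:~R.
  exact: Num.Theory.floor_itv.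
rewrite ler_pdivlMr // in m1; rewrite ltr_pdivrMr // intrD mulrDl mul1r in m2.
by move: m1 m2; set m := _%:~R => m1 m2; apply/andP; split; lra.
Qed.

Section Slice.
Variable n : nat.

Definition slice (f : 'rV[R]_(1 + n) -> R) (t : R) : 'rV[R]_n -> R :=
  fun x => f (row_mx (const_mx t : 'rV_1) x).

Definition dir0 : 'I_(1 + n) := lshift n (ord0 : 'I_1).

Lemma slice_line t (x : 'rV[R]_n) :
  row_mx (const_mx t : 'rV_1) x = t *: delta_mx 0 dir0 + row_mx (0 : 'rV_1) x.
Proof.
rewrite /dir0 delta_mx_lshift scale_row_mx add_row_mx scaler0 add0r addr0; congr row_mx.
by apply/rowP => i; rewrite !mxE (ord1 i) !eqxx mulr1.
Qed.

Lemma slice_isd f (t : R) x : smooth f -> is_derive t 1 (fun s => slice f s x) (slice (pderiv dir0 f) t x).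
Proof.
move=> sf.
have /isd_line := smooth_is_derive dir0 (row_mx (const_mx t : 'rV_1) x) sf.
have -> : (fun s : R => f (s *: delta_mx 0 dir0 + row_mx (const_mx t : 'rV_1) x))
    = (fun s => slice f (s + t) x).
  by apply/funext => s; rewrite /slice [in RHS]slice_line scalerDl -addrA -slice_line.
move=> h; have := @isd_shift R (fun s => slice f (s + t) x) (- t) t (slice (pderiv dir0 f) t x).
rewrite subrr => /(_ h).
by under eq_fun do rewrite subrK.
Qed.

Lemma smn_slice k (f : 'rV[R]_(1 + n) -> R) t : smn k f -> smn k (slice f t).
Proof.
have cs : continuous (fun x : 'rV[R]_n => row_mx (const_mx t : 'rV_1) x : 'rV[R]_(1 + n)).
  apply: rv_cont => j; have [i ->|i ->] := split_ordP (j : 'I_(1 + n)).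
    by under eq_fun do rewrite row_mxEl mxE; exact: cst_continuous.
  by under eq_fun do rewrite row_mxEr; exact: coord_continuous.
elim: k f => [|k IH] f.
  move=> cf x; apply: (@continuous_comp _ _ _ (fun x : 'rV[R]_n => row_mx (const_mx t : 'rV_1) x : 'rV[R]_(1 + n)) f).
    exact: cs.
  exact: cf.
move=> [cf h]; split.
  move=> x; apply: (@continuous_comp _ _ _ (fun x : 'rV[R]_n => row_mx (const_mx t : 'rV_1) x : 'rV[R]_(1 + n)) f).
    exact: cs.
  exact: cf.
move=> i; have [f' df sf] := h (rshift 1 i : 'I_(1 + n)).
exists (slice f' t); last exact: IH.
move=> x; have /isd_line E := df (row_mx (const_mx t : 'rV_1) x); apply/isd_line.
have -> : (fun s : R => slice f t (s *: delta_mx 0 i + x)) =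
   (fun s : R => f (s *: delta_mx 0 (rshift 1 i) + row_mx (const_mx t : 'rV_1) x)).
  by apply/funext => s; rewrite delta_mx_rshift scale_row_mx add_row_mx scaler0 add0r.
exact: E.
Qed.

Lemma slice_per f t : periodic_fun f -> periodic_fun (slice f t).
Proof.
move=> pf k x; rewrite /slice -[RHS](pf (row_mx (0 : 'rV_1) k)); congr f.
apply/rowP => j; rewrite add_period.
have [i ->|i ->] := split_ordP (j : 'I_(1 + n)); first by rewrite !row_mxEl !mxE mulr0 addr0.
by rewrite !row_mxEr add_period.
Qed.

Lemma tsm_slice f t : tsm f -> tsm (slice f t).
Proof. by move=> [pf sf]; split=> [|k]; [exact: slice_per|exact: smn_slice]. Qed.

Lemma slice_2pi f : periodic_fun f -> slice f (2 * pi) = slice f 0.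
Proof.
move=> pf; apply/funext => x; rewrite /slice -[RHS](pf (row_mx (const_mx 1 : 'rV_1) 0)); congr f.
apply/rowP => j; rewrite add_period.
by have [i ->|i ->] := split_ordP (j : 'I_(1 + n)); rewrite ?row_mxEl ?row_mxEr !mxE ?mulr1 ?mulr0 ?add0r ?addr0.
Qed.
End Slice.

Definition integral_lin n := [/\
  forall f g : 'rV[R]_n -> R, tsm f -> tsm g ->
    torus_integral (fun x => f x + g x) = torus_integral f + torus_integral g,
  forall c (f : 'rV[R]_n -> R), tsm f -> torus_integral (fun x => c * f x) = c * torus_integral f &
  forall f : 'rV[R]_n -> R, tsm f -> (forall x, 0 <= f x) -> 0 <= torus_integral f].

                                                                                
Lemma slice_integral_isd n (f : 'rV[R]_(1 + n) -> R) (t : R) : integral_lin n -> tsm f ->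
  is_derive t 1 (fun s => torus_integral (slice f s)) (torus_integral (slice (pderiv (dir0 n) f) t)).
Proof.
move=> [iD iZ i0] tf.
have td := tsm_pderiv (dir0 n) tf; have tdd := tsm_pderiv (dir0 n) td.
have [M M0 hM] := tsm_bounded tdd.
have iN (g : 'rV[R]_n -> R) : tsm g -> torus_integral (fun x => - g x) = - torus_integral g.
  by move=> tg; have := iZ (-1) g tg; under eq_fun do rewrite mulN1r; rewrite mulN1r.
have iB (g g' : 'rV[R]_n -> R) : tsm g -> tsm g' ->
    torus_integral (fun x => g x - g' x) = torus_integral g - torus_integral g'.
  by move=> tg tg'; rewrite (iD g (fun x => - g' x)) ?iN //; exact: tsmN.
pose I1 := torus_integral (fun _ : 'rV[R]_n => 1 : R).
apply: (@isd_of_sq _ _ _ _ (M * I1)) => h h1.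
set g0 := slice f t; set g1 := slice f (h + t); set d := slice _ t.
have t0 : tsm g0 by exact: tsm_slice.
have t1 : tsm g1 by exact: tsm_slice.
have tdt : tsm d by exact: tsm_slice.
have tp : tsm (fun x => g1 x - g0 x - h * d x) by apply: tsmB; [exact: tsmB|exact: tsmZ].
have E : torus_integral g1 - torus_integral g0 - h * torus_integral d =
  torus_integral (fun x => g1 x - g0 x - h * d x).
  by rewrite (iB (fun x => g1 x - g0 x)) ?iB ?iZ //; [exact: tsmB|exact: tsmZ].
have bnd x : `|g1 x - g0 x - h * d x| <= M * h ^+ 2.
  apply: (@taylor1 R (fun s => slice f s x) (fun s => slice (pderiv (dir0 n) f) s x)
    (fun s => slice (pderiv (dir0 n) (pderiv (dir0 n) f)) s x)) => [s|s|s _].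
  - by apply: slice_isd; case: tf.
  - by apply: slice_isd; case: td.
  - exact: hM.
have tc : tsm (fun _ : 'rV[R]_n => M * h ^+ 2) by exact: tsm_cst.
have Ic : torus_integral (fun _ : 'rV[R]_n => M * h ^+ 2) = M * I1 * h ^+ 2.
  rewrite mulrAC -(iZ (M * h ^+ 2) (fun=> 1)); last exact: tsm_cst.
  by congr torus_integral; apply/funext => x; rewrite mulr1.
rewrite E ler_norml; apply/andP; split; rewrite -Ic.
  rewrite -subr_ge0 opprK -iD //; apply: i0; first exact: tsmD.
  by move=> x; have := bnd x; rewrite ler_norml => /andP[]; lra.
rewrite -subr_ge0 -iB //; apply: i0; first exact: tsmB.
by move=> x; have := bnd x; rewrite ler_norml => /andP[]; lra.
Qed.

Lemma torus_integralS n (f : 'rV[R]_n.+1 -> R) : torus_integral f =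
  \int[lebesgue_measure]_(t in `[0, 2 * pi]) torus_integral (slice f t).
Proof. by []. Qed.

Lemma torus_integral_lin n : integral_lin n.
Proof.
elim: n => [|n IH].
  by split=> [f g tf tg|c f tf|f tf f0] //=; exact: f0.
have ci (f : 'rV[R]_(1 + n) -> R) : tsm f ->
    lebesgue_measure.-integrable `[0, 2 * pi : R] (EFin \o (fun t => torus_integral (slice f t))).
  by move=> tf; apply: cont_integrable; apply: isd_cont => t; exact: slice_integral_isd.
have [iD iZ i0] := IH.
split=> [f g tf tg|c f tf|f tf f0].
- rewrite !torus_integralS -RintegralD ?ci //.
  by apply: eq_Rintegral => t _; rewrite -iD //; exact: tsm_slice.
- rewrite !torus_integralS -RintegralZl ?ci //.
  by apply: eq_Rintegral => t _; rewrite -iZ //; exact: tsm_slice.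
- rewrite torus_integralS; apply: Rintegral_ge0 => t _.
  by apply: i0 => [|x]; [exact: tsm_slice|exact: f0].
Qed.

Lemma Rintegral_derive (F F' : R -> R) (a b : R) : a < b -> continuous F' ->
  (forall t : R, is_derive t 1 F (F' t)) -> \int[lebesgue_measure]_(t in `[a, b]) F' t = F b - F a.
Proof.
move=> ab cF' dF; rewrite /Rintegral (@continuous_FTC2 R F' F) //.
- exact: continuous_subspaceT.
- have cF := isd_cont dF.
  split; first by move=> t _; case: (dF t).
    by apply: cvg_at_right_filter; exact: cF.
  by apply: cvg_at_left_filter; exact: cF.
- by move=> t _; rewrite derive1E; case: (dF t).
Qed.

Lemma torus_integral_pderiv n (f : 'rV[R]_n -> R) i : tsm f -> torus_integral (pderiv i f) = 0.
Proof.
elim: n f i => [f [] //|n IH] f i tf; rewrite torus_integralS.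
have [j ->|j ->] := split_ordP (i : 'I_(1 + n)).
  have -> : lshift n j = dir0 n by rewrite /dir0; congr lshift; exact: ord1.
  have td := tsm_pderiv (dir0 n) tf.
  have tp : 0 < 2 * pi :> R by rewrite mulr_gt0 ?pi_gt0.
  have dJ g (tg : tsm g) t := slice_integral_isd t (torus_integral_lin n) tg.
  have := @Rintegral_derive _ _ 0 (2 * pi) tp (isd_cont (dJ _ td)) (dJ _ tf).
  by rewrite slice_2pi ?subrr //; case: tf.
under eq_Rintegral => t _.
  rewrite (_ : slice (pderiv (rshift 1 j) f) t = pderiv j (slice f t)); last first.
    by rewrite /slice (pderiv_snd (m := 1)).
  rewrite IH; last exact: tsm_slice.
  over.
by rewrite Rintegral_cst //= mul0r.
Qed.
Lemma integral_div_ge0 n i j k (a b c N : 'rV[R]_n -> R) : tsm a -> tsm b -> tsm c -> tsm N ->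
  (forall z, 0 <= N z) ->
  0 <= torus_integral (fun z => (-1 * pderiv i a z + -1 * pderiv j b z) + (pderiv k c z + N z)).
Proof.
move=> ta tb tc tN N0; have [iD iZ ige] := torus_integral_lin n.
have t0 := tsm_pderiv i ta; have t1 := tsm_pderiv j tb; have t2 := tsm_pderiv k tc.
rewrite (iD _ _ (tsmD (tsmZ (-1) t0) (tsmZ (-1) t1)) (tsmD t2 tN)).
rewrite (iD _ _ (tsmZ (-1) t0) (tsmZ (-1) t1)) (iD _ _ t2 tN) (iZ _ _ t0) (iZ _ _ t1).
by rewrite !torus_integral_pderiv // !mulr0 !add0r; exact: ige.
Qed.

End TorusIntegral.

                                  

Lemma pderiv_fst2 (R : realType) m n (h : 'rV[R]_(m + n) -> R) (i j : 'I_m) (y : 'rV[R]_n) :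
  pderiv i (pderiv j (fun x => h (row_mx x y))) =
  fun x => pderiv (lshift n i) (pderiv (lshift n j) h) (row_mx x y).
Proof. by rewrite pderiv_fst (pderiv_fst (pderiv _ h)). Qed.

Lemma pderiv_snd2 (R : realType) m n (h : 'rV[R]_(m + n) -> R) (i j : 'I_n) (x : 'rV[R]_m) :
  pderiv i (pderiv j (fun y => h (row_mx x y))) =
  fun y => pderiv (rshift m i) (pderiv (rshift m j) h) (row_mx x y).
Proof. by rewrite pderiv_snd (pderiv_snd (pderiv _ h)). Qed.

Section Operator.
Variables (R : realType) (q : R -> R) (lam : R).
Hypothesis qs : smooth1 q.
Hypothesis q0 : forall x, 0 < q x.
Hypothesis qper : forall x, q (x + 2 * pi) = q x.

Let i0 : 'I_(2 + 1) := lshift 1 0.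
Let i1 : 'I_(2 + 1) := lshift 1 1.
Let i2 : 'I_(2 + 1) := rshift 2 0.

Definition fac (z : 'rV[R]_(2 + 1)) : R := cfac q (lsubmx z).

Lemma fac_gt0 z : 0 < fac z. Proof. exact: cfac_gt0. Qed.
Lemma fac_neq0 z : fac z != 0. Proof. exact: cfac_neq0. Qed.

Lemma tsm_fac : tsm fac.
Proof.
split=> k; last exact: (@smn_lsubmx R 2 1 k (cfac q) (smooth_cfac qs k)).
by move=> z; rewrite /fac linearD /= period_lsubmx cfac_periodic.
Qed.

Lemma pderiv_fac2 : pderiv i2 fac = fun=> 0.
Proof. exact: pderiv_lsubmx0. Qed.

Definition flat_laplace (h : 'rV[R]_(2 + 1) -> R) z : R :=
  pderiv i0 (pderiv i0 h) z + pderiv i1 (pderiv i1 h) z.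

Lemma laplace_fstE (h : 'rV[R]_(2 + 1) -> R) : laplace_fst (gconf q) h = fun z => - ((fac z)^-1 * flat_laplace h z).
Proof.
apply/funext => z; rewrite /laplace_fst (laplace_gconf q0).
by rewrite (pderiv_fst2 h 0 0) (pderiv_fst2 h 1 1) hsubmxK.
Qed.

Lemma laplace_st (f : 'rV[R]_1 -> R) : laplace (@g_st R) f = fun x => - pderiv 0 (pderiv 0 f) x.
Proof.
apply/funext => x; rewrite /laplace /divergence.
have V y : vol_density (@g_st R) y = 1 by rewrite /vol_density det1 sqrtr1.
rewrite V invr1 mul1r big_ord1.
have E : (fun y : 'rV[R]_1 => vol_density (@g_st R) y * gradient (@g_st R) f y 0 ord0) = pderiv 0 f.
  by apply/funext => y; rewrite V mul1r mxE big_ord1 /g_st invmx1 mxE eqxx mul1r.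
by rewrite E.
Qed.

Lemma laplace_sndE (h : 'rV[R]_(2 + 1) -> R) : laplace_snd (@g_st R) h = fun z => - pderiv i2 (pderiv i2 h) z.
Proof.
apply/funext => z; rewrite /laplace_snd laplace_st.
by rewrite pderiv_snd2 hsubmxK.
Qed.

Lemma vol_fac z : vol_density (metric_sum (gconf q) (@g_st R)) z = fac z.
Proof.
rewrite /vol_density /metric_sum det_ublock det1 mulr1 -/(vol_density (gconf q) (lsubmx z)).
exact: vol_gconf.
Qed.

Lemma bls_operatorE (h : 'rV[R]_(2 + 1) -> R) : smooth h -> bls_operator (gconf q) lam h = fun z =>
  laplace_fst (gconf q) (laplace_fst (gconf q) h) z + iter_pderiv [:: i2; i2; i2; i2] h z
  - lam * laplace_fst (gconf q) h z + lam ^+ 2 / 4 * h z.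
Proof.
move=> sh; apply/funext => z; rewrite /bls_operator !laplace_sndE.
have N (f : 'rV[R]_(2 + 1) -> R) i : smooth f -> pderiv i (fun z => - f z) = fun z => - pderiv i f z.
  by move=> sf; apply: pderiv_is => x; apply: isdN; exact: smooth_is_derive.
have s2 : smooth (pderiv i2 (pderiv i2 h)) by do 2 apply: smooth_pderiv.
rewrite (N _ i2 s2) (N _ i2 (smooth_pderiv i2 s2)) opprK.
reflexivity.
Qed.

Lemma tsm_laplace_fst (h : 'rV[R]_(2 + 1) -> R) : tsm h -> tsm (laplace_fst (gconf q) h).
Proof.
move=> th; rewrite laplace_fstE; apply: tsmN; apply: tsmM.
  by apply: tsmV; [exact: fac_neq0|exact: tsm_fac].
by apply: tsmD; do 2 apply: tsm_pderiv.
Qed.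

Lemma laplace_fst_at (h : 'rV[R]_(2 + 1) -> R) z : laplace_fst (gconf q) h z =
  - ((fac z)^-1 * (pderiv i0 (pderiv i0 h) z + pderiv i1 (pderiv i1 h) z)).
Proof. by rewrite laplace_fstE. Qed.

Definition green (i : 'I_(2 + 1)) (u v : 'rV[R]_(2 + 1) -> R) z := u z * pderiv i v z - pderiv i u z * v z.

Lemma tsm_green i u v : tsm u -> tsm v -> tsm (green i u v).
Proof. by move=> tu tv; exact: tsmB (tsmM tu (tsm_pderiv i tv)) (tsmM (tsm_pderiv i tu) tv). Qed.

Lemma pderiv_green i u v : smooth u -> smooth v -> pderiv i (green i u v) = fun z =>
  u z * pderiv i (pderiv i v) z - pderiv i (pderiv i u) z * v z.
Proof.
move=> su sv; apply: pderiv_is => z.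
have su1 := smooth_pderiv i su; have sv1 := smooth_pderiv i sv.
have du f (sf : smooth f) := smooth_is_derive i z sf.
apply: isd_eq (isdB (isdM (du _ su) (du _ sv1)) (isdM (du _ su1) (du _ sv))) _.
move: (pderiv i (pderiv i u) z) (pderiv i (pderiv i v) z) (pderiv i u z) (pderiv i v z) (u z) (v z).
by move=> *; ring.
Qed.

                                                                                       
                                             
Lemma bls_nonnegative : nonnegative (metric_sum (gconf q) (@g_st R)) (bls_operator (gconf q) lam).
Proof.
move=> h /torus_smoothP th0; have th : tsm h by [].
pose g := laplace_fst (gconf q) h.
have tg : tsm g by exact: tsm_laplace_fst.
pose h2 := pderiv i2 (pderiv i2 h).
have th2 : tsm h2 := tsm_pderiv i2 (tsm_pderiv i2 th).
pose Y z := fac z * green i2 h h2 z.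
have tY : tsm Y := tsmM tsm_fac (tsm_green i2 th th2).
have dY : pderiv i2 Y = fun z => fac z * (h z * pderiv i2 (pderiv i2 h2) z - h2 z * h2 z).
  rewrite /Y (pderivM i2 tsm_fac.2 (tsm_green i2 th th2).2) pderiv_fac2 (pderiv_green i2 th.2 th2.2).
  by apply/funext => z; rewrite mul0r add0r.
pose N z := fac z * ((g z - lam / 2 * h z) * (g z - lam / 2 * h z) + h2 z * h2 z).
have tN : tsm N.
  have t1 : tsm (fun z => g z - lam / 2 * h z) := tsmB tg (tsmZ (lam / 2) th).
  exact: tsmM tsm_fac (tsmD (tsmM t1 t1) (tsmM th2 th2)).
have E : (fun z => h z * bls_operator (gconf q) lam h z * vol_density (metric_sum (gconf q) (@g_st R)) z)
  = fun z => ((- 1) * pderiv i0 (green i0 h g) z + (- 1) * pderiv i1 (green i1 h g) z) +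
      (pderiv i2 Y z + N z).
  apply/funext => z; rewrite vol_fac (bls_operatorE th.2) dY.
  rewrite (pderiv_green i0 th.2 tg.2) (pderiv_green i1 th.2 tg.2) -/g.
  have Eg : laplace_fst (gconf q) g z =
      - ((fac z)^-1 * (pderiv i0 (pderiv i0 g) z + pderiv i1 (pderiv i1 g) z)) := laplace_fst_at g z.
  have Eh : g z = - ((fac z)^-1 * (pderiv i0 (pderiv i0 h) z + pderiv i1 (pderiv i1 h) z)) :=
    laplace_fst_at h z.
  have E4 : iter_pderiv [:: i2; i2; i2; i2] h z = pderiv i2 (pderiv i2 h2) z by [].
  rewrite {}E4 {}Eg /N; move: Eh (fac_neq0 z).
  move: (fac z) (g z) (h z) (h2 z) (pderiv i2 (pderiv i2 h2) z) => F G H H2 H4.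
  move: (pderiv i0 (pderiv i0 h) z) (pderiv i1 (pderiv i1 h) z) => a b.
  move: (pderiv i0 (pderiv i0 g) z) (pderiv i1 (pderiv i1 g) z) => c d -> F0.
  by field; rewrite F0.
rewrite E; apply: (integral_div_ge0 i0 i1 i2 (tsm_green i0 th tg) (tsm_green i1 th tg) tY tN) => z.
by rewrite mulr_ge0 ?(ltW (fac_gt0 z)) // -!expr2 addr_ge0 // sqr_ge0.
Qed.
Lemma table_sum (I : finType) (T : seq (seq I * R)) m (G : seq I -> R) :
  \sum_(s : m.-tuple I) (\sum_(p <- T) (p.1 == s)%:R * p.2) * G s =
  \sum_(p <- T | size p.1 == m) p.2 * G p.1.
Proof.
under eq_bigr do rewrite mulr_suml.
rewrite exchange_big [RHS]big_mkcond; apply: eq_bigr => -[u c] _ /=.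
case: ifPn => um.
  rewrite (bigD1 (Tuple um)) //= eqxx mul1r big1 ?addr0 // => s su.
  rewrite (_ : (u == s :> seq I) = false) ?mul0r //.
  by apply: contraNF su => /eqP E; apply/eqP/val_inj; rewrite /= E.
rewrite big1 // => s _; rewrite (_ : (u == s :> seq I) = false) ?mul0r //.
by apply: contraNF um => /eqP ->; rewrite size_tuple.
Qed.

Lemma table_sum_le (I : finType) (T : seq (seq I * R)) m (G : seq I -> R) :
  all (fun p => (size p.1 <= m)%N) T ->
  \sum_(k < m.+1) \sum_(s : k.-tuple I) (\sum_(p <- T) (p.1 == s)%:R * p.2) * G s =
  \sum_(p <- T) p.2 * G p.1.
Proof.
move=> /allP sT; under eq_bigr do rewrite table_sum big_mkcond.
rewrite exchange_big big_seq [RHS]big_seq; apply: eq_bigr => p pT.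
have pm : (size p.1 < m.+1)%N by exact: sT.
rewrite (bigD1 (Ordinal pm)) //= eqxx big1 ?addr0 // => k kp.
by case: ifPn => // /eqP E; case/eqP: kp; apply/val_inj; rewrite /= E.
Qed.

Definition inv_fac (z : 'rV[R]_(2 + 1)) : R := (fac z)^-1.

Lemma tsm_inv_fac : tsm inv_fac.
Proof. exact: tsmV fac_neq0 tsm_fac. Qed.

Let dw i := pderiv i inv_fac.

                                                                                               
Definition bls_symbol (z : 'rV[R]_(2 + 1)) : seq (seq 'I_(2 + 1) * R) :=
  let w := inv_fac z in
  let b := w * (pderiv i0 (dw i0) z + pderiv i1 (dw i1) z) + lam * w in
  [:: ([:: i0; i0; i0; i0], w * w); ([:: i0; i0; i1; i1], w * w);
      ([:: i1; i1; i0; i0], w * w); ([:: i1; i1; i1; i1], w * w);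
      ([:: i2; i2; i2; i2], 1);
      ([:: i0; i0; i0], 2 * (w * dw i0 z)); ([:: i0; i1; i1], 2 * (w * dw i0 z));
      ([:: i1; i0; i0], 2 * (w * dw i1 z)); ([:: i1; i1; i1], 2 * (w * dw i1 z));
      ([:: i0; i0], b); ([:: i1; i1], b); ([::], lam ^+ 2 / 4)].

Lemma pderiv2M i (u v : 'rV[R]_(2 + 1) -> R) : smooth u -> smooth v ->
  pderiv i (pderiv i (fun z => u z * v z)) = fun z =>
  pderiv i (pderiv i u) z * v z + 2 * (pderiv i u z * pderiv i v z) + u z * pderiv i (pderiv i v) z.
Proof.
move=> su sv; rewrite (pderivM i su sv); apply: pderiv_is => z.
have su1 := smooth_pderiv i su; have sv1 := smooth_pderiv i sv.
have du f (sf : smooth f) := smooth_is_derive i z sf.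
apply: isd_eq (isdD (isdM (du _ su1) (du _ sv)) (isdM (du _ su) (du _ sv1))) _.
move: (pderiv i (pderiv i u) z) (pderiv i (pderiv i v) z) (pderiv i u z) (pderiv i v z) (u z) (v z).
by move=> *; ring.
Qed.

Lemma bls_expand h z : smooth h ->
  bls_operator (gconf q) lam h z = \sum_(p <- bls_symbol z) p.2 * iter_pderiv p.1 h z.
Proof.
move=> sh; rewrite bls_operatorE // !laplace_fst_at.
pose F z := pderiv i0 (pderiv i0 h) z + pderiv i1 (pderiv i1 h) z.
have s0 := smooth_pderiv i0 (smooth_pderiv i0 sh); have s1 := smooth_pderiv i1 (smooth_pderiv i1 sh).
have sF : smooth F by move=> k; exact: smnD (s0 k) (s1 k).
have sw := tsm_inv_fac.2.
have Lh : laplace_fst (gconf q) h = fun z => -1 * (inv_fac z * F z).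
  by apply/funext => y; rewrite laplace_fst_at mulN1r.
have E i : pderiv i (pderiv i (laplace_fst (gconf q) h)) z = -1 * (pderiv i (dw i) z * F z +
    2 * (dw i z * pderiv i F z) + inv_fac z * pderiv i (pderiv i F) z).
  have sP : smooth (fun z => inv_fac z * F z) by move=> k; exact: smnM (sw k) (sF k).
  by rewrite Lh (pderivZ i _ sP) (pderivZ i _ (smooth_pderiv i sP)) (pderiv2M i sw sF).
have DF i : pderiv i F = fun z => pderiv i (pderiv i0 (pderiv i0 h)) z + pderiv i (pderiv i1 (pderiv i1 h)) z.
  exact: (pderivD i s0 s1).
have DDF i : pderiv i (pderiv i F) = fun z => pderiv i (pderiv i (pderiv i0 (pderiv i0 h))) z +
    pderiv i (pderiv i (pderiv i1 (pderiv i1 h))) z.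
  by rewrite DF; exact: (pderivD i (smooth_pderiv i s0) (smooth_pderiv i s1)).
rewrite !E !DDF !DF -/(inv_fac z) /F /bls_symbol !big_cons big_nil /=.
move: (inv_fac z) (dw i0 z) (dw i1 z) (pderiv i0 (dw i0) z) (pderiv i1 (dw i1) z) => w w0 w1 w00 w11.
move: (@pderiv R (2 + 1) i0) (@pderiv R (2 + 1) i1) (@pderiv R (2 + 1) i2) => p0 p1 p2.
by field.
Qed.

Lemma bls_coef_tsm (s : seq 'I_(2 + 1)) : tsm (fun z => \sum_(p <- bls_symbol z) (p.1 == s)%:R * p.2).
Proof.
have w_ := tsm_inv_fac; have d i : tsm (dw i) := tsm_pderiv i w_.
have dd i : tsm (pderiv i (dw i)) := tsm_pderiv i (d i).
have tb : tsm (fun z => inv_fac z * (pderiv i0 (dw i0) z + pderiv i1 (dw i1) z) + lam * inv_fac z) :=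
  tsmD (tsmM w_ (tsmD (dd i0) (dd i1))) (tsmZ lam w_).
have tww := tsmM w_ w_.
have t2 i : tsm (fun z => 2 * (inv_fac z * dw i z)) := tsmZ 2 (tsmM w_ (d i)).
have tc c : tsm (fun _ : 'rV[R]_(2 + 1) => c : R) := @tsm_cst _ _ c.
have step (b : bool) u v : tsm u -> tsm v -> tsm (fun z : 'rV[R]_(2 + 1) => b%:R * u z + v z) by
  move=> tu tv; exact: tsmD (tsmZ b%:R tu) tv.
rewrite /bls_symbol.
under eq_fun do rewrite !big_cons big_nil /=.
exact (step _ _ _ tww (step _ _ _ tww (step _ _ _ tww (step _ _ _ tww (step _ _ _ (tc 1)
    (step _ _ _ (t2 i0) (step _ _ _ (t2 i0) (step _ _ _ (t2 i1) (step _ _ _ (t2 i1)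
    (step _ _ _ tb (step _ _ _ tb (step _ _ _ (tc _) (tc 0))))))))))))).
Qed.

Lemma bls_principal z (xi : 'rV[R]_(2 + 1)) : xi != 0 ->
  \sum_(p <- bls_symbol z | size p.1 == 4) p.2 * \prod_(i <- p.1) xi 0 i != 0.
Proof.
move=> xi0; rewrite -big_filter /= !big_cons !big_nil /=.
have w0 : 0 < inv_fac z by rewrite invr_gt0 fac_gt0.
move: (inv_fac z) w0 => w w0.
have [i xii] : exists i, xi 0 i != 0.
  apply/existsP; apply: contraNT xi0; rewrite negb_exists => /forallP h.
  by apply/eqP/rowP => i; rewrite mxE; apply/eqP; rewrite -[_ == _]negbK; exact: h.
have : (i == i0) || ((i == i1) || (i == i2)).
  by case: i {xii} => [[|[|[|//]]] ?].
move=> I; suff : 0 < (w * (xi 0 i0 ^+ 2 + xi 0 i1 ^+ 2)) ^+ 2 + (xi 0 i2 ^+ 2) ^+ 2.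
  move=> /lt0r_neq0; apply: contraNN => /eqP E; apply/eqP; rewrite -[RHS]E.
  move: (xi 0 i0) (xi 0 i1) (xi 0 i2) => a b c.
  ring.
have sq (a : R) : a != 0 -> 0 < a ^+ 2 by move=> a0; rewrite exprn_even_gt0.
move: I xii => /or3P[] /eqP -> x0.
- by rewrite ltr_pwDl ?sqr_ge0 // exprn_gt0 // mulr_gt0 // ltr_pwDl ?sqr_ge0 // sq.
- by rewrite ltr_pwDl ?sqr_ge0 // exprn_gt0 // mulr_gt0 // ltr_wpDl ?sqr_ge0 // sq.
- by rewrite ltr_wpDl ?sqr_ge0 // exprn_gt0 // sq.
Qed.

Lemma bls_elliptic : elliptic 4 (bls_operator (gconf q) lam).
Proof.
exists (fun s z => \sum_(p <- bls_symbol z) (p.1 == s)%:R * p.2); split.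
- by move=> s; apply/torus_smoothP; exact: bls_coef_tsm.
- move=> h /torus_smoothP[_ sh] z; rewrite (bls_expand z sh).
  by rewrite (table_sum_le (fun s => iter_pderiv s h z)).
- by move=> z xi xi0; rewrite (table_sum (bls_symbol z) 4 (fun s => \prod_(i <- s) xi 0 i)) bls_principal.
Qed.
Lemma laplace_fst_prod (u : 'rV[R]_2 -> R) (v : 'rV[R]_1 -> R) : smooth u ->
  laplace_fst (gconf q) (fun z : 'rV[R]_(2 + 1) => u (lsubmx z) * v (rsubmx z)) =
  fun z => laplace (gconf q) u (lsubmx z) * v (rsubmx z).
Proof.
move=> su; apply/funext => z; rewrite /laplace_fst !(laplace_gconf q0).
have E : (fun x => u (lsubmx (row_mx x (rsubmx z))) * v (rsubmx (row_mx x (rsubmx z)))) =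
   fun x => v (rsubmx z) * u x by apply/funext => x; rewrite row_mxKl row_mxKr mulrC.
rewrite E !(pderivZ _ _ su) !pderivZ; try exact: smooth_pderiv.
by rewrite -mulrDr mulNr mulrCA [in RHS]mulrC.
Qed.

Lemma bls_operator_eigen (f : 'rV[R]_2 -> R) (c : R) (j : nat) : (0 < j)%N -> tsm f ->
  (forall x, laplace (gconf q) f x = lam * f x) -> (exists x, f x - c != 0) ->
  eigenfunction (bls_operator (gconf q) lam) (j%:R ^+ 4 + lam ^+ 2 / 4)
    (fun z : 'rV[R]_(2 + 1) => (f (lsubmx z) - c) * sin (j%:R * rsubmx z 0 0)).
Proof.
move=> j0 tf ef [x0 fx0]; have sf := tf.2.
have j1 : 0 < j%:R :> R by rewrite ltr0n.
pose F x := f x - c; pose S (y : 'rV[R]_1) := sin (j%:R * y 0 0); pose C (y : 'rV[R]_1) := cos (j%:R * y 0 0).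
have sF : smooth F by move=> k; apply: smnB; [exact: sf|exact: smn_cst].
have arg k : smn k (fun y : 'rV[R]_1 => j%:R * y 0 0) by apply: smnZ; exact: smn_coord.
have sS : smooth S by move=> k; exact: (smn_comp (csm_sincos R k).1 (arg k)).
have sC : smooth C by move=> k; exact: (smn_comp (csm_sincos R k).2 (arg k)).
have tP : tsm (fun z : 'rV[R]_(2 + 1) => F (lsubmx z) * S (rsubmx z)).
  split=> [k z|k]; last by apply: smnM; [exact: (smn_lsubmx 1 (sF k))|exact: (smn_rsubmx 2 (sS k))].
  by rewrite /F /S !linearD /= period_lsubmx period_rsubmx tf.1 sin_period.
have da y : is_derive y (delta_mx 0 0) (fun y : 'rV[R]_1 => j%:R * y 0 0) j%:R.
  by apply: isd_eq (isdZ j%:R (isd_coord 0 0 y)) _; rewrite eqxx mulr1.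
have dS : pderiv 0 S = fun y => j%:R * C y.
  by apply: pderiv_is => y; apply: isd_eq (isd_comp (is_derive_sin _) (da y)) _; rewrite mulrC.
have dC : pderiv 0 C = fun y => - (j%:R * S y).
  by apply: pderiv_is => y; apply: isd_eq (isd_comp (is_derive_cos _) (da y)) _; rewrite mulNr mulrC.
have d2S : pderiv 0 (pderiv 0 S) = fun y => - (j%:R ^+ 2) * S y.
  by rewrite dS (pderivZ 0 _ sC) dC; apply/funext => y; rewrite mulrN mulrA expr2 mulNr.
have dr (v : 'rV[R]_1 -> R) : smooth v -> pderiv i2 (fun z : 'rV[R]_(2 + 1) => F (lsubmx z) * v (rsubmx z))
    = fun z => F (lsubmx z) * pderiv 0 v (rsubmx z).
  move=> sv; apply: pderiv_is => z.
  apply: isd_eq (isdM (isd_lsubmx0 F 0 z) (isd_rsubmx (smooth_is_derive 0 _ sv))) _.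
  by rewrite mul0r add0r.
have sS1 := smooth_pderiv 0 sS; have sS2 := smooth_pderiv 0 sS1; have sS3 := smooth_pderiv 0 sS2.
have d4 : iter_pderiv [:: i2; i2; i2; i2] (fun z : 'rV[R]_(2 + 1) => F (lsubmx z) * S (rsubmx z)) =
    fun z => j%:R ^+ 4 * (F (lsubmx z) * S (rsubmx z)).
  rewrite /= (dr _ sS) (dr _ sS1) (dr _ sS2) (dr _ sS3) d2S (pderivZ 0 _ sS) (pderivZ 0 _ sS1) d2S.
  by apply/funext => z; ring.
have lF : laplace (gconf q) F = fun x => lam * f x.
  apply/funext => x; rewrite -ef !(laplace_gconf q0).
  have dF i : pderiv i F = pderiv i f.
    by rewrite /F (pderivB i sf (fun k => @smn_cst R 2 k c : smn k (fun _ : 'rV[R]_2 => c))) pderiv_cst; apply/funext => y; rewrite subr0.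
  by rewrite !dF.
have slf : smooth (fun x => lam * f x) by move=> k; exact: smnZ.
have llf : laplace (gconf q) (fun x => lam * f x) = fun x => lam * (lam * f x).
  by apply/funext => x; rewrite (laplace_gconfZ lam x q0 sf) ef.
split.
- by apply/torus_smoothP; exact: tP.
- exists (row_mx x0 (const_mx (pi / 2 / j%:R))).
  rewrite row_mxKl row_mxKr mxE (mulrC j%:R).
  rewrite divfK; last by rewrite gt_eqF.
  by rewrite sin_pihalf mulr1.
move=> z; rewrite (bls_operatorE tP.2) (laplace_fst_prod S sF) lF (laplace_fst_prod S slf) llf d4.
by rewrite /F -/(S (rsubmx z)); move: (S _) (f _) => *; field.
Qed.
End Operator.

Theorem proposition1p11 (R : realType) (K : fieldType) :
  exists (g : 'rV[R]_2 -> 'M[R]_2) (f : nat -> 'rV[R]_2 -> R)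
    (lam c : nat -> R),
             
    [/\ riemannian_metric g,
        forall j, (1 <= j)%N -> eigenfunction (laplace g) (lam j) (f j),
        lam j @[j --> \oo] --> +oo &
        forall j, (1 <= j)%N ->
          nodal_betti K 0 (fun x => f j x - c j) = +oo%E] /\
              
    (forall j, (1 <= j)%N ->
       let u := fun_sum (f j) (fun y => - f j y) in
       eigenfunction (laplace (metric_sum g g)) (lam j) u /\
       nodal_betti K 1 u = +oo%E) /\
               
    let F := fun x => f 1%N x - c 1%N in
    let D := bls_operator g (lam 1%N) in
    [/\ nonnegative (metric_sum g (@g_st R)) D,
        elliptic 4 D &
        forall j, (1 <= j)%N ->
          let h := fun z : 'rV[R]_(2 + 1) =>
            F (lsubmx z) * sin (j%:R * rsubmx z 0 0) in
          eigenfunction D (j%:R ^+ 4 + lam 1%N ^+ 2 / 4) h /\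
          nodal_betti K 0 h = +oo%E].
Proof.
have [q [lam [c [c1 [s [s1 [qs q0 qper data]]]]]]] := bls_data R.
pose f j := bls_fun (lam j) (c j) (s j).
pose h j := bls_diag (lam j) (c j) (s j).
have lam0 j : (1 <= j)%N -> 0 < lam j.
  move=> j1; have [jl _ _ _ _] := data j j1; apply: lt_le_trans jl.
  by rewrite mulr_gt0 // exprn_gt0 // ltr0n.
have tf j : (1 <= j)%N -> tsm (f j).
  move=> j1; have [_ [hc hs] [per _] [c0 s0] _] := data j j1.
  split; [exact: bls_periodic (fun x => (per x).1) (fun x => (per x).2)|exact: smooth_bls qs hc hs].
have ef j : (1 <= j)%N -> eigenfunction (laplace (gconf q)) (lam j) (f j).
  move=> j1; have [_ [hc hs] [per _] [c0 s0] _] := data j j1.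
  exact: (bls_eigen qs q0 hc hs (fun x => (per x).1) (fun x => (per x).2) c0 s0).
have fcont j (j1 : (1 <= j)%N) : continuous (f j) := smn_cont ((tf j j1).2 0%N).
have fd j (x : 'rV[R]_2) : x 0 0 = x 0 1 -> f j x = h j (x 0 0).
  by move=> E; rewrite /f /h /bls_fun /bls_diag -E.
have fCS j (j1 : (1 <= j)%N) := bls_CS (c j) (s j) (lam0 j j1).
have h_ge0 j (j1 : (1 <= j)%N) t : 0 <= h j t.
  by rewrite /h /bls_diag -!expr2 addr_ge0 ?sqr_ge0 // mulr_ge0 ?sqr_ge0 // ltW // lam0.
have h0 j (j1 : (1 <= j)%N) : h j 0 = 1.
  by have [_ _ _ [c0 s0] _] := data j j1; rewrite /h /bls_diag c0 s0 !mulr0 addr0 mulr1.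
have hper j (j1 : (1 <= j)%N) t : h j (t + 2 * pi) = h j t.
  by have [_ _ [per _] _ _] := data j j1; rewrite /h /bls_diag !(per t).1 !(per t).2.
have heven j (j1 : (1 <= j)%N) t : h j (- t) = h j t.
  by have [_ _ [_ ev] _ _] := data j j1; rewrite /h /bls_diag !(ev t).1 !(ev t).2 mulrNN.
have hpeaks j (j1 : (1 <= j)%N) : has_peaks (h j) by have [_ _ _ _ ?] := data j j1.
exists (gconf q), f, lam, (fun=> 1); split; [split|split].
- exact: gconf_metric.
- exact: ef.
- apply/cvgryPge => A; near=> j.
  have j1 : (1 <= j)%N by near: j; exact: nbhs_infty_gt.
  have jA : `|A| <= j%:R by near: j; exact: nbhs_infty_ger.
  have [jl _ _ _ _] := data j j1; apply: le_trans jl.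
  have jr : 1 <= j%:R :> R by rewrite ler1n.
  by have := ler_norm A; move: jA jr; set x := j%:R; nra.
- move=> j j1; exact: (betti0_bls (fcont j j1) (tf j j1).1 (fd j) (fCS j j1) (h_ge0 j j1) (hper j j1) (heven j j1) (hpeaks j j1)).
- move=> j j1 u; have sf := (tf j j1).2; split; last first.
    exact: (betti1_bls (fcont j j1) (tf j j1).1 (fd j) (fCS j j1) (h_ge0 j j1) (h0 j j1) (hper j j1) (heven j j1) (hpeaks j j1)).
  have [_ [x fx] ej] := ef j j1.
  have uE : u = fun z => f j (lsubmx z) - f j (rsubmx z) by [].
  split.
  + apply/torus_smoothP; rewrite uE; split=> [k z|k].
      exact: (diff_fun_per (tf j j1).1).
    by apply: smnB; [exact: (smn_lsubmx 2 (sf k))|exact: (smn_rsubmx 2 (sf k))].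
  + have [y [yp [_ hy _ _ _]]] := hpeaks j j1 1 ltr01.
    exists (row_mx (const_mx y) 0); rewrite uE row_mxKl row_mxKr !fd !mxE // h0 //.
    by rewrite subr_eq0 gt_eqF.
  + move=> z; rewrite /u laplace_sum //; last by move=> k; exact: smnN (sf k).
    rewrite (laplace_gconfN (rsubmx z) q0 sf) !ej.
    by rewrite -mulrBr.
move=> F D; have l1 : (1 <= 1)%N by [].
split.
- exact: bls_nonnegative.
- exact: bls_elliptic.
move=> j j1 g; split; last first.
  exact: (betti0_product (fcont _ l1) (tf _ l1).1 (fd _) (fCS _ l1) (h_ge0 _ l1) (hper _ l1) (heven _ l1) (hpeaks _ l1)).
apply: bls_operator_eigen => //; [exact: tf|by have [] := ef _ l1|].
have [y [yp [_ hy _ _ _]]] := hpeaks _ l1 1 ltr01.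
by exists (const_mx y); rewrite fd !mxE // subr_eq0 gt_eqF.
Unshelve. all: by end_near.
Qed.
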